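(* Let $V$ be a vertex operator algebra with an automorphism $g$, let $W_1$ be an untwisted $V$-module, let $W_2,W_3$ be $g$-twisted $V$-modules, and let $\mathcal{Y}(\cdot,x)\cdot:W_1\otimes W_2\to W_3\{x\}[\log x]$ be a twisted intertwining operator of type $\binom{W_3}{W_1\,W_2}$. Then for all $\alpha\in\mathbb{C}$ with $\Re(\alpha)\in[0,1)$, all $u\in V^{[\alpha]}$ and all $w_1\in W_1$, the following identity holds (as formal series of maps acting on $W_2$): $$x_0^{-1}\delta\Big(\frac{x_1-x_2}{x_0}\Big)x_1^{\alpha}Y_{W_3,0}(u,x_1)\mathcal{Y}(w_1,x_2)-x_0^{-1}\delta\Big(\frac{-x_2+x_1}{x_0}\Big)x_1^{\alpha}\mathcal{Y}(w_1,x_2)Y_{W_2,0}(u,x_1)=x_1^{-1}\delta\Big(\frac{x_2+x_0}{x_1}\Big)\mathcal{Y}\big(Y_{W_1}\big((x_2+x_0)^{\mathcal{L}}u,x_0\big)w_1,x_2\big).$$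
   Context: FORMAL CALCULUS. All vector spaces are over $\mathbb{C}$; $\mathrm{i}=\sqrt{-1}$. Formal variables $x,x_j,\log x,\log x_j$ commute; $W\{x_1,\dots,x_n\}$ is the space of formal series in arbitrary complex powers of the $x_j$ with coefficients in $W$; $\frac{\partial}{\partial x_i}$ is the derivation with $\frac{\partial}{\partial x_i}x_j^n=nx_i^{n-1}\delta_{ij}$, $\frac{\partial}{\partial x_i}\log x_j=x_i^{-1}\delta_{ij}$. $\delta(x)=\sum_{n\in\mathbb{Z}}x^n$. Powers of binomials such as $(x_1-x_2)^n$ are expanded in nonnegative integral powers of the second-written variable, and $\log(x+x_1)=\log x+\log(1+x_1/x)$. For $z\in\mathbb{C}^\times$ let $0\le\arg z<2\pi$ and $l_p(z)=\log|z|+(\arg z+2p\pi)\mathrm{i}$ for $p\in\mathbb{Z}$; for a formal series $f$, $f^{p_1,\dots,p_n}(z_1,\dots,z_n)=f|^{p_1,\dots,p_n}_{x_1=z_1,\dots,x_n=z_n}$ denotes the substitution $x_j^r\mapsto e^{r\,l_{p_j}(z_j)}$, $\log x_j\mapsto l_{p_j}(z_j)$. VERTEX OPERATOR ALGEBRA. $V=(V,Y,\mathbf 1,\omega)$ is a vertex operator algebra, $V=\coprod_{n\in\mathbb{Z}}V_{(n)}$ its $L(0)$-grading. An automorphism $g$ is a linear automorphism with $gY(u,x)v=Y(gu,x)gv$, $g\mathbf 1=\mathbf 1$, $g\omega=\omega$. Write $g=e^{2\pi\mathrm{i}\mathcal{L}}$ on $V$ with $\mathcal{L}=\mathcal{S}+\mathcal{N}$,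 where $\mathcal{S}$ is semisimple, $\mathcal{N}$ is locally nilpotent, they commute, and the eigenvalues of $\mathcal{S}$ have real part in $[0,1)$. $V^{[\alpha]}$ is the space of generalized eigenvectors of $g$ with eigenvalue $e^{2\pi\mathrm{i}\alpha}$ (for $\Re(\alpha)\in[0,1)$, the $\alpha$-eigenspace of $\mathcal{S}$). If $\mathcal{S}u=\alpha u$, then $x^{\mathcal{L}}u=x^{\alpha}\sum_{k\ge0}\frac{(\log x)^k}{k!}\mathcal{N}^ku$; $(1+x)^{\mathcal{L}}=\sum_{k\ge0}\binom{\mathcal{L}}{k}x^k$ with $\binom{\mathcal{L}}{k}=\mathcal{L}(\mathcal{L}-1)\cdots(\mathcal{L}-k+1)/k!$; and $(x_2+x_0)^{\mathcal{L}}=x_2^{\mathcal{L}}(1+x_0/x_2)^{\mathcal{L}}$. TWISTED MODULES. A $g$-twisted $V$-module is a $\mathbb{C}$-graded space $W=\coprod_{n\in\mathbb{C}}W_{[n]}$ with $\dim W_{[n]}<\infty$ and $W_{[n+l]}=0$ for all sufficiently negative integers $l$, with a linear map $Y_W:V\otimes W\to W\{x\}[\log x]$, $Y_W(u,x)w=\sum_{k=0}^{K}\sum_{n\in\mathbb{C}}u_{n,k}w\,x^{-n-1}(\log x)^k$, such that: (equivariance) $Y_W^{p+1}(gu,z)w=Y_W^{p}(u,z)w$ for $p\in\mathbb{Z}$, where $Y_W^p(u,z)w=Y_W(u,x)w|^p_{x=z}$; (identity) $Y_W(\mathbf 1,x)w=w$; (duality) for $u,v\in V$, $w\in W$, $w'\in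 W'=\coprod_n W_{[n]}^*$ there is $f(z_1,z_2)=\sum a_{ijkl}z_1^{m_i}z_2^{n_j}(\log z_1)^k(\log z_2)^l(z_1-z_2)^{-t}$ (finite sum, $m_i,n_j\in\mathbb{C}$, $t\in\mathbb{Z}_{\ge0}$) such that $\langle w',Y_W^p(u,z_1)Y_W^p(v,z_2)w\rangle$, $\langle w',Y_W^p(v,z_2)Y_W^p(u,z_1)w\rangle$, $\langle w',Y_W^p(Y(u,z_1-z_2)v,z_2)w\rangle$ converge absolutely for $|z_1|>|z_2|>0$, $|z_2|>|z_1|>0$, $|z_2|>|z_1-z_2|>0$, respectively, to the branch $f^{p,p}(z_1,z_2)$ (in the third case when $|\arg z_1-\arg z_2|<\pi/2$); ($L(0)$-grading) $W_{[n]}$ is the generalized $n$-eigenspace of $L(0)$, the coefficient of $x^{-2}(\log x)^0$ in $Y_W(\omega,x)$; ($L(-1)$-derivative) $\frac{d}{dx}Y_W(u,x)=Y_W(L(-1)u,x)$. No $g$-action on $W$ is required. An untwisted $V$-module is a $1$-twisted module ($1=\mathrm{id}_V$). $Y_{W,0}(u,x)=\sum_{n\in\mathbb{C}}u_{n,0}x^{-n-1}$ denotes the $\log x$-free part of $Y_W(u,x)$. TWISTED INTERTWINING OPERATORS. For $g_i$-twisted $V$-modules $W_i$ ($i=1,2,3$), a twisted intertwining operator of type $\binom{W_3}{W_1\,W_2}$ is a linear map $\mathcal{Y}(\cdot,x)\cdot:W_1\otimes W_2\to W_3\{x\}[\log x]$, $w_1\otimes w_2\mapsto\sum_{k=0}^K\sum_{n\in\mathbb{C}}\mathcal{Y}_{n,k}(w_1)w_2x^{-n-1}(\log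 x)^k$, such that: (i) $\mathcal{Y}_{n+l,k}(w_1)w_2=0$ for all sufficiently large $l\in\mathbb{Z}$; (ii) $\frac{d}{dx}\mathcal{Y}(w_1,x)=\mathcal{Y}(L(-1)w_1,x)$; (iii) for $u\in V$, $w_1\in W_1$, $w_2\in W_2$, $w_3'\in W_3'$ there is a finite sum $f(x_0,x_1,x_2)=\sum a_{ijklmn}x_0^{r_i}x_1^{s_j}x_2^{t_k}(\log x_0)^l(\log x_1)^m(\log x_2)^n$ such that for $p_1,p_2,p_{12}\in\mathbb{Z}$ the series $\langle w_3',Y_{W_3}^{p_1}(u,z_1)\mathcal{Y}^{p_2}(w_1,z_2)w_2\rangle$, $\langle w_3',\mathcal{Y}^{p_2}(w_1,z_2)Y_{W_2}^{p_1}(u,z_1)w_2\rangle$, $\langle w_3',\mathcal{Y}^{p_2}(Y_{W_1}^{p_{12}}(u,z_1-z_2)w_1,z_2)w_2\rangle$ converge absolutely for $|z_1|>|z_2|>0$, $|z_2|>|z_1|>0$, $|z_2|>|z_1-z_2|>0$ respectively, and converge to $f^{p_1,p_1,p_2}(z_1-z_2,z_1,z_2)$, $f^{p_2,p_1,p_2}(z_1-z_2,z_1,z_2)$, $f^{p_{12},p_2,p_2}(z_1-z_2,z_1,z_2)$ in the respective subregions $-\frac\pi2<\arg(z_1-z_2)-\arg z_1<\frac\pi2$; $-\frac{3\pi}2<\arg(z_1-z_2)-\arg z_1<-\frac\pi2$; $-\frac\pi2<\arg z_1-\arg z_2<\frac\pi2$.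
   Formalization: Added: for every element of the graded dual, the series Y_W(u,x)w and 𝒴(w₁,x)w₂ paired with it have only finitely many nonzero terms; without this, infinite series in complex powers that sum to zero at all points can be added to 𝒴 and the identity fails. *)

(* Defs.v *)
From HB Require Import structures.
From mathcomp Require Import all_boot all_order all_algebra finmap.
From mathcomp Require Import all_classical all_reals all_analysis.
From mathcomp Require Import complex.
From mathcomp Require summability.

Set Implicit Arguments.
Unset Strict Implicit.
Unset Printing Implicit Defensive.
Import Order.TTheory GRing.Theory Num.Theory.
Import numFieldNormedType.Exports.

Local Open Scope classical_set_scope.
Local Open Scope ring_scope.
Local Open Scope complex_scope.

(* A formal series with coefficients in W is a function M -> W on a           *)
(* commutative monoid M of (exponents of) monomials, written additively.  The *)
(* sums below have finite support in every use that is made of them (they     *)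
(* would be 0 otherwise).                                                     *)
Section FormalSeries.
Variable M : nmodType.

(* \sum_i c_i X^(e_i) *)
Definition fsum (I : choiceType) (W : nmodType) (c : I -> W) (e : I -> M) :
    M -> W :=
  fun m => \sum_(i \in [set i | e i = m]) c i.

(* The product A(X) f(X), where A(X) is a linear map from U to series and f   *)
(* is a series with coefficients in U.                                        *)
Definition fapply (U : Type) (W : nmodType) (A : U -> M -> W) (f : M -> U) :
    M -> W :=
  fun m => \sum_(p \in [set p : M * M | p.1 + p.2 = m]) A (f p.1) p.2.

Definition fmul (K : pzRingType) (W : lmodType K) (f : M -> K) (h : M -> W) :
    M -> W :=
  fapply (fun c m => c *: h m) f.

Definition fmonomial (K : pzRingType) (e : M) : M -> K :=
  fun m => if m == e then 1 else 0.

End FormalSeries.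

Section Complex.
Variable R : realType.
Local Notation C := R[i].

Definition cabs (z : C) : R := complex.Re `|z|.

Definition cexp (z : C) : C :=
  (expR (complex.Re z) * cos (complex.Im z)) +i*
  (expR (complex.Re z) * sin (complex.Im z)).

(* The argument in [0, 2 pi) (for z != 0). *)
Definition carg (z : C) : R :=
  let t := acos (complex.Re z / cabs z) in
  if 0 <= complex.Im z then t else pi *+ 2 - t.

Definition clog (p : int) (z : C) : C :=
  ln (cabs z) +i* (carg z + (pi *+ 2) * p%:~R).

Definition abs_summable (I : choiceType) (a : I -> C) : Prop :=
  esum.summable [set: I] (fun i => (cabs (a i))%:E).

Definition sums_to (I : choiceType) (a : I -> C) (s : C) : Prop :=
  summability.partial_sum a @ summability.totally --> (s : C^o).

Definition binom (a : C) (k : nat) : C :=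
  (\prod_(i < k) (a - i%:R)) / (k`!)%:R.

End Complex.

Section Monomials.
Variable R : realType.
Local Notation C := R[i].

(* (r, k) stands for x^r (log x)^k. *)
Definition lmono : Type := (C * nat)%type.
HB.instance Definition _ := GRing.Nmodule.on lmono.

(* Monomials in x_0, ..., x_(n-1) and log x_0, ..., log x_(n-1). *)
Definition lmonos (n : nat) : Type := {ffun 'I_n -> lmono}.
HB.instance Definition _ n := GRing.Nmodule.on (lmonos n).

Definition at_var n (i : 'I_n) (a : lmono) : lmonos n :=
  [ffun j => if j == i then a else 0].

Definition xpow n (i : 'I_n) (r : C) : lmonos n := at_var i (r, 0%N).

(* A series s(x) in one variable, read in the variable x_i. *)
Definition in_var (W : nmodType) n (i : 'I_n) (s : lmono -> W) : lmonos n -> W :=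
  fsum s (at_var i).

Definition of_laurent (W : nmodType) (s : int -> W) : lmono -> W :=
  fsum s (fun n : int => (n%:~R, 0%N) : lmono).

Definition log_free (W : nmodType) (s : lmono -> W) : lmono -> W :=
  fun m => if m.2 == 0%N then s m else 0.

Definition fderiv (W : lmodType C) (s : lmono -> W) : lmono -> W :=
  fun m => (m.1 + 1) *: s (m.1 + 1, m.2) + (m.2.+1)%:R *: s (m.1 + 1, m.2.+1).

Definition log_bounded (W : nmodType) (s : lmono -> W) : Prop :=
  exists K : nat, forall r k, (K < k)%N -> s (r, k) = 0.

(* x_a^-1 delta((s x_b + t x_c) / x_a) for signs s and t, that is,            *)
(*   \sum_(n : int) (s x_b + t x_c)^n x_a^(- n - 1),                          *)
(* expanded in nonnegative powers of x_c.                                     *)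
Definition fdelta n (a b c : 'I_n) (s t : C) : lmonos n -> C :=
  fsum (fun p : int * nat =>
          binom p.1%:~R p.2 * s ^ (p.1 - p.2%:Z) * t ^+ p.2)
       (fun p : int * nat =>
          xpow a (- p.1%:~R - 1) + xpow b (p.1%:~R - p.2%:R) + xpow c p.2%:R).

(* The substitution x^r |-> e^(r l_p(z)), log x |-> l_p(z). *)
Definition mono_at (p : int) (z : C) (m : lmono) : C :=
  cexp (m.1 * clog p z) * clog p z ^+ m.2.

Definition eval_at (p : int) (z : C) (s : lmono -> C) : C :=
  \sum_(m \in [set: lmono]) s m * mono_at p z m.

(* Finite sums of terms a x_0^(r_0) (log x_0)^(k_0) x_1^(r_1) ..., and their  *)
(* branches.                                                                  *)
Definition logpoly (n : nat) : Type := seq (C * lmonos n).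

Definition lp_eval n (f : logpoly n) (p : n.-tuple int) (z : n.-tuple C) : C :=
  \sum_(c <- f) c.1 * \prod_(i < n) mono_at (tnth p i) (tnth z i) (c.2 i).

End Monomials.

Definition x0 : 'I_3 := @Ordinal 3 0 isT.
Definition x1 : 'I_3 := @Ordinal 3 1 isT.
Definition x2 : 'I_3 := @Ordinal 3 2 isT.

Section Graded.
Variables (R : realType) (W : lmodType R[i]).
Local Notation C := R[i].

Definition fin_dim_subspace (A : set W) : Prop :=
  exists (d : nat) (b : 'I_d -> W),
    A = [set w | exists c : 'I_d -> C, w = \sum_i c i *: b i].

Definition direct_sum (I : choiceType) (gr : I -> set W) : Prop :=
  (forall w, exists (s : seq I) (f : I -> W),
     (forall i, gr i (f i)) /\ w = \sum_(i <- s) f i) /\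
  (forall (s : seq I) (f : I -> W), uniq s -> (forall i, gr i (f i)) ->
     \sum_(i <- s) f i = 0 -> forall i, i \in s -> f i = 0).

(* The elements of the coproduct of the duals of the homogeneous subspaces,   *)
(* as linear functionals on the whole space.                                  *)
Definition graded_dual (gr : C -> set W) (w' : W -> C) : Prop :=
  scalar w' /\
  exists s : seq C, forall n, n \notin s -> forall w, gr n w -> w' w = 0.

(* The substitution x = z in a series with coefficients in W is an element of *)
(* the product of the homogeneous subspaces; this makes sense when every      *)
(* homogeneous component of the series is a finite sum.                       *)
Definition fin_components (gr : C -> set W) (s : lmono R -> W) : Prop :=
  forall w', graded_dual gr w' -> finite_set [set m | w' (s m) != 0].

Definition gen_eigenspace (T : W -> W) (a : C) : set W :=
  [set w | exists m : nat, iter m (fun v => T v - a *: v) w = 0].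

(* T (T - 1) ... (T - k + 1) / k! *)
Fixpoint op_binom (T : W -> W) (k : nat) (w : W) : W :=
  if k is j.+1 then
    let v := op_binom T j w in (j.+1%:R)^-1 *: (T v - j%:R *: v)
  else w.

End Graded.

(* [voa_Y u v n] is the coefficient of x^n in Y(u, x) v; thus L(n), the       *)
(* coefficient of x^(- n - 2) in Y(omega, x), is [voa_L n].                   *)
(* In the Jacobi identity, x_0^-1 delta((x_2 - x_1) / (- x_0)) is written as  *)
(* x_0^-1 delta((- x_2 + x_1) / x_0).                                         *)
Record voa (R : realType) := Voa {
  voa_space :> lmodType R[i];
  voa_Y : voa_space -> voa_space -> int -> voa_space;
  voa_one : voa_space;
  voa_omega : voa_space;
  voa_gr : int -> set voa_space;
  voa_c : R[i];
  voa_L := fun (n : int) v => voa_Y voa_omega v (- n - 2);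
  voa_linl : forall v n, linear (fun u => voa_Y u v n);
  voa_linr : forall u n, linear (fun v => voa_Y u v n);
  voa_direct : direct_sum voa_gr;
  voa_fin_dim : forall n, fin_dim_subspace (voa_gr n);
  voa_gr_lower : exists n0 : int, forall n : int, n < n0 -> voa_gr n = [set 0];
  voa_lower : forall u v, exists n0 : int, forall n : int, n < n0 -> voa_Y u v n = 0;
  voa_one_gr : voa_gr 0 voa_one;
  voa_omega_gr : voa_gr 2 voa_omega;
  voa_identity : forall v n, voa_Y voa_one v n = if n == 0 then v else 0;
  voa_creation_lower : forall u (n : int), n < 0 -> voa_Y u voa_one n = 0;
  voa_creation : forall u, voa_Y u voa_one 0 = u;
  voa_jacobi : forall u v w,
    let Y := fun a (i : 'I_3) b => in_var i (of_laurent (voa_Y a b)) in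
    fmul (fdelta x0 x1 x2 1 (-1)) (fapply (Y u x1) (Y v x2 w))
    \- fmul (fdelta x0 x2 x1 (-1) 1) (fapply (Y v x2) (Y u x1 w))
    =1 fmul (fdelta x2 x1 x0 1 (-1)) (fapply (fun a => Y a x2 w) (Y u x0 v));
  voa_virasoro : forall (m n : int) v,
    voa_L m (voa_L n v) - voa_L n (voa_L m v)
    = (m - n)%:~R *: voa_L (m + n) v
      + (if m + n == 0 then ((m ^+ 3 - m)%:~R / 12%:R * voa_c) *: v else 0);
  voa_L0 : forall n v, voa_gr n v -> voa_L 0 v = n%:~R *: v;
  voa_derivative : forall u v n,
    voa_Y (voa_L (-1) u) v n = (n + 1)%:~R *: voa_Y u v (n + 1)
}.

Section Automorphisms.
Variables (R : realType) (V : voa R).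
Local Notation C := R[i].

Definition voa_automorphism (g : V -> V) : Prop :=
  [/\ linear g, bijective g,
      forall u v n, g (voa_Y u v n) = voa_Y (g u) (g v) n,
      g (voa_one V) = voa_one V & g (voa_omega V) = voa_omega V].

Definition twopii : C := 0 +i* (pi *+ 2).

(* g = e^(2 pi i (S + N)) with S semisimple, N locally nilpotent, S and N     *)
(* commuting, and the eigenvalues of S of real part in [0, 1).  On the        *)
(* a-eigenspace of S, e^(2 pi i (S + N)) is e^(2 pi i a) e^(2 pi i N).        *)
Definition is_log (g S N : V -> V) : Prop :=
  [/\ linear S /\ linear N,
      direct_sum (fun a : C => [set v : V | S v = a *: v]),
      (forall v, exists m : nat, iter m N v = 0)
        /\ (forall v, S (N v) = N (S v)),
      forall a v, S v = a *: v -> v != 0 -> 0 <= complex.Re a < 1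
    & forall a v m, S v = a *: v -> iter m N v = 0 ->
        g v = cexp (twopii * a) *:
              \sum_(k < m) (twopii ^+ k / (k`!)%:R) *: iter k N v].

(* x^(S + N) u when S u = a u *)
Definition pow_log (N : V -> V) (a : C) (u : V) : lmono R -> V :=
  fun m => if m.1 == a then ((m.2)`!%:R)^-1 *: iter m.2 N u else 0.

(* (x_2 + x_0)^(S + N) u = x_2^(S + N) (1 + x_0 / x_2)^(S + N) u when         *)
(* S u = a u                                                                  *)
Definition binom_pow_log (S N : V -> V) (a : C) (u : V) : lmonos R 3 -> V :=
  fapply (fun v => in_var x2 (pow_log N a v))
         (fsum (fun k : nat => op_binom (fun v => S v + N v) k u)
               (fun k : nat => xpow x0 k%:R + xpow x2 (- k%:R))).

End Automorphisms.

(* [tm_Y u w (r, k)] is the coefficient of x^r (log x)^k in Y_W(u, x) w, that *)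
(* is, u_(n, k) w for n = - r - 1.                                            *)
Record twisted_module (R : realType) (V : voa R) (g : V -> V) := TwistedModule {
  tm_space :> lmodType R[i];
  tm_Y : V -> tm_space -> lmono R -> tm_space;
  tm_gr : R[i] -> set tm_space;
  tm_linl : forall w m, linear (fun u => tm_Y u w m);
  tm_linr : forall u m, linear (fun w => tm_Y u w m);
  tm_log : forall u w, log_bounded (tm_Y u w);
  tm_fin : forall u w, fin_components tm_gr (tm_Y u w);
  tm_direct : direct_sum tm_gr;
  tm_fin_dim : forall n, fin_dim_subspace (tm_gr n);
  tm_gr_lower : forall n : R[i], exists l0 : int, forall l : int, l < l0 ->
    tm_gr (n + l%:~R) = [set 0];
  tm_equivariance : forall (p : int) (z : R[i]) u w w', z != 0 ->
    graded_dual tm_gr w' ->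
    eval_at (p + 1) z (fun m => w' (tm_Y (g u) w m))
    = eval_at p z (fun m => w' (tm_Y u w m));
  tm_identity : forall w m,
    tm_Y (voa_one V) w m = if m == (0, 0%N) then w else 0;
  tm_duality : forall u v w w', graded_dual tm_gr w' ->
    exists (f : logpoly R 2) (t : nat), forall (p : int) (z1 z2 : R[i]),
      let fval :=
        lp_eval f [tuple p; p] [tuple z1; z2] * (z1 - z2) ^- t in
      let prod := fun m : lmono R * lmono R =>
        w' (tm_Y u (tm_Y v w m.2) m.1)
        * mono_at p z1 m.1 * mono_at p z2 m.2 in
      let rprod := fun m : lmono R * lmono R =>
        w' (tm_Y v (tm_Y u w m.1) m.2)
        * mono_at p z1 m.1 * mono_at p z2 m.2 in
      let iterate := fun m : int * lmono R =>
        w' (tm_Y (voa_Y u v m.1) w m.2)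
        * (z1 - z2) ^ m.1 * mono_at p z2 m.2 in
      [/\ 0 < cabs z2 < cabs z1 -> abs_summable prod /\ sums_to prod fval,
          0 < cabs z1 < cabs z2 -> abs_summable rprod /\ sums_to rprod fval
        & 0 < cabs (z1 - z2) < cabs z2 ->
          abs_summable iterate /\
          (`|carg z1 - carg z2| < pi / 2 -> sums_to iterate fval)];
  tm_L0 : forall n,
    tm_gr n = gen_eigenspace (fun w => tm_Y (voa_omega V) w (- 2, 0%N)) n;
  tm_derivative : forall u w,
    fderiv (tm_Y u w) =1 tm_Y (voa_L (-1) u) w
}.

Definition tm_Lm1 (R : realType) (V : voa R) (g : V -> V)
    (W : twisted_module g) (w : W) : W :=
  tm_Y (voa_omega V) w (- 1, 0%N).

(* As for modules, [io_Y w1 w2 (- n - 1, k)] is the mode of index (n, k).     *)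
Record twisted_intertwining (R : realType) (V : voa R) (g1 g2 g3 : V -> V)
    (W1 : twisted_module g1) (W2 : twisted_module g2)
    (W3 : twisted_module g3) := TwistedIntertwining {
  io_Y :> W1 -> W2 -> lmono R -> W3;
  io_linl : forall w2 m, linear (fun w1 => io_Y w1 w2 m);
  io_linr : forall w1 m, linear (fun w2 => io_Y w1 w2 m);
  io_log : forall w1 w2, log_bounded (io_Y w1 w2);
  io_fin : forall w1 w2, fin_components (@tm_gr _ _ _ W3) (io_Y w1 w2);
  io_lower : forall w1 w2 (n : R[i]) k, exists l0 : int, forall l : int, l0 < l ->
    io_Y w1 w2 (- (n + l%:~R) - 1, k) = 0;
  io_derivative : forall w1 w2,
    fderiv (io_Y w1 w2) =1 io_Y (tm_Lm1 w1) w2;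
  io_duality : forall u w1 w2 w3', graded_dual (@tm_gr _ _ _ W3) w3' ->
    exists f : logpoly R 3, forall (p1 p2 p12 : int) (z1 z2 : R[i]),
      let z := [tuple z1 - z2; z1; z2] in
      let prod := fun m : lmono R * lmono R =>
        w3' (tm_Y u (io_Y w1 w2 m.2) m.1)
        * mono_at p1 z1 m.1 * mono_at p2 z2 m.2 in
      let rprod := fun m : lmono R * lmono R =>
        w3' (io_Y w1 (tm_Y u w2 m.1) m.2)
        * mono_at p1 z1 m.1 * mono_at p2 z2 m.2 in
      let iterate := fun m : lmono R * lmono R =>
        w3' (io_Y (tm_Y u w1 m.1) w2 m.2)
        * mono_at p12 (z1 - z2) m.1 * mono_at p2 z2 m.2 in
      [/\ 0 < cabs z2 < cabs z1 ->
          abs_summable prod /\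
          (- (pi / 2) < carg (z1 - z2) - carg z1 < pi / 2 ->
           sums_to prod (lp_eval f [tuple p1; p1; p2] z)),
          0 < cabs z1 < cabs z2 ->
          abs_summable rprod /\
          (- (pi *+ 3 / 2) < carg (z1 - z2) - carg z1 < - (pi / 2) ->
           sums_to rprod (lp_eval f [tuple p2; p1; p2] z))
        & 0 < cabs (z1 - z2) < cabs z2 ->
          abs_summable iterate /\
          (- (pi / 2) < carg z1 - carg z2 < pi / 2 ->
           sums_to iterate (lp_eval f [tuple p12; p2; p2] z))]
}.

(* Main.v *)
(* Fix w_3' and let z_2 = - rho run over the negative axis.  If S u = alpha u, *)
(* then \sum_j z_1^alpha (log z_1)^j / j! Y(N^j u, z_1) = z_1^alpha Y_0(u, z_1) *)
(* has integral powers of z_1 only.  The same combination of the finite sums   *)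
(* provided by duality is a function H of l_0 = log(z_1 - z_2), l_1 = log z_1. *)
(* For |z_1| < |z_2| it does not depend on the branch of log z_1, and for      *)
(* |z_1 - z_2| < |z_2| it does not depend on the branch of log(z_1 - z_2),     *)
(* since W_1 is untwisted.  An exponential polynomial is determined by its     *)
(* values on a half-line, so H = z_1^-K (z_1 - z_2)^-J P(z_1 - z_2) for a      *)
(* polynomial P, and the three expansions of such a function satisfy the       *)
(* Jacobi identity.  The expansion in z_1 - z_2 that involves                  *)
(* (x_2 + x_0)^(S + N) is identified as an asymptotic expansion at 0.          *)
(* Both sides are exponential polynomials in log z_2, so the coefficients of   *)
(* x_2 can be compared, and then w_3' can be removed.                          *)
(*   The truncation properties of the modes follow from the commutator formula *)
(* for L(0), to which the same argument applies with u = omega.                *)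
Require Import Defs.
From HB Require Import structures.
From mathcomp Require Import all_boot all_order all_algebra finmap.
From mathcomp Require Import all_classical all_reals all_analysis.
From mathcomp Require Import complex.
From mathcomp Require summability.
From mathcomp Require Import ring lra zify.

Set Implicit Arguments.
Unset Strict Implicit.
Unset Printing Implicit Defensive.
Import Order.TTheory GRing.Theory Num.Theory.
Import numFieldNormedType.Exports.
Local Open Scope classical_set_scope.
Local Open Scope ring_scope.
Local Open Scope complex_scope.

(** Put v_j = N^j u and z_0 = z_1 - z_2. Equivariance of a g-twisted module forces Y_W(u, x) =
    Y_(W,0)(x^(- N) u, x), with exponents of x in Z - alpha ([chain_poly], [chain_modes]). Hence
    \sum_j z_1^alpha (log z_1)^j / j! Y_W(v_j, z_1) = z_1^alpha Y_(W,0)(u, z_1) is a Laurent series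
    in z_1. The same combination of the finite sums given by duality is a function H of log z_0 and
    log z_1, at a fixed z_2 = - rho; with z_2 negative, points z_1 on the negative axis meet all the
    argument conditions of duality.

    A priori H contains arbitrary powers and logarithms. For |z_1| < rho its value does not depend
    on the branch of log z_1, which removes the terms with a nonintegral power or a logarithm of z_1
    ([branch_keys]). Since W_1 is untwisted, it does not depend on the branch of log z_0 near z_1 =
    z_2 either, and what remains is z_1^-K z_0^-J P(z_0) with a polynomial P ([branch_rational]).
    Both steps rest on the independence of exponential polynomials on a half-line
    ([cexp_sum_indep]).

    The passage to the Jacobi identity is formal ([jacobi_of_weak]): the three residues, as
    functions of their two indices, satisfy one and the same Pascal recursion, and a solution is
    determined by one row together with one entry in each row. The series of the product and of the
    reversed product are identified by uniqueness of Laurent series on a real interval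
    ([weak_outer], [weak_inner]). The series of the iterate, which contains (x_2 + x_0)^(S + N), is
    identified as an asymptotic expansion for z_0 -> 0+ ([weak_iterate]); its coefficients come from
    the Taylor expansion of (1 + t)^a (log (1 + t))^j ([powlog_taylor]).

    At z_2 = - rho both sides are finite sums of powers of z_2 and log z_2, so that letting rho vary
    compares the coefficients ([gev_inj], [modes_dual]). All sums over modes are finite by
    truncation ([modes_lower], [modes_upper]), which follows from the commutator of L(0) with a
    vertex operator ([L0_commutator]), itself the case u = omega of the same argument. Then w_3' can
    be removed, since the graded dual separates points ([tm_separates]), and [io_modes] is read as
    an equality of coefficients of formal series. *)

(** * Modulus and exponential of complex numbers *)

Section ComplexBasics.
Variable R : realType.
Local Notation C := R[i].
Implicit Types (z w : C) (x y : R).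

Lemma normr_cabs z : `|z| = (cabs z)%:C :> C.
Proof. by rewrite /cabs normc_def. Qed.

Lemma cabs_ge0 z : 0 <= cabs z.
Proof. by rewrite -ler0c -normr_cabs normr_ge0. Qed.

Lemma cabsM z w : cabs (z * w) = cabs z * cabs w.
Proof. by apply: complexI; rewrite rmorphM /= -!normr_cabs normrM. Qed.

Lemma cabs0 : cabs (0 : C) = 0.
Proof. by apply: complexI; rewrite -normr_cabs normr0. Qed.

Lemma cabs1 : cabs (1 : C) = 1.
Proof. by apply: complexI; rewrite -normr_cabs normr1. Qed.

Lemma cabs_eq0 z : (cabs z == 0) = (z == 0).
Proof. by rewrite -(inj_eq (@complexI R)) -normr_cabs normr_eq0. Qed.

Lemma cabs_gt0 z : (0 < cabs z) = (z != 0).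
Proof. by rewrite lt_neqAle cabs_ge0 andbT eq_sym cabs_eq0. Qed.

Lemma cabsD z w : cabs (z + w) <= cabs z + cabs w.
Proof. by rewrite -lecR rmorphD /= -!normr_cabs ler_normD. Qed.

Lemma cabsN z : cabs (- z) = cabs z.
Proof. by apply: complexI; rewrite -!normr_cabs normrN. Qed.

Lemma cabsBC z w : cabs (z - w) = cabs (w - z).
Proof. by rewrite -cabsN opprB. Qed.

Lemma cabsV z : cabs z^-1 = (cabs z)^-1.
Proof. by apply: complexI; rewrite fmorphV /= -!normr_cabs normfV. Qed.

Lemma cabsX z n : cabs (z ^+ n) = cabs z ^+ n.
Proof. by elim: n => [|n IH]; rewrite ?expr0 ?cabs1 // !exprS cabsM IH. Qed.

Lemma cabs_exprz z (n : int) : cabs (z ^ n) = cabs z ^ n.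
Proof. by case: n => n; rewrite ?NegzE -?exprnN ?cabsV cabsX. Qed.

Lemma cabs_real x : cabs x%:C = `|x|.
Proof. by rewrite /cabs normc_def /= expr0n /= addr0 sqrtr_sqr. Qed.

Lemma cabs_sum (I : Type) (r : seq I) (P : pred I) (F : I -> C) :
  cabs (\sum_(i <- r | P i) F i) <= \sum_(i <- r | P i) cabs (F i).
Proof.
elim/big_rec2: _ => [|i y z _ h]; first by rewrite cabs0.
by rewrite (le_trans (cabsD _ _)) // lerD2l.
Qed.

Lemma cabs_ge_Re z : `|complex.Re z| <= cabs z.
Proof. by rewrite -lecR -normr_cabs normc_ge_Re. Qed.

Lemma cabs_ge_Im z : `|complex.Im z| <= cabs z.
Proof.
rewrite /cabs normc_def /= -[leLHS]sqrtr_sqr ler_wsqrtr // lerDr sqr_ge0 //.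
Qed.

Lemma cabs_le_ReIm z : cabs z <= `|complex.Re z| + `|complex.Im z|.
Proof.
have ci : cabs ('i%C : C) = 1.
  by rewrite /cabs normc_def /= expr0n expr1n add0r sqrtr1.
rewrite {1}(complexE z) (le_trans (cabsD _ _)) // cabsM ci mul1r.
by rewrite !cabs_real.
Qed.

Lemma cexpD z w : cexp (z + w) = cexp z * cexp w.
Proof.
case: z => a b; case: w => c d; rewrite /cexp; simpc => /=.
rewrite expRD cosD sinD; congr (_ +i* _); ring.
Qed.

Lemma cexp0 : cexp (0 : C) = 1.
Proof. by rewrite /cexp /= expR0 cos0 sin0 mulr1 mulr0. Qed.

Lemma cexp_neq0 z : cexp z != 0.
Proof.
apply/eqP => h; have := cexpD z (- z); rewrite subrr cexp0 h mul0r => /eqP.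
by rewrite oner_eq0.
Qed.

Lemma cexpN z : cexp (- z) = (cexp z)^-1.
Proof.
apply: (mulfI (cexp_neq0 z)); rewrite -cexpD subrr cexp0 divff //.
exact: cexp_neq0.
Qed.

Lemma cexpMn z n : cexp (n%:R * z) = cexp z ^+ n.
Proof.
elim: n => [|n IH]; first by rewrite mul0r cexp0.
by rewrite -natr1 mulrDl mul1r cexpD IH exprSr.
Qed.

Lemma cexpMz z (n : int) : cexp (n%:~R * z) = cexp z ^ n.
Proof.
case: n => n; first by rewrite -pmulrn cexpMn.
by rewrite NegzE -exprnN mulrNz mulNr cexpN -pmulrn cexpMn.
Qed.

Lemma cabs_cexp z : cabs (cexp z) = expR (complex.Re z).
Proof.
rewrite /cabs normc_def /= !exprMn -mulrDr cos2Dsin2 mulr1 sqrtr_sqr.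
by rewrite ger0_norm // expR_ge0.
Qed.

Lemma cexp_real x : cexp x%:C = (expR x)%:C.
Proof. by rewrite /cexp /= cos0 sin0 mulr1 mulr0. Qed.

Lemma cexp_twopii : cexp (twopii R) = 1.
Proof. by rewrite /cexp /twopii /= expR0 cos2pi sin2pi mulr1 mulr0. Qed.

Lemma cexp_twopiiz (n : int) : cexp (n%:~R * twopii R) = 1.
Proof. by rewrite cexpMz cexp_twopii exp1rz. Qed.

Lemma twopii_neq0 : twopii R != 0.
Proof. by rewrite eq_complex /= eqxx /= mulrn_eq0 /= gt_eqF // pi_gt0. Qed.

Lemma twopiiE : twopii R = 'i * (pi *+ 2)%:C.
Proof. by rewrite /twopii; simpc. Qed.

(** The modulus gives Re z = 0. Reducing Im z to [0, 2 pi) leaves an angle of cosine 1, and cos is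
    injective on [0, pi]. *)
Lemma cexp_eq1 z : cexp z = 1 -> exists n : int, z = n%:~R * twopii R.
Proof.
case: z => a b h.
have a0 : a = 0.
  have := cabs_cexp (a +i* b); rewrite h cabs1 /= => /esym h1.
  by apply: (@expR_inj R); rewrite h1 expR0.
move: h; rewrite a0 /cexp /= expR0 !mul1r => -[hc hs].
have pp := pi_gt0 R.
pose n := Num.floor (b / (pi *+ 2)).
pose b' := b - n%:~R * (pi *+ 2).
have p2 : 0 < pi *+ 2 :> R by rewrite pmulrn_lgt0.
have /andP[b0 b2] : 0 <= b' < pi *+ 2.
  have := floor_le (b / (pi *+ 2)); have := floorD1_gt (b / (pi *+ 2)).
  rewrite -/n ler_pdivlMr // ltr_pdivrMr // intrD mulrDl mul1r /b' => h1 h2.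
  by rewrite subr_ge0 h2 ltrBlDl.
have pern : forall k : int, cexp (0 +i* (b - k%:~R * (pi *+ 2))) = cexp (0 +i* b).
  move=> k; have -> : (0 +i* (b - k%:~R * (pi *+ 2))) =
     (0 +i* b) + (- k)%:~R * twopii R.
    rewrite mulrNz mulNr twopiiE -(rmorph_int (real_complex R)) mulrCA -rmorphM /=.
    by simpc.
  by rewrite cexpD cexp_twopiiz mulr1.
have := pern n; rewrite /cexp /= expR0 !mul1r -/b' hc hs => -[hc' hs'].
have b'0 : b' = 0.
  case: (lerP b' pi) => hb.
    apply: cos_inj; rewrite ?in_itv /= ?b0 ?hb ?lexx ?(ltW pp) //.
    by rewrite cos0.
  have h2 : pi *+ 2 - b' = 0.
    apply: cos_inj; rewrite ?in_itv /= ?lexx ?(ltW pp) //.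
      by move: hb b2; rewrite !mulr2n; lra.
    by rewrite cosB cos2pi sin2pi hc' mul1r mul0r addr0 cos0.
  by move: b2; rewrite -subr_gt0 h2 ltxx.
exists n; rewrite twopiiE -(rmorph_int (real_complex R)) mulrCA -rmorphM /=.
by move/eqP: b'0; rewrite subr_eq0 => /eqP ->; simpc.
Qed.

Lemma cexp_twopiiM z : cexp (twopii R * z) = 1 <-> exists n : int, z = n%:~R.
Proof.
split=> [/cexp_eq1[n h]|[n ->]]; last by rewrite mulrC cexp_twopiiz.
by exists n; apply: (mulfI twopii_neq0); rewrite h mulrC.
Qed.

End ComplexBasics.

(** * Finitely supported sums *)

Lemma fsbig_list (T : choiceType) (V : nmodType) (A : set T) (r : seq T)
    (F : T -> V) :
  uniq r -> (forall i, i \in r -> A i) -> (forall i, A i -> i \notin r -> F i = 0) ->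
  \sum_(i \in A) F i = \sum_(i <- r) F i.
Proof.
move=> ur rA F0; rewrite (fsbigE r) //.
rewrite big_seq_cond [RHS]big_seq; apply: eq_bigl => i.
case: (boolP (i \in r)) => //= /rA h; exact: mem_set.
Qed.

Section NSum.
Variable V : nmodType.
Implicit Types F G : nat -> V.

Definition ev0 F := exists N : nat, forall k, (N <= k)%N -> F k = 0.
(** By convention the sum is 0 when the support is infinite, whence the side conditions [ev0]. *)
Definition nsum F : V := \sum_(k \in [set: nat]) F k.

Lemma nsumE F N : (forall k, (N <= k)%N -> F k = 0) -> nsum F = \sum_(k < N) F k.
Proof.
move=> h; rewrite /nsum (@fsbig_list _ _ _ (iota 0 N)) ?iota_uniq //.
  by rewrite -[RHS](big_mkord xpredT F) /index_iota subn0.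
by move=> i _; rewrite mem_iota add0n leq0n /= -leqNgt => /h.
Qed.

Lemma eq_nsum F G : F =1 G -> nsum F = nsum G.
Proof. by move=> /funext ->. Qed.

Lemma nsumD F G : ev0 F -> ev0 G -> nsum (fun k => F k + G k) = nsum F + nsum G.
Proof.
move=> [N hN] [M hM]; rewrite (@nsumE _ (maxn N M)); last first.
  by move=> k; rewrite geq_max => /andP[? ?]; rewrite hN ?hM ?addr0.
rewrite (@nsumE F (maxn N M)) ?(@nsumE G (maxn N M)) ?big_split //.
- by move=> k; rewrite geq_max => /andP[? ?]; exact: hM.
- by move=> k; rewrite geq_max => /andP[? ?]; exact: hN.
Qed.

Lemma nsumS F : ev0 F -> nsum F = F 0%N + nsum (fun k => F k.+1).
Proof.
move=> [N hN]; rewrite (@nsumE F N.+1); last by move=> k hk; exact/hN/ltnW.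
rewrite big_ord_recl (@nsumE (fun k => F k.+1) N) // => k hk.
by rewrite hN // leqW.
Qed.

Lemma nsum0 F : (forall k, F k = 0) -> nsum F = 0.
Proof. by move=> h; rewrite (@nsumE F 0) ?big_ord0. Qed.

Lemma ev0S F : ev0 F -> ev0 (fun k => F k.+1).
Proof. by move=> [N hN]; exists N => k hk; rewrite hN // leqW. Qed.

Lemma ev0_comp F (G : nat -> V) : ev0 F -> (forall k, F k = 0 -> G k = 0) -> ev0 G.
Proof. by move=> [N hN] h; exists N => k hk; apply/h/hN. Qed.

End NSum.

Lemma nsum_morph (V W : nmodType) (f : V -> W) (F : nat -> V) :
  f 0 = 0 -> {morph f : x y / x + y} -> ev0 F -> f (nsum F) = nsum (f \o F).
Proof.
move=> f0 fD [N hN]; rewrite (nsumE hN) (@nsumE _ _ N) ?(big_morph _ fD f0) //.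
by move=> k hk /=; rewrite hN.
Qed.

(** * Generalized binomial coefficients *)

Section Binomials.
Variable R : realType.
Local Notation C := R[i].
Implicit Types (a b y : C).

Lemma binom0 a : binom a 0 = 1.
Proof. by rewrite /binom big_ord0 fact0 divr1. Qed.

Lemma binomS a k : (k.+1)%:R * binom a k.+1 = (a - k%:R) * binom a k.
Proof.
rewrite /binom big_ord_recr /= factS natrM.
have h : (k.+1)%:R != 0 :> C by rewrite pnatr_eq0.
have f0 : (k`!)%:R != 0 :> C by rewrite pnatr_eq0 -lt0n fact_gt0.
move: (k.+1)%:R (k`!)%:R h f0 => v w h f0.
by field; rewrite f0 h.
Qed.

Lemma binomD1 a k : binom (a + 1) k.+1 = binom a k.+1 + binom a k.
Proof.
elim: k => [|k IH].
  have h b : binom b 1 = b by have := binomS b 0; rewrite binom0 mul1r mulr1 subr0.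
  by rewrite !h binom0.
have h : (k.+2)%:R != 0 :> C by rewrite pnatr_eq0.
apply: (mulfI h); rewrite binomS IH [RHS]mulrDr binomS.
have := binomS a k; move: (binom a k.+1) (binom a k) => u v huv.
have e1 : (k.+1)%:R = k%:R + 1 :> C by rewrite natr1.
have e2 : (k.+2)%:R = k%:R + 2 :> C by rewrite -natrD addn2.
rewrite e1 in huv; rewrite e1 e2.
transitivity ((a-k%:R)*u + (a-k%:R)*v); [ring|rewrite -huv; ring].
Qed.

Lemma binom_gt (n k : nat) : (n < k)%N -> binom (n%:R : C) k = 0.
Proof.
move=> hk; rewrite /binom (bigD1 (Ordinal hk)) //= subrr mul0r mul0r //.
Qed.

Lemma binom_nat (n k : nat) : binom (n%:R : C) k = ('C(n, k))%:R.
Proof.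
elim: n k => [|n IH] [|k]; rewrite ?bin0 ?binom0 //; first by rewrite binom_gt.
by rewrite -natr1 binomD1 !IH binS natrD.
Qed.

End Binomials.

(** * The formal Jacobi identity *)

Section FormalJacobi.
Variable R : realType.
Local Notation C := R[i].
Implicit Types (y : C) (A B : int -> C) (D : int -> int -> C).

(** The residue in x_1 of x_1^m (x_1 + y)^n A(x_1), the binomial being expanded in nonnegative
    powers of [y]. *)
Definition phiA y A (m n : int) : C :=
  nsum (fun k : nat => binom n%:~R k * y ^+ k * A (k%:Z - m - n - 1)).

(** The residue in x_1 of x_1^m (y + x_1)^n B(x_1), the binomial being expanded in nonnegative
    powers of x_1. *)
Definition psi y B (m n : int) : C :=
  nsum (fun k : nat => binom n%:~R k * y ^ (n - k%:Z) * B (- m - 1 - k%:Z)).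

(** The effect on residues of (x_1 + y)^(n + 1) = x_1 (x_1 + y)^n + y (x_1 + y)^n, whatever the
    expansion. *)
Definition pascal_rec y D := forall m n : int, D m (n + 1) = D (m + 1) n + y * D m n.

Lemma ev0_phiA y A a0 (c : nat -> C) (s : int) :
  (forall i, a0 < i -> A i = 0) -> ev0 (fun k : nat => c k * A (k%:Z + s)).
Proof.
move=> hA; exists `|a0 - s|.+1 => k hk; rewrite hA ?mulr0 //.
by move: hk; lia.
Qed.

Lemma ev0_psi B b0 (c : nat -> C) (s : int) :
  (forall i, i < b0 -> B i = 0) -> ev0 (fun k : nat => c k * B (s - k%:Z)).
Proof.
move=> hB; exists `|s - b0|.+1 => k hk; rewrite hB ?mulr0 //.
by move: hk; lia.
Qed.

Lemma phiA_rec y A a0 : (forall i, a0 < i -> A i = 0) -> pascal_rec y (phiA y A).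
Proof.
move=> hA m n; rewrite /phiA.
have e c s : ev0 (fun k : nat => c k * A (k%:Z - s - n - 1)).
  by apply: ev0_comp (ev0_phiA y c (- s - n - 1) hA) _ => k; rewrite !addrA.
rewrite nsumS; last first.
  apply: ev0_comp (e (fun k => binom (n + 1)%:~R k * y ^+ k) (m + 1)) _ => k.
  by rewrite (_ : _ - (n + 1) - 1 = k%:Z - (m + 1) - n - 1) //; ring.
rewrite [X in _ = X + _]nsumS ?(e (fun k => _)) // -!addrA; congr (_ + _).
  by rewrite !binom0; congr (_ * A _); ring.
have e1 : ev0 (fun k : nat => binom n%:~R k * y ^+ k * A (k%:Z - m - n - 1)) by exact: e.
rewrite (@nsum_morph _ _ ( *%R y)) ?mulr0 //; last exact: mulrDr.
rewrite -nsumD; first last.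
- by apply: ev0_comp e1 _ => k /= ->; rewrite mulr0.
- exact: (ev0S (e (fun k => binom n%:~R k * y ^+ k) (m + 1))).

apply: eq_nsum => k /=; rewrite intrD binomD1 exprS.
rewrite (_ : k.+1%:Z - m - (n + 1) - 1 = k%:Z - m - n - 1); last by lia.
rewrite (_ : k.+1%:Z - (m + 1) - n - 1 = k%:Z - m - n - 1); last by lia.
ring.
Qed.

Lemma psi_rec y B b0 : y != 0 -> (forall i, i < b0 -> B i = 0) ->
  pascal_rec y (psi y B).
Proof.
move=> y0 hB m n; rewrite /psi.
have e c m' : ev0 (fun k : nat => c k * B (- m' - 1 - k%:Z)).
  exact: ev0_psi hB.
rewrite nsumS // (@nsum_morph _ _ ( *%R y)) ?mulr0 //; last exact: mulrDr.
have e1 : ev0 (fun k => y * (binom n%:~R k * y ^ (n - k%:Z) * B (- m - 1 - k%:Z))).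
  by apply: ev0_comp (e (fun k => binom n%:~R k * y ^ (n - k%:Z)) m) _ => k /= ->; rewrite mulr0.
rewrite [X in _ = _ + X]nsumS // addrCA; congr (_ + _).
  by rewrite /= !binom0 !mul1r !subr0 exprzDr ?unitfE // expr1z; ring.
rewrite -nsumD; [|exact: e|exact: (ev0S e1)].
apply: eq_nsum => k /=; rewrite intrD binomD1.
rewrite (_ : n + 1 - k.+1%:Z = n - k%:Z); last by lia.
rewrite (_ : - (m + 1) - 1 - k%:Z = - m - 1 - k.+1%:Z); last by lia.
rewrite (_ : y ^ (n - k%:Z) = y * y ^ (n - k.+1%:Z)); first by ring.
rewrite (_ : n - k%:Z = 1 + (n - k.+1%:Z)); last by lia.
by rewrite [LHS]exprzDr ?unitfE // expr1z.
Qed.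

(** The zero row propagates upwards by the recursion. A row preceding a zero row is geometric of
    ratio [- y], so it vanishes with any one of its entries. *)
Lemma pascal_rec_eq0 y D (n0 : int) : y != 0 -> pascal_rec y D ->
  (forall m, D m n0 = 0) -> (forall n, exists m, D m n = 0) ->
  forall m n, D m n = 0.
Proof.
move=> y0 hD h0 hz.
have up : forall (k : nat) m, D m (n0 + k%:Z) = 0.
  elim=> [|k IH] m; first by rewrite addr0 h0.
  by rewrite -addn1 PoszD addrA hD !IH mulr0 addr0.
have dn : forall (k : nat) m, D m (n0 - k%:Z) = 0.
  elim=> [|k IH]; first by move=> m; rewrite subr0 h0.
  set n := n0 - k.+1%:Z.
  have hn : n + 1 = n0 - k%:Z by rewrite /n; lia.
  have rec m : D (m + 1) n = - y * D m n.
    by have /eqP := hD m n; rewrite hn IH eq_sym addr_eq0 => /eqP ->; rewrite mulNr.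
  have [m0 hm0] := hz n.
  have up' : forall (j : nat), D (m0 + j%:Z) n = 0.
    elim=> [|j IHj]; first by rewrite addr0.
    by rewrite -addn1 PoszD addrA rec IHj mulr0.
  have dn' : forall (j : nat), D (m0 - j%:Z) n = 0.
    elim=> [|j IHj]; first by rewrite subr0.
    have := rec (m0 - j.+1%:Z); rewrite (_ : _ + 1 = m0 - j%:Z); last by lia.
    by rewrite IHj => /esym/eqP; rewrite mulf_eq0 oppr_eq0 (negbTE y0) => /eqP.
  move=> m; case: (lerP m0 m) => h.
    by have := up' `|m - m0|%N; rewrite (_ : m0 + _ = m) //; lia.
  by have := dn' `|m - m0|%N; rewrite (_ : m0 - _ = m) //; lia.
move=> m n; case: (lerP n0 n) => h.
  by have := up `|n - n0|%N m; rewrite (_ : n0 + _ = n) //; lia.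
by have := dn `|n - n0|%N m; rewrite (_ : n0 - _ = n) //; lia.
Qed.

Definition icoef (P : {poly C}) (i : int) : C := if i is Posz k then P`_k else 0.

(* The residue in x_1 of x_1^m (x_1 + y)^b, expanded in nonnegative powers of *)
(* y.                                                                         *)
Definition resG y (m b : int) : C :=
  if m + b + 1 is Posz c then binom b%:~R c * y ^+ c else 0.

Lemma resG_rec y : pascal_rec y (resG y).
Proof.
move=> m b; rewrite /resG.
have -> : m + (b + 1) + 1 = (m + b + 1) + 1 by ring.
have -> : m + 1 + b + 1 = (m + b + 1) + 1 by ring.
case: (m + b + 1) => [c|[|c]] //=; last by rewrite mulr0 addr0.
  rewrite addn1 intrD binomD1 exprS; ring.
by rewrite subnn !binom0 mulr0 addr0.
Qed.

Lemma resG0 y b : resG y 0 b = (b == -1)%:R.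
Proof.
rewrite /resG add0r; case h : (b + 1) => [[|c]|c].
- have -> : b == -1 by lia.
  by rewrite binom0 expr0 mulr1.
- have -> : (b == -1) = false by lia.
  have -> : b = c by lia.
  by rewrite -pmulrn binom_gt // mul0r.
- by have -> : (b == -1) = false by lia.
Qed.

Lemma icoefMXD (P : {poly C}) y i :
  icoef (P * ('X + y%:P)) i = icoef P (i - 1) + y * icoef P i.
Proof.
case: i => [[|k]|k] /=.
- by rewrite mulrDr coefD coefMX coefMC /= add0r mulrC add0r.
- rewrite mulrDr coefD coefMX coefMC /= mulrC; congr (_ + _).
  by rewrite subn1.
- by rewrite mulr0 addr0.
Qed.

Lemma resG_icoef y m (j : nat) : resG y m j = icoef (('X + y%:P) ^+ j) (- m - 1).
Proof.
elim: j m => [|j IH] m.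
  rewrite expr0 /resG addr0; case h : (m + 1) => [[|c]|c].
  - have -> : - m - 1 = 0 by lia.
    by rewrite /= binom0 coef1 expr0 mulr1.
  - rewrite -pmulrn binom_gt // mul0r; case h' : (- m - 1) => [k|//]; lia.
  - by case h' : (- m - 1) => [[|k]|//] /=; [lia | rewrite coef1].
rewrite -addn1 PoszD resG_rec !IH addn1 exprSr icoefMXD; congr (icoef _ _ + _).
by ring.
Qed.

Lemma icoef_sum n (F : nat -> {poly C}) i :
  icoef (\sum_(j < n) F j) i = \sum_(j < n) icoef (F j) i.
Proof. by case: i => i; rewrite /icoef; [rewrite coef_sum | rewrite big1]. Qed.

Lemma icoefZ c P i : icoef (c *: P) i = c * icoef P i.
Proof. by case: i => i /=; rewrite ?coefZ ?mulr0. Qed.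

(* Weak commutativity and weak associativity imply the Jacobi identity: A, B  *)
(* and C are the three expansions of x_1^-K (x_1 + y)^-J P(x_1 + y).          *)
Lemma jacobi_of_weak y A B E (a0 b0 c0 : int) (J K : nat) (P : {poly C}) :
  y != 0 ->
  (forall i, a0 < i -> A i = 0) -> (forall i, i < b0 -> B i = 0) ->
  (forall i, i < c0 -> E i = 0) ->
  (forall m, phiA y A m J = icoef (P \Po ('X + y%:P)) (K%:Z - m - 1)) ->
  (forall m, psi y B m J = icoef (P \Po ('X + y%:P)) (K%:Z - m - 1)) ->
  (forall n, psi (- y) E n K = icoef P (J%:Z - n - 1)) ->
  forall m n, phiA y A m n - psi y B m n = psi (- y) E n m.
Proof.
move=> y0 hA hB hD eA eB eD.
have rA := phiA_rec y hA; have rB := psi_rec y0 hB.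
have Ny0 : - y != 0 by rewrite oppr_eq0.
have rD : pascal_rec y (fun m n => psi (- y) E n m).
  by move=> m n; rewrite (psi_rec Ny0 hD) mulNr subrK.
(* The residue of x_1^(m - K) (x_1 + y)^(n - J) P(x_1 + y), expanded in powers of [y]. *)
pose T m n := \sum_(j < size P) P`_j * resG y (m - K%:Z) (n + j%:Z - J%:Z).
have rT : pascal_rec y T.
  move=> m n; rewrite /T mulr_sumr -big_split; apply: eq_bigr => j _ /=.
  rewrite (_ : n + 1 + j%:Z - J%:Z = n + j%:Z - J%:Z + 1); last by ring.
  rewrite resG_rec (_ : m + 1 - K%:Z = m - K%:Z + 1); last by ring.
  by ring.
have eAT m n : phiA y A m n = T m n.
  apply/eqP; rewrite -subr_eq0; apply/eqP; move: m n.
  apply: (@pascal_rec_eq0 y _ J%:Z) => //.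
  - by move=> m n; rewrite rA rT; ring.
  - move=> m; rewrite eA /T; apply/eqP; rewrite subr_eq0; apply/eqP.
    rewrite comp_polyE (icoef_sum (size P) (fun j : nat => P`_j *: ('X + y%:P) ^+ j)); apply: eq_bigr => j _.
    rewrite icoefZ (_ : J%:Z + j%:Z - J%:Z = j%:Z); last by ring.
    rewrite resG_icoef; congr (_ * icoef _ _); ring.
  - move=> n; exists (- `|a0|%:Z - `|n|%:Z - `|(size P)%:Z|%:Z - 2).
    rewrite /phiA nsum0; last first.
      move=> k; rewrite hA ?mulr0 //; lia.
    rewrite sub0r /T big1 ?oppr0 // => j _.
    have := ltn_ord j => hj; rewrite /resG.
    case h : (_ + _) => [c|c]; last by rewrite mulr0.
    by exfalso; move: h; lia.
(* For m = K the factor x_1^-K is cleared, and only the residue of x_0^(n - J) P(x_0) in x_0 = x_1 +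
   y is left. *)
have eAK (n : int) : phiA y A K n = psi (- y) E n K.
  rewrite eAT eD /T subrr.
  under eq_bigr => j _ do rewrite resG0.
  case h : (J%:Z - n - 1) => [k|k] /=.
    case: (ltnP k (size P)) => hk.
      rewrite (bigD1 (Ordinal hk)) //= big1 ?addr0.
        have -> : (n + k%:Z - J%:Z == -1) by lia.
        by rewrite mulr1.
      move=> j /eqP hj; have -> : (n + j%:Z - J%:Z == -1) = false.
        apply/negP => /eqP hh; apply: hj; apply: val_inj => /=; lia.
      by rewrite mulr0.
    rewrite nth_default // big1 // => j _; have hj := ltn_ord j.
    case: eqP => hh; last by rewrite mulr0.
    by exfalso; have hjk : (j < k)%N := leq_trans hj hk; lia.
  rewrite big1 // => j _.
  case: eqP => hh; last by rewrite mulr0.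
  by exfalso; have := ltn_ord j; lia.
(* The recursion expresses column m + 1 by column m, so the agreement of A and E extends to all m >=
   K. *)
have eAKm (j : nat) n : phiA y A (K%:Z + j%:Z) n = psi (- y) E n (K%:Z + j%:Z).
  elim: j n => [|j IH] n; first by rewrite addr0 eAK.
  rewrite -addn1 PoszD addrA.
  have /eqP := rA (K%:Z + j%:Z) n; rewrite -subr_eq => /eqP <-.
  by have /eqP := rD (K%:Z + j%:Z) n; rewrite -subr_eq => /eqP <-; rewrite !IH.
have eABj (j : nat) m : phiA y A m (J%:Z + j%:Z) = psi y B m (J%:Z + j%:Z).
  elim: j m => [|j IH] m; first by rewrite addr0 eA eB.
  by rewrite -addn1 PoszD addrA rA rB !IH.
move=> m n; apply/eqP; rewrite -subr_eq0; apply/eqP; move: m n.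
(* In row J + |c0| the series E contributes nothing, and A and B agree. In any row, the entry m = K
   + |b0| receives nothing from B, and A and E agree. *)
apply: (@pascal_rec_eq0 y _ (J%:Z + `|c0|%:Z)) => //.
- by move=> m n; rewrite rA rB rD; ring.
- move=> m; rewrite eABj subrr sub0r /psi nsum0 ?oppr0 // => k.
  by rewrite hD ?mulr0 //; lia.
- move=> n; exists (K%:Z + `|b0|%:Z); rewrite eAKm [psi y B _ _]nsum0.
    by rewrite subr0 subrr.
  by move=> k; rewrite hB ?mulr0 //; lia.
Qed.

End FormalJacobi.

(** * Exponential polynomials *)

Section ExpPoly.
Variable R : realType.
Local Notation C := R[i].
Implicit Types (l c : C) (P Q : {poly C}).

Lemma poly_natmul_roots P c : c != 0 -> (forall n : nat, P.[n%:R * c] = 0) -> P = 0.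
Proof.
move=> c0 h; apply/eqP/negPn/negP => P0.
have al : all (root P) [seq n%:R * c | n <- iota 0 (size P)].
  by apply/allP => x /mapP[n _ ->]; rewrite /root h.
have ur : uniq [seq n%:R * c | n <- iota 0 (size P)].
  rewrite map_inj_uniq ?iota_uniq // => m n /(mulIf c0)/eqP.
  by rewrite eqr_nat => /eqP.
by have := max_poly_roots P0 al ur; rewrite size_map size_iota ltnn.
Qed.

Lemma size_shift P c : size (P \Po ('X + c%:P)) = size P.
Proof. by rewrite size_comp_poly2 // size_XaddC. Qed.

Lemma lead_coef_shift P c : lead_coef (P \Po ('X + c%:P)) = lead_coef P.
Proof.
rewrite lead_coef_comp ?size_XaddC // lead_coefXaddC expr1n mulr1 //.
Qed.

(** Leading coefficients give mu = 1 unless P = 0; then P - P(0) vanishes at all natural multiples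
    of [c]. *)
Lemma poly_shift_eigen P (mu c : C) : c != 0 -> mu *: (P \Po ('X + c%:P)) = P ->
  P = 0 \/ (mu = 1 /\ P = (P.[0])%:P).
Proof.
move=> c0 h; case: (eqVneq P 0) => P0; [by left | right].
have mu1 : mu = 1.
  have := congr1 lead_coef h; rewrite lead_coefZ lead_coef_shift -[RHS]mul1r.
  by move/mulIf; apply; rewrite lead_coef_eq0.
split=> //; apply/eqP; rewrite -subr_eq0; apply/eqP.
apply: (poly_natmul_roots c0) => n; rewrite hornerD hornerN hornerC.
apply/eqP; rewrite subr_eq0; apply/eqP.
elim: n => [|n IH]; first by rewrite mul0r.
rewrite -{}IH -[in RHS]h mu1 scale1r horner_comp !hornerE.
by rewrite -natr1 mulrDl mul1r.
Qed.

(** Induction on the total size of the [Q r]: the operator f(p) -> f(p + 1) - r1 f(p) keeps the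
    shape of the sum, lowers the size of [Q r1] and raises no other size. *)
Lemma geom_poly_indep (rs : seq C) (Q : C -> {poly C}) :
  uniq rs -> 0 \notin rs ->
  (forall p : nat, \sum_(r <- rs) r ^+ p * (Q r).[p%:R] = 0) ->
  forall r, r \in rs -> Q r = 0.
Proof.
move=> urs rs0; have [n] := ubnP (\sum_(r <- rs) size (Q r)).
elim: n Q => // n IH Q hn h.
have [/allP allQ|/allPn[r1 r1rs Qr1]] := boolP (all (fun r => Q r == 0) rs).
  by move=> r /allQ/eqP.
pose Q' r := r *: (Q r \Po ('X + 1%:P)) - r1 *: Q r.
have r10 : r1 != 0 by apply: contraNneq rs0 => <-.
have sQ' r : (size (Q' r) <= size (Q r))%N.
  rewrite /Q' (leq_trans (size_polyD _ _)) // geq_max size_polyN.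
  by rewrite !(leq_trans (size_scale_leq _ _)) // size_shift.
have sQ'1 : (size (Q' r1) < size (Q r1))%N.
  rewrite -(prednK (n := size (Q r1))) ?lt0n ?size_poly_eq0 // ltnS.
  apply/leq_sizeP => j; rewrite leq_eqVlt => /orP[/eqP <-|hj].
    rewrite /Q' coefB !coefZ -{1}(size_shift (Q r1) 1) -!lead_coefE lead_coef_shift.
    by rewrite subrr.
  apply/(leq_sizeP _ _ (sQ' r1)); move: hj.
  by rewrite prednK // lt0n size_poly_eq0.
have Q'0 : forall r, r \in rs -> Q' r = 0.
  apply: IH.
    rewrite -ltnS; apply: leq_trans hn; rewrite ltnS.
    rewrite !(big_rem r1 r1rs) /= -addSn leq_add // leq_sum // => r _; exact: sQ'.
  move=> p; rewrite /Q'.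
  have := h p.+1; have := h p => /(congr1 ( *%R r1)).
  rewrite mulr0 mulr_sumr => h1 h2.
  transitivity (\sum_(r <- rs) r ^+ p.+1 * (Q r).[p.+1%:R]
                - \sum_(r <- rs) r1 * (r ^+ p * (Q r).[p%:R])).
    rewrite -sumrB; apply: eq_bigr => r _.
    by rewrite hornerD hornerN !hornerZ horner_comp hornerD hornerX hornerC natr1 exprS; ring.
  by rewrite h1 h2 subrr.
have Qn r : r \in rs -> r != r1 -> Q r = 0.
  move=> rrs rr1; have := Q'0 r rrs => /eqP; rewrite subr_eq0 => /eqP.
  move/(congr1 lead_coef); rewrite !lead_coefZ lead_coef_shift => /eqP.
  rewrite -subr_eq0 -mulrBl mulf_eq0 subr_eq0 (negbTE rr1) /= lead_coef_eq0.
  by move/eqP.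
have [//|[_ Qc]] : Q r1 = 0 \/ (1 = 1 :> C /\ Q r1 = ((Q r1).[0])%:P).
  apply: (@poly_shift_eigen _ 1 1) => //.
  rewrite scale1r; have /eqP := Q'0 r1 r1rs; rewrite /Q' -scalerBr scaler_eq0.
  by rewrite (negbTE r10) subr_eq0 => /eqP.
- move=> Q0 r rrs; case: (eqVneq r r1) => [->//|]; exact: Qn.
move=> r rrs; case: (eqVneq r r1) => [->|]; last exact: Qn.
rewrite Qc; have := h 0%N; rewrite (bigD1_seq r1) //= big1_seq ?addr0 ?expr0 ?mul1r.
  by move=> ->.
by move=> r' /andP[rr1 rrs']; rewrite (Qn r') // horner0 mulr0.
Qed.

(** With l = log z this is a ray along which z tends to 0. *)
Definition halfline (P : C -> Prop) :=
  exists (c0 : C) (b : R), forall x : R, x < b -> P (c0 + x%:C).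

Lemma halfline_mono (P1 P2 : C -> Prop) :
  (forall l, P1 l -> P2 l) -> halfline P1 -> halfline P2.
Proof. by move=> h [c0 [b hb]]; exists c0, b => x /hb/h. Qed.

(** Sampling along an arithmetic progression inside the half-line turns the sum into the one of
    [geom_poly_indep]. *)
Lemma cexp_sum_indep (rs : seq C) (Q : C -> {poly C}) : uniq rs ->
  halfline (fun l => \sum_(r <- rs) cexp (r * l) * (Q r).[l] = 0) ->
  forall r, r \in rs -> Q r = 0.
Proof.
move=> urs [c0 [b h]].
(* The step [dl] = 1 / M satisfies |Im r - Im s| dl < 2 pi, which keeps the ratios e^(- r dl)
   distinct. *)
pose M : R := 1 + 2 * \sum_(r <- rs) `|complex.Im r|.
have S0 : 0 <= \sum_(r <- rs) `|complex.Im r| by apply: sumr_ge0.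
have M0 : 0 < M by rewrite /M; lra.
have leM r : r \in rs -> 2 * `|complex.Im r| < M.
  move=> rrs; rewrite /M (big_rem r rrs) /=.
  have : 0 <= \sum_(y <- rem r rs) `|complex.Im y| by apply: sumr_ge0.
  by lra.
pose dl := M^-1.
have dl0 : 0 < dl by rewrite invr_gt0.
pose lam r := cexp (r * - dl%:C).
pose l0 := c0 + (b - 1)%:C.
have lam_inj : {in rs &, injective lam}.
  move=> r s rrs srs; rewrite /lam => e.
  have : cexp ((r - s) * - dl%:C) = 1.
    by rewrite mulrBl cexpD e cexpN divff // cexp_neq0.
  move=> /cexp_eq1[n hn].
  have dlC : dl%:C != 0 by rewrite (inj_eq (@complexI R)) gt_eqF.
  have hrs : r - s = n%:~R * twopii R * - M%:C.
    by rewrite -hn -mulrA mulrNN -rmorphM /= mulVf ?gt_eqF // mulr1.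
  have him : complex.Im r - complex.Im s = - (n%:~R * (M * (pi *+ 2))).
    have <- : complex.Im (r - s) = complex.Im r - complex.Im s by rewrite raddfB.
    rewrite hrs twopiiE -(rmorph_int (real_complex R)) /=; simpc => /=.
    by ring.
  have n0 : n = 0.
    apply/eqP; apply: contraT => n0.
    have h1 : 1 <= `|n%:~R| :> R by rewrite -intr_norm ler1z -gtz0_ge1 normr_gt0.
    have : M * (pi *+ 2) <= `|complex.Im r - complex.Im s|.
      rewrite him normrN normrM [X in _ <= _ * X]ger0_norm.
        by rewrite ler_peMl // mulr_ge0 ?(ltW M0) // mulrn_wge0 // pi_ge0.
      by rewrite mulr_ge0 ?(ltW M0) // mulrn_wge0 // pi_ge0.
    have := ler_normB (complex.Im r) (complex.Im s).
    have := leM r rrs; have := leM s srs; have := pi_ge2 R.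
    rewrite mulr2n => p2 h2 h3 h4 h5; exfalso.
    have : M * 1 <= M * (pi + pi) by rewrite ler_pM2l //; lra.
    by lra.
  by move/eqP: hrs; rewrite n0 !mul0r subr_eq0 => /eqP.
pose Q' mu := \sum_(r <- rs | lam r == mu)
   cexp (r * l0) *: (Q r \Po (l0%:P - dl%:C *: 'X)).
have Q'E r : r \in rs -> Q' (lam r) = cexp (r * l0) *: (Q r \Po (l0%:P - dl%:C *: 'X)).
  move=> rrs; rewrite /Q' big_mkcond (bigD1_seq r) //= eqxx big1_seq ?addr0 //.
  by move=> s /andP[sr srs]; case: eqP => // /(lam_inj _ _ srs rrs) e; rewrite e eqxx in sr.
have key : forall mu, mu \in map lam rs -> Q' mu = 0.
  apply: geom_poly_indep.
  - by rewrite map_inj_in_uniq.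
  - by apply/negP => /mapP[r _ /esym/eqP]; apply/negP; exact: cexp_neq0.
  move=> p; rewrite big_map -[RHS](h (b - 1 - dl * p%:R)); last first.
    have : 0 <= dl * p%:R by rewrite mulr_ge0 // ltW.
    by lra.
  apply: eq_big_seq => r rrs; rewrite Q'E // hornerZ horner_comp hornerD hornerN hornerC hornerZ hornerX.
  have eC : (b - 1 - dl * p%:R)%:C = (b - 1)%:C - dl%:C * p%:R.
    by rewrite [LHS]rmorphB [X in _ - X]rmorphM /= rmorph_nat.
  rewrite mulrA /lam -cexpMn -cexpD eC /l0; congr (cexp _ * _.[_]); ring.
move=> r rrs; have := key (lam r) (map_f lam rrs); rewrite Q'E // => /eqP.
rewrite scaler_eq0 (negbTE (cexp_neq0 _)) /= => /eqP.
have dlC : dl%:C != 0 by rewrite (inj_eq (@complexI R)) gt_eqF.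
move/(congr1 (fun P => P \Po ((dl%:C)^-1 *: (l0%:P - 'X)))).
rewrite comp_poly0 -comp_polyA comp_polyB comp_polyC comp_polyZ comp_polyX.
by rewrite scalerA divff // scale1r opprB addrC subrK comp_polyXr.
Qed.

End ExpPoly.

Lemma sum_by_key (T K : eqType) (V : nmodType) (key : T -> K) (s : seq T)
    (rs : seq K) (F : T -> V) : uniq rs -> (forall c, c \in s -> key c \in rs) ->
  \sum_(c <- s) F c = \sum_(r <- rs) \sum_(c <- s | key c == r) F c.
Proof.
move=> urs hs; under [RHS]eq_bigr => r _ do rewrite big_mkcond.
rewrite exchange_big /=; apply: eq_big_seq => c /hs crs.
rewrite (bigD1_seq (key c)) //= eqxx big1 ?addr0 // => r.
by rewrite eq_sym => /negbTE ->.
Qed.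

Section ExpPolyAlgebra.
Variable R : realType.
Local Notation C := R[i].
Implicit Types (l c : C) (P Q : {poly C}) (m : lmono R).

(** The monomial x^r (log x)^k as a function of l = log x: all branches are values of this single
    function. *)
Definition mon m l : C := cexp (m.1 * l) * l ^+ m.2.

Lemma monD m1 m2 l : mon (m1 + m2) l = mon m1 l * mon m2 l.
Proof. by rewrite /mon /= mulrDl cexpD exprD; ring. Qed.

Definition exppoly (phi : C -> C) :=
  exists s : seq (C * lmono R), forall l, phi l = \sum_(c <- s) c.1 * mon c.2 l.

Lemma exppoly_rep phi : exppoly phi -> exists (rs : seq C) (Q : C -> {poly C}),
  uniq rs /\ forall l, phi l = \sum_(r <- rs) cexp (r * l) * (Q r).[l].
Proof.
move=> [s hs]; exists (undup [seq t.2.1 | t <- s]).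
exists (fun r => \sum_(t <- s | t.2.1 == r) t.1 *: 'X^(t.2.2)).
split=> [|l]; first exact: undup_uniq.
rewrite hs (@sum_by_key _ _ _ (fun t => t.2.1) s (undup [seq t.2.1 | t <- s])) ?undup_uniq //.
  apply: eq_bigr => r _; rewrite horner_sum mulr_sumr; apply: eq_bigr => c /eqP <-.
  by rewrite hornerZ hornerXn /mon; ring.
by move=> t ht; rewrite mem_undup; apply/mapP; exists t.
Qed.

Lemma exppoly_eq0 phi : exppoly phi -> halfline (fun l => phi l = 0) ->
  forall l, phi l = 0.
Proof.
move=> /exppoly_rep[rs [Q [urs hphi]]] h l.
have Q0 := cexp_sum_indep urs (halfline_mono (fun l e => etrans (esym (hphi l)) e) h).
by rewrite hphi big1_seq // => r /andP[_ /Q0 ->]; rewrite horner0 mulr0.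
Qed.

Lemma mon_indep (ms : seq (lmono R)) (f : lmono R -> C) : uniq ms ->
  halfline (fun l => \sum_(m <- ms) f m * mon m l = 0) ->
  forall m, m \in ms -> f m = 0.
Proof.
move=> ums h m hm.
pose rs := undup [seq m.1 | m <- ms].
pose Q r : {poly C} := \sum_(m <- ms | m.1 == r) f m *: 'X^(m.2).
have hrs : m.1 \in rs by rewrite mem_undup; apply/mapP; exists m.
have : Q m.1 = 0.
  apply: (@cexp_sum_indep _ rs) hrs; first exact: undup_uniq.
  apply: halfline_mono h => l h; rewrite -[RHS]h {h}.
  rewrite [RHS](@sum_by_key _ _ _ (fun m => m.1) _ rs) ?undup_uniq //.
    apply: eq_bigr => r _; rewrite horner_sum mulr_sumr; apply: eq_bigr => c /eqP <-.
    by rewrite hornerZ hornerXn /mon; ring.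
  by move=> t ht; rewrite mem_undup; apply/mapP; exists t.
move=> /(congr1 (fun P : {poly C} => P`_m.2)); rewrite coef0 coef_sum => <-.
rewrite big_mkcond (bigD1_seq m) //= eqxx coefZ coefXn eqxx mulr1 big1_seq ?addr0 //.
move=> m' /andP[nm _] /=; case: eqP => // er; rewrite coefZ coefXn.
case: eqP => [ek|]; last by rewrite mulr0.
case/eqP: nm; case: m' m er ek {h hm hrs} => [r k] [r' k'] /= -> -> //.
Qed.

Lemma exppoly_mon m : exppoly (mon m).
Proof. by exists [:: (1, m)] => l; rewrite big_seq1 mul1r. Qed.

Lemma exppolyD phi psi : exppoly phi -> exppoly psi ->
  exppoly (fun l => phi l + psi l).
Proof. by move=> [s hs] [t ht]; exists (s ++ t) => l; rewrite big_cat /= hs ht. Qed.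

Lemma exppolyM phi psi : exppoly phi -> exppoly psi ->
  exppoly (fun l => phi l * psi l).
Proof.
move=> [s hs] [t ht].
exists [seq (a.1 * d.1, a.2 + d.2) | a <- s, d <- t] => l.
rewrite hs ht big_allpairs_dep /= mulr_suml; apply: eq_bigr => c _.
by rewrite mulr_sumr; apply: eq_bigr => d _; rewrite monD; ring.
Qed.

Lemma exppolyC c : exppoly (fun=> c).
Proof.
by exists [:: (c, 0)] => l; rewrite big_seq1 /mon /= mul0r cexp0 expr0 !mulr1.
Qed.

Lemma eq_exppoly phi psi : phi =1 psi -> exppoly phi -> exppoly psi.
Proof. by move=> e [s hs]; exists s => l; rewrite -e. Qed.

Lemma exppoly_cexp c : exppoly (fun l => cexp (c * l)).
Proof. by apply: eq_exppoly (exppoly_mon (c, 0%N)) => l; rewrite /mon /= expr0 mulr1. Qed.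

Lemma exppoly_sum (T : Type) (s : seq T) (p : pred T) (F : T -> C -> C) :
  (forall t, exppoly (F t)) -> exppoly (fun l => \sum_(t <- s | p t) F t l).
Proof.
move=> h; elim: s => [|t s IH].
  by apply: eq_exppoly (exppolyC 0) => l; rewrite big_nil.
case ht : (p t); last by apply: eq_exppoly IH => l; rewrite big_cons ht.
by apply: eq_exppoly (exppolyD (h t) IH) => l; rewrite big_cons ht.
Qed.

Lemma exppolyX phi n : exppoly phi -> exppoly (fun l => phi l ^+ n).
Proof.
move=> h; elim: n => [|n IH]; first exact: exppolyC.
by apply: eq_exppoly (exppolyM h IH) => l; rewrite exprS.
Qed.

(** The translation by 2 pi i multiplies e^(r l) by e^(2 pi i r). By [poly_shift_eigen] each nonzero
    coefficient is constant and has an integral exponent r. *)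
Lemma exppoly_periodic phi : exppoly phi ->
  halfline (fun l => phi (l + twopii R) = phi l) ->
  exists (J : nat) (P : {poly C}), forall l, phi l = cexp l ^- J * P.[cexp l].
Proof.
move=> /exppoly_rep[rs [Q [urs hphi]]] h.
have Q0 : forall r, r \in rs ->
    cexp (r * twopii R) *: (Q r \Po ('X + (twopii R)%:P)) - Q r = 0.
  apply: cexp_sum_indep => //; apply: halfline_mono h => l /eqP.
  rewrite -subr_eq0 => /eqP e; rewrite -[RHS]e !hphi -sumrB.
  apply: eq_bigr => r _.
  rewrite hornerD hornerN hornerZ horner_comp hornerD hornerX hornerC.
  have -> : cexp (r * (l + twopii R)) = cexp (r * l) * cexp (r * twopii R).
    by rewrite mulrDr cexpD.
  ring.
have {}Q0 r : r \in rs -> exists (n : int) c, forall l,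
    cexp (r * l) * (Q r).[l] = c * cexp l ^ n.
  move=> /Q0/eqP; rewrite subr_eq0 => /eqP /(poly_shift_eigen (twopii_neq0 R)).
  move=> [->|[]]; first by exists 0, 0 => l; rewrite horner0 mulr0 mul0r.
  rewrite mulrC => /cexp_twopiiM[n er] eQ; exists n, (Q r).[0] => l.
  by rewrite {1}eQ hornerC {1}er cexpMz mulrC.
have {Q0} : exists (J : nat) (P : {poly C}), forall l,
    \sum_(r <- rs) cexp (r * l) * (Q r).[l] = cexp l ^- J * P.[cexp l].
  elim: rs Q0 {urs hphi} => [_|r rs IH Q0].
    by exists 0%N, 0 => l; rewrite big_nil horner0 mulr0.
  have [n [c hc]] := Q0 r (mem_head _ _).
  have [|J [P hP]] := IH; first by move=> t ht; apply: Q0; rewrite inE ht orbT.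
  exists (J + `|n|)%N, (P * 'X^`|n| + c *: 'X^(`|(J + `|n|)%:Z + n|)) => l.
  rewrite big_cons hc hP hornerD hornerM hornerZ !hornerXn mulrDr addrC.
  have cl0 : cexp l \is a GRing.unit by rewrite unitfE cexp_neq0.
  congr (_ + _).
    rewrite exprD; have eJ := expf_neq0 J (cexp_neq0 l).
    have en := expf_neq0 `|n|%N (cexp_neq0 l).
    by move: (cexp l ^+ J) (cexp l ^+ `|n|) eJ en => a b a0 b0; field; rewrite a0 b0.
  rewrite mulrCA; congr (_ * _).
  have -> : cexp l ^+ `|(J + `|n|)%:Z + n| = cexp l ^ ((J + `|n|)%:Z + n).
    by rewrite exprnP; congr (_ ^ _); lia.
  by rewrite exprzDr // -exprnP mulrA mulVf ?mul1r // expf_neq0 // cexp_neq0.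
by move=> [J [P hP]]; exists J, P => l; rewrite hphi hP.
Qed.

End ExpPolyAlgebra.

(** * Summable families *)

Section Sums.
Variable R : realType.
Local Notation C := R[i].

Definition asum (I : choiceType) (a : I -> C) :=
  exists M : R, forall F : {fset I}, \sum_(i <- F) cabs (a i) <= M.

(** Convergence along the net of finite subsets; [asum] and [hsum] are the elementary forms of
    [abs_summable] and [sums_to]. *)
Definition hsum (I : choiceType) (a : I -> C) (s : C) :=
  forall e : R, 0 < e -> exists F0 : {fset I}, forall F : {fset I}, (F0 `<=` F)%fset ->
    cabs (\sum_(i <- F) a i - s) < e.

Section Basic.
Variable I : choiceType.
Implicit Types (a b : I -> C) (F : {fset I}).

Lemma sums_to_hsum a s : sums_to a s -> hsum a s.
Proof.
move=> hh e e0; have h := (iffLR (cvgrPdist_lt (K := C) (V := C^o) _ _)) hh.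
have e0' : 0 < e%:C :> C by rewrite ltcR.
have [A _ hA] := h (@filter_filter _ _ (summability.totally_filter)) e%:C e0'; exists A => F AF.
have := hA F AF; rewrite /= (_ : summability.partial_sum a F = \sum_(i <- F) a i); last by rewrite big_seq_fsetE.
by rewrite distrC normr_cabs ltcR.
Qed.

Lemma abs_summable_asum a : abs_summable a -> asum a.
Proof.
rewrite /abs_summable /esum.summable => h.
exists (fine (\esum_(x in [set: I]) `|(cabs (a x))%:E|)%E) => F.
rewrite -lee_fin fineK; last first.
  by rewrite ge0_fin_numE // esum_ge0.
rewrite -sumEFin; apply: le_trans (esum_ge _); last first.
  exists [set` F]; first by split => //; exact: finite_fset.
  exact: lexx.
rewrite -fsbig_seq ?fset_uniq //; apply: lee_sum => i _.
by rewrite lee_fin ler_norm.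
Qed.

Lemma hsum_uniq a (s t : C) : hsum a s -> hsum a t -> s = t.
Proof.
move=> hs ht; apply/eqP; rewrite -subr_eq0 -cabs_eq0; apply: contraT => d0.
have e0 : 0 < cabs (s - t) / 2 by rewrite divr_gt0 // lt_neqAle eq_sym d0 cabs_ge0.
have [F1 h1] := hs _ e0; have [F2 h2] := ht _ e0.
have := h1 _ (fsubsetUl F1 F2); have := h2 _ (fsubsetUr F1 F2).
set S := \sum_(i <- _) _ => u v.
have := cabsD (s - S) (S - t); rewrite addrA subrK (cabsBC s S).
lra.
Qed.

Lemma hsumD a b (s t : C) : hsum a s -> hsum b t -> hsum (fun i => a i + b i) (s + t).
Proof.
move=> ha hb e e0; have e2 : 0 < e / 2 by rewrite divr_gt0.
have [F1 h1] := ha _ e2; have [F2 h2] := hb _ e2.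
exists (F1 `|` F2)%fset => F; rewrite fsubUset => /andP[f1 f2].
rewrite big_split /= opprD addrACA.
have := cabsD (\sum_(i <- F) a i - s) (\sum_(i <- F) b i - t).
by have := h1 _ f1; have := h2 _ f2; lra.
Qed.

Lemma hsum_fin a (r : seq I) : uniq r -> (forall i, i \notin r -> a i = 0) ->
  hsum a (\sum_(i <- r) a i).
Proof.
move=> ur h e e0; exists [fset i in r]%fset => F rF.
suff -> : \sum_(i <- F) a i = \sum_(i <- r) a i by rewrite subrr cabs0.
rewrite (bigID (mem r)) /= [X in _ + X]big1 ?addr0; last by move=> i /h.
rewrite -big_filter; apply: perm_big; apply: uniq_perm => //.
  by rewrite filter_uniq.
move=> i; rewrite mem_filter andb_idr // => ir.
by apply: (fsubsetP rF); rewrite !inE.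
Qed.

Lemma hsum0 : hsum (fun _ : I => 0 : C) 0.
Proof. by have := @hsum_fin (fun=> 0) [::]; rewrite big_nil; apply. Qed.

Lemma hsumZ c a s : hsum a s -> hsum (fun i => c * a i) (c * s).
Proof.
move=> ha e e0; have c1 : 0 < cabs c + 1 by rewrite ltr_wpDl // cabs_ge0.
have [F1 h1] := ha _ (divr_gt0 e0 c1).
exists F1 => F /h1; rewrite -mulr_sumr -mulrBr cabsM ltr_pdivlMr //.
have := cabs_ge0 (\sum_(i <- F) a i - s); have := cabs_ge0 c; nra.
Qed.

Lemma eq_hsum a b s : a =1 b -> hsum a s -> hsum b s.
Proof. by move=> /funext ->. Qed.

Lemma hsum_sum (T : Type) (r : seq T) (f : T -> I -> C) (s : T -> C) :
  (forall t, hsum (f t) (s t)) ->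
  hsum (fun i => \sum_(t <- r) f t i) (\sum_(t <- r) s t).
Proof.
move=> h; elim: r => [|t r IH].
  by rewrite big_nil; apply: eq_hsum hsum0 => i; rewrite big_nil.
by rewrite big_cons; apply: eq_hsum (hsumD (h t) IH) => i; rewrite big_cons.
Qed.

Lemma asumD a b : asum a -> asum b -> asum (fun i => a i + b i).
Proof.
move=> [M hM] [N hN]; exists (M + N) => F.
rewrite (le_trans _ (lerD (hM F) (hN F))) // -big_split /=.
by apply: ler_sum => i _; exact: cabsD.
Qed.

Lemma asum_le a b : (forall i, cabs (b i) <= cabs (a i)) -> asum a -> asum b.
Proof. by move=> h [M hM]; exists M => F; rewrite (le_trans _ (hM F)) // ler_sum. Qed.

Lemma asumZ c a : asum a -> asum (fun i => c * a i).
Proof.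
move=> [M hM]; exists (cabs c * M) => F.
rewrite (le_trans _ (ler_wpM2l (cabs_ge0 c) (hM F))) // mulr_sumr.
by apply: ler_sum => i _; rewrite cabsM.
Qed.

Lemma asum0 : asum (fun _ : I => 0 : C).
Proof. by exists 0 => F; rewrite big1 // => i _; rewrite cabs0. Qed.

Lemma asum_sum (T : Type) (r : seq T) (f : T -> I -> C) :
  (forall t, asum (f t)) -> asum (fun i => \sum_(t <- r) f t i).
Proof.
move=> h; elim: r => [|t r [M hM]].
  by case: asum0 => M hM; exists M => F; under eq_bigr do rewrite big_nil.
have [N hN] := asumD (h t) (ex_intro _ M hM).
by exists N => F; under eq_bigr do rewrite big_cons.
Qed.

Lemma hsum_bound a s (M : R) : hsum a s ->
  (forall F, \sum_(i <- F) cabs (a i) <= M) -> cabs s <= M.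
Proof.
move=> hs hM; apply/ler_addgt0Pr => e e0.
have [F0 h0] := hs _ e0; have := h0 _ (fsubset_refl F0); have := hM F0.
have := cabs_sum F0 predT a; have := cabsD (s - \sum_(i <- F0) a i) (\sum_(i <- F0) a i).
by rewrite subrK cabsBC; lra.
Qed.

Lemma asum_tail a : asum a -> forall e : R, 0 < e -> exists F0 : {fset I},
  forall F, [disjoint F0 & F]%fset -> \sum_(i <- F) cabs (a i) < e.
Proof.
move=> [M hM] e e0.
pose E := [set x : R | exists F : {fset I}, x = \sum_(i <- F) cabs (a i)].
have hE : has_sup E.
  split; first by exists (\sum_(i <- (@fset0 I)) cabs (a i)), fset0.
  by exists M => _ [F ->].
have [_ [F0 ->] hF0] := sup_adherent e0 hE.
exists F0 => F dF.
have : \sum_(i <- (F0 `|` F)%fset) cabs (a i) <= sup E.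
  by apply: sup_upper_bound => //; exists (F0 `|` F)%fset.
have -> : \sum_(i <- (F0 `|` F)%fset) cabs (a i) =
    \sum_(i <- F0) cabs (a i) + \sum_(i <- F) cabs (a i).
  rewrite -big_cat; apply: perm_big; apply: uniq_perm => //.
    rewrite cat_uniq !fset_uniq /= andbT; apply/hasPn => i iF.
    by apply: contraL iF; apply: (fdisjointP dF).
  by move=> i; rewrite mem_cat inE.
lra.
Qed.

Lemma hsum_nonneg (b : I -> R) (M : R) : (forall i, 0 <= b i) ->
  (forall F, \sum_(i <- F) b i <= M) -> exists s, hsum (fun i => (b i)%:C) s.
Proof.
move=> b0 hM.
pose E := [set x : R | exists F : {fset I}, x = \sum_(i <- F) b i].
have hE : has_sup E.
  split; first by exists (\sum_(i <- (@fset0 I)) b i), fset0.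
  by exists M => _ [F ->].
exists (sup E)%:C => e e0; have [_ [F0 ->] hF0] := sup_adherent e0 hE.
exists F0 => F FF.
have h1 : \sum_(i <- F) b i <= sup E by apply: sup_upper_bound => //; exists F.
have h2 : \sum_(i <- F0) b i <= \sum_(i <- F) b i.
  have -> : \sum_(i <- F0) b i = \sum_(i <- F | i \in F0) b i.
    rewrite -[RHS]big_filter; apply: perm_big; apply: uniq_perm => //.
      by rewrite filter_uniq.
    by move=> i; rewrite mem_filter andb_idr // => /(fsubsetP FF).
  by rewrite [leRHS](bigID (mem F0)) /= lerDl sumr_ge0.
rewrite -rmorph_sum -rmorphB /= cabs_real ler0_norm; lra.
Qed.

Lemma asum_hsum a : asum a -> exists s, hsum a s.
Proof.
move=> [M hM].
have pos (f : I -> R) : (forall i, `|f i| <= cabs (a i)) ->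
    exists s, hsum (fun i => (f i)%:C) s.
  move=> hf.
  have [s1 h1] : exists s, hsum (fun i => (Num.max (f i) 0)%:C) s.
    apply: (@hsum_nonneg _ M) => [i|F]; first by rewrite le_max lexx orbT.
    rewrite (le_trans _ (hM F)) // ler_sum // => i _.
    by rewrite (le_trans _ (hf i)) // ge_max ler_norm normr_ge0.
  have [s2 h2] : exists s, hsum (fun i => (Num.max (- f i) 0)%:C) s.
    apply: (@hsum_nonneg _ M) => [i|F]; first by rewrite le_max lexx orbT.
    rewrite (le_trans _ (hM F)) // ler_sum // => i _.
    by rewrite (le_trans _ (hf i)) // ge_max normr_ge0 -normrN ler_norm.
  exists (s1 + (-1) * s2); apply: eq_hsum (hsumD h1 (hsumZ (-1) h2)) => i.
  rewrite mulN1r -rmorphB /=; congr (_%:C).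
  by rewrite /Num.max; case: ltP => ?; case: ltP => ?; lra.
have [s1 h1] := pos (fun i => complex.Re (a i)) (fun i => cabs_ge_Re (a i)).
have [s2 h2] := pos (fun i => complex.Im (a i)) (fun i => cabs_ge_Im (a i)).
exists (s1 + 'i%C * s2); apply: eq_hsum (hsumD h1 (hsumZ 'i%C h2)) => i.
by rewrite -complexE.
Qed.

End Basic.

Lemma cphase (z : C) : exists u : C, cabs u <= 1 /\ u * z = (cabs z)%:C.
Proof.
case: (eqVneq z 0) => [->|z0]; first by exists 0; rewrite cabs0 ler01 mul0r.
have z1 : cabs z != 0 by rewrite cabs_eq0.
exists ((cabs z)%:C / z); rewrite mulfVK // cabsM cabsV cabs_real ger0_norm ?cabs_ge0 //.
by rewrite mulfV.
Qed.

(** Regrouping by degree. The group sums are absolutely summable because, with phases u_j such that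
    u_j A_j = |A_j|, the sum of the |A_j| is a sum of terms bounded by the |a_i|. *)
Lemma asum_fubini (I J : choiceType) (a : I -> C) (s : C) (deg : I -> J) (A : J -> C) :
  asum a -> hsum a s ->
  (forall j, hsum (fun i => if deg i == j then a i else 0) (A j)) ->
  asum A /\ hsum A s.
Proof.
move=> aa ha hA.
have sum1 (u : J -> C) (G : {fset J}) i :
    \sum_(j <- G) u j * (if deg i == j then a i else 0) =
    if deg i \in G then u (deg i) * a i else 0.
  case: ifPn => hG.
    rewrite (bigD1_seq (deg i)) //= eqxx big1_seq ?addr0 // => j /andP[nj _].
    by rewrite eq_sym (negbTE nj) mulr0.
  rewrite big1_seq // => j /andP[_ jG]; case: eqP => [e|]; rewrite ?mulr0 //.
  by rewrite e jG in hG.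
split.
  have [M hM] := aa; exists M => G.
  pose u j := sval (cid (cphase (A j))).
  have u1 j : cabs (u j) <= 1 by rewrite /u; case: cid => x [].
  have uA j : u j * A j = (cabs (A j))%:C by rewrite /u; case: cid => x [].
  have hs := hsum_sum G (fun j => hsumZ (u j) (hA j)).
  have := hsum_bound (M := M) hs.
  rewrite (eq_bigr (fun j => (cabs (A j))%:C)) => [|j _]; last exact: uA.
  rewrite -rmorph_sum cabs_real ger0_norm ?sumr_ge0 // => [|j _]; last exact: cabs_ge0.
  apply=> F; apply: le_trans (hM F); apply: ler_sum => i _.
  rewrite sum1; case: ifP => _; last by rewrite cabs0 cabs_ge0.
  by rewrite cabsM ler_piMl // cabs_ge0.
move=> e e0; have [F0 hF0] := asum_tail aa (divr_gt0 e0 (ltr0n _ 2)).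
(* As soon as G contains the degrees of [F0], the error only involves terms outside [F0]. *)
exists [fset deg i | i in F0]%fset => G hG.
have hs := hsumD (hsum_sum G (fun j => hsumZ 1 (hA j))) (hsumZ (-1) ha).
rewrite mulN1r in hs; under eq_bigr do rewrite -[A _]mul1r.
apply: (@le_lt_trans _ _ (e / 2)); last by rewrite gtr_pMr // invf_lt1 // ltr1n.
apply: hsum_bound hs _ => F; rewrite (bigID (mem F0)) /= big1 ?add0r; last first.
  move=> i iF0; rewrite (sum1 (fun=> 1)) ifT ?mul1r ?mulN1r ?subrr ?cabs0 //.
  by apply: (fsubsetP hG); apply/imfsetP; exists i.
apply: (@le_trans _ _ (\sum_(i <- (F `\` F0)%fset) cabs (a i))).
  rewrite -[leLHS]big_filter [leLHS](perm_big (F `\` F0)%fset) /=; last first.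
    apply: uniq_perm; rewrite ?filter_uniq // => i.
    by rewrite mem_filter !inE.
  apply: ler_sum => i _; rewrite (sum1 (fun=> 1)).
  by case: ifP => _; rewrite ?mul1r mulN1r ?subrr ?cabs0 ?cabs_ge0 // add0r cabsN.
by apply/ltW/hF0/fdisjointP => i iF0; rewrite !inE iF0.
Qed.

End Sums.

(** * Series on a circle, tested at roots of unity *)

Section Circle.
Variable R : realType.
Local Notation C := R[i].
Implicit Types (b : int -> C) (phi psi : C -> C).

Definition uroot (N : nat) : C := cexp (twopii R / N%:R).

Lemma uroot_neq0 N : uroot N != 0. Proof. exact: cexp_neq0. Qed.

Lemma uroot_eq1 N (i : int) : (0 < N)%N -> (uroot N ^ i == 1) = (N%:Z %| i)%Z.
Proof.
move=> N0; have N0' : N%:R != 0 :> C by rewrite pnatr_eq0 -lt0n.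
rewrite /uroot -cexpMz; apply/eqP/idP.
  have -> : i%:~R * (twopii R / N%:R) = twopii R * (i%:~R / N%:R).
    by rewrite mulrCA mulrA.
  move=> /cexp_twopiiM[n /(congr1 ( *%R^~ N%:R))]; rewrite mulfVK // => hn.
  apply/dvdzP; exists n; apply: (@intr_inj C); rewrite hn intrM -pmulrn //.
move=> /dvdzP[n ->]; rewrite intrM -pmulrn.
rewrite (_ : _ * _ * _ = n%:~R * twopii R); last by field.
exact: cexp_twopiiz.
Qed.

Lemma sum_uroot N (i : int) : (0 < N)%N ->
  \sum_(a < N) (uroot N ^ i) ^+ a = if (N%:Z %| i)%Z then N%:R else 0.
Proof.
move=> N0; rewrite -uroot_eq1 //; case: eqP => [->|/eqP h].
  by under eq_bigr do rewrite expr1n; rewrite sumr_const card_ord.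
have /eqP := subrX1 (uroot N ^ i) N.
have -> : (uroot N ^ i) ^+ N = 1.
  rewrite exprnP exprzAC (_ : uroot N ^ N%:Z = 1) ?exp1rz //.
  by apply/eqP; rewrite uroot_eq1 // dvdzz.
by rewrite subrr eq_sym mulf_eq0 subr_eq0 (negbTE h) => /eqP.
Qed.

(** A discrete form of the integral formula for coefficients: averaging over the N-th roots of unity
    leaves the sum of the b_i with i congruent to i0 modulo N, and for large N all of these but b_i0
    lie in a small tail. *)
Lemma circle_uniq b : asum b ->
  (forall N a : nat, (0 < N)%N -> hsum (fun i => b i * (uroot N ^+ a) ^ i) 0) ->
  forall i, b i = 0.
Proof.
move=> ab hb i0; apply/eqP; rewrite -cabs_eq0 eq_le cabs_ge0 andbT.
apply/ler_addgt0Pr => e e0; rewrite add0r.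
have [F0 hF0] := asum_tail ab e0.
(* This exceeds every |i - i0| with i in [F0], so i0 is the only possible index of [F0] in its class
   modulo N. *)
pose N := (\sum_(i <- F0) `|i - i0|).+1.
have hN i : i \in F0 -> (`|i - i0| < N)%N.
  by move=> iF; rewrite /N (big_rem i iF) /= ltnS leq_addr.
have N0 : N%:R != 0 :> C by rewrite pnatr_eq0.
have h1 : hsum (fun i => if (N%:Z %| i - i0)%Z then b i else 0) 0.
  have := hsumZ (N%:R^-1) (hsum_sum (index_enum 'I_N)
    (fun a : 'I_N => hsumZ ((uroot N ^+ a) ^ (- i0)) (hb N a (ltn0Sn _)))).
  rewrite big1 => [|a _]; last by rewrite mulr0.
  rewrite mulr0; apply: eq_hsum => i.
  under eq_bigr => a _.
    rewrite mulrCA -exprzDr ?unitfE ?expf_neq0 ?uroot_neq0 //.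
    rewrite (addrC (- i0)) exprnP exprzAC -exprnP; over.
  rewrite -mulr_sumr sum_uroot //; case: ifP => _; last by rewrite !mulr0.
  by rewrite mulrCA mulVf // mulr1.
have h2 : hsum (fun i => if i == i0 then b i else 0) (b i0).
  have := @hsum_fin _ _ (fun i => if i == i0 then b i else 0) [:: i0] isT.
  by rewrite big_seq1 eqxx; apply=> i; rewrite inE => /negbTE ->.
have h3 := hsumD h2 (hsumZ (-1) h1).
rewrite mulr0 addr0 in h3.
apply: hsum_bound h3 _ => F; rewrite (bigID (mem F0)) /= big1 ?add0r; last first.
  move=> i /hN hi; rewrite mulN1r; case: eqP => [->|ni].
    by rewrite subrr dvdz0 subrr cabs0.
  case: ifP => [/dvdzP[q hq]|_]; last by rewrite subrr cabs0.
  exfalso; case: (eqVneq q 0) => q0; first by move: hq; rewrite q0 mul0r; lia.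
  by move: hi; rewrite hq abszM; move: q0; nia.
apply: (@le_trans _ _ (\sum_(i <- (F `\` F0)%fset) cabs (b i))).
  rewrite -[leLHS]big_filter [leLHS](perm_big (F `\` F0)%fset) /=; last first.
    apply: uniq_perm; rewrite ?filter_uniq // => i.
    by rewrite mem_filter !inE.
  apply: ler_sum => i _; rewrite mulN1r; case: eqP => [->|_].
    by rewrite subrr dvdz0 subrr cabs0 cabs_ge0.
  by rewrite add0r cabsN; case: ifP => _; rewrite ?cabs0 ?cabs_ge0.
by apply/ltW/hF0/fdisjointP => i iF0; rewrite !inE iF0.
Qed.

Definition cvg0 (u : nat -> C) :=
  forall e : R, 0 < e -> exists N0 : nat, forall N, (N0 < N)%N -> cabs (u N) < e.

Lemma cvg0D u v : cvg0 u -> cvg0 v -> cvg0 (fun n => u n + v n).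
Proof.
move=> hu hv e e0; have e2 : 0 < e / 2 by rewrite divr_gt0.
have [N1 h1] := hu _ e2; have [N2 h2] := hv _ e2; exists (maxn N1 N2) => N.
rewrite gtn_max => /andP[n1 n2]; have := h1 _ n1; have := h2 _ n2.
by have := cabsD (u N) (v N); lra.
Qed.

Lemma cvg0_le (M : R) u v : (forall n, cabs (v n) <= M * cabs (u n)) ->
  cvg0 u -> cvg0 v.
Proof.
move=> h hu e e0; have M0 : 0 < `|M| + 1 by rewrite ltr_wpDl.
have [N0 hN] := hu _ (divr_gt0 e0 M0); exists N0 => N /hN.
rewrite ltr_pdivlMr // => h1; have := h N; have := cabs_ge0 (u N).
by have := ler_norm M; nra.
Qed.

Lemma cvg0Z c u : cvg0 u -> cvg0 (fun n => c * u n).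
Proof. by apply: (@cvg0_le (cabs c)) => n; rewrite cabsM. Qed.

Lemma cvg0_sum (T : Type) (r : seq T) (u : T -> nat -> C) :
  (forall t, cvg0 (u t)) -> cvg0 (fun n => \sum_(t <- r) u t n).
Proof.
move=> h; elim: r => [|t r IH].
  by move=> e e0; exists 0%N => N _; rewrite big_nil cabs0.
move=> e e0; have [N0 hN] := cvg0D (h t) IH e0; exists N0 => N /hN.
by rewrite big_cons.
Qed.

Lemma cvg0_const c : cvg0 (fun=> c) -> c = 0.
Proof.
move=> h; apply/eqP; rewrite -cabs_eq0 eq_le cabs_ge0 andbT.
by apply/ler_addgt0Pr => e e0; rewrite add0r; have [N /(_ N.+1 (ltnSn _))/ltW] := h e e0.
Qed.

Lemma cvg0_inv c : cvg0 (fun n => c / n%:R).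
Proof.
move=> e e0; exists (Num.truncn (cabs c / e)) => N hN.
have N0 : 0 < N%:R :> R by rewrite ltr0n (leq_trans _ hN).
have -> : N%:R = (N%:R : R)%:C by rewrite rmorph_nat.
rewrite cabsM cabsV cabs_real ger0_norm ?(ltW N0) // ltr_pdivrMr // mulrC.
rewrite -ltr_pdivrMr //; have := truncnS_gt (cabs c / e) => /lt_le_trans; apply.
by rewrite ler_nat.
Qed.

Lemma cvg0_cexp u : cvg0 u -> cvg0 (fun n => cexp (u n) - 1).
Proof.
move=> hu e e0; have e3 : 0 < e / 4 by rewrite divr_gt0.
have e1 : 0 < Num.min (e / 4) 1 by rewrite lt_min e3 ltr01.
have near0 (f : R -> R) (l : R) : f @ (0 : R) --> l -> exists2 d : R, 0 < d &
    forall x, `|x| < d -> `|f x - l| < Num.min (e / 4) 1.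
  move=> /cvgrPdist_lt/(_ _ e1)[d /= d0 hd]; exists d => // x hx.
  by rewrite distrC; apply: hd; rewrite /= sub0r normrN.
have [d1 d10 h1] : exists2 d : R, 0 < d & forall x, `|x| < d -> `|expR x - 1| < Num.min (e/4) 1.
  apply: near0; have h : expR x @[x --> (0 : R)] --> expR 0 := @continuous_expR R 0.
  by rewrite expR0 in h.
have [d2 d20 h2] : exists2 d : R, 0 < d & forall x, `|x| < d -> `|cos x - 1| < Num.min (e/4) 1.
  apply: near0; have h : cos x @[x --> (0 : R)] --> cos 0 := @continuous_cos R 0.
  by rewrite cos0 in h.
have [d3 d30 h3] : exists2 d : R, 0 < d & forall x, `|x| < d -> `|sin x - 0| < Num.min (e/4) 1.
  apply: near0; have h : sin x @[x --> (0 : R)] --> sin 0 := @continuous_sin R 0.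
  by rewrite sin0 in h.
have d0 : 0 < Num.min d1 (Num.min d2 d3) by rewrite !lt_min d10 d20 d30.
have [N0 hN] := hu _ d0; exists N0 => N /hN; rewrite !lt_min => /and3P[k1 k2 k3].
move: (u N) k1 k2 k3 => [a b'] k1 k2 k3.
have := h1 _ (le_lt_trans (cabs_ge_Re _) k1).
have := h2 _ (le_lt_trans (cabs_ge_Im _) k2).
have := h3 _ (le_lt_trans (cabs_ge_Im _) k3).
rewrite /= subr0 !lt_min => /andP[s1 _] /andP[c1 c2] /andP[x1 x2].
apply: le_lt_trans (cabs_le_ReIm _) _.
have -> : complex.Re (cexp (a +i* b') - 1) = expR a * cos b' - 1.
  by rewrite /cexp raddfB.
have -> : complex.Im (cexp (a +i* b') - 1) = expR a * sin b'.
  by rewrite /cexp raddfB /= subr0.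
have -> : expR a * cos b' - 1 = (expR a - 1) * cos b' + (cos b' - 1) by ring.
have -> : expR a * sin b' = (expR a - 1) * sin b' + sin b' by ring.
have := ler_normD ((expR a - 1) * cos b') (cos b' - 1).
have := ler_normD ((expR a - 1) * sin b') (sin b').
rewrite !normrM.
have : `|cos b'| <= 1 by rewrite ler_norml cos_geN1 cos_le1.
have : `|sin b'| <= 1 by rewrite ler_norml sin_geN1 sin_le1.
have := normr_ge0 (expR a - 1); have := normr_ge0 (sin b').
move: (`|expR a - 1|) (`|cos b'|) (`|sin b'|) (`|cos b' - 1|) x1 s1 c1 => w x y z.
move: (`|(expR a - 1) * cos b' + _|) (`|_ + sin b'|) => p q; clear; nra.
Qed.

(** Continuity at 1 of the sum along e^(- 2 pi i / N): the finitely many terms in [F0] vary little,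
    and all others are bounded by twice the tail. *)
Lemma circle_cont b s (G : nat -> C) : asum b -> hsum b s ->
  (forall N, (0 < N)%N -> hsum (fun i => b i * ((uroot N)^-1) ^ i) (G N)) ->
  cvg0 (fun N => G N - s).
Proof.
move=> ab hb hG e e0.
have [F0 hF0] := asum_tail ab (divr_gt0 e0 (ltr0n _ 4)).
have : cvg0 (fun N => \sum_(i <- F0) b i * (cexp (- (i : int)%:~R * twopii R / N%:R) - 1)).
  apply: cvg0_sum => i; apply: cvg0Z; apply: cvg0_cexp; exact: cvg0_inv.
move=> /(_ _ (divr_gt0 e0 (ltr0n _ 4)))[N0 hN]; exists N0 => N N0N.
have {N0N} [N0' hN'] : (0 < N)%N /\ _ := conj (leq_ltn_trans (leq0n _) N0N) (hN _ N0N).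
have hs := hsumD (hG N N0') (hsumZ (-1) hb); rewrite mulN1r in hs.
have e1 (i : int) : ((uroot N)^-1) ^ i = cexp (- i%:~R * twopii R / N%:R).
  by rewrite exprz_inv -cexpMz mulrNz mulrA.
have hs2 := @hsum_fin _ _ (fun i => if i \in F0 then
     b i * ((uroot N)^-1) ^ i + -1 * b i else 0) F0 (fset_uniq _).
have {}hs2 := hs2 (fun i h => ifN _ _ h).
have hs3 := hsumD hs (hsumZ (-1) hs2).
have : cabs (G N - s - \sum_(i <- F0) b i * (cexp (- (i : int)%:~R * twopii R / N%:R) - 1))
     <= 2 * (e / 4).
  rewrite (eq_big_seq (fun i => if i \in F0 then
     b i * ((uroot N)^-1) ^ i + -1 * b i else 0)); last first.
    by move=> i ->; rewrite e1; ring.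
  rewrite -[X in _ - s + X]mulN1r; apply: hsum_bound hs3 _ => F.
  rewrite (bigID (mem F0)) /= big1 ?add0r; last first.
    by move=> i ->; rewrite [X in _ + X]mulN1r subrr cabs0.
  apply: (@le_trans _ _ (2 * \sum_(i <- (F `\` F0)%fset) cabs (b i))); last first.
    rewrite ler_pM2l //.
    by apply/ltW/hF0/fdisjointP => i iF0; rewrite !inE iF0.
  rewrite -[leLHS]big_filter [leLHS](perm_big (F `\` F0)%fset) /=; last first.
    apply: uniq_perm; rewrite ?filter_uniq // => i.
    by rewrite mem_filter !inE.
  rewrite mulr_sumr big_seq [leRHS]big_seq; apply: ler_sum => i.
  rewrite !inE => /andP[/negbTE -> _]; rewrite mulr0 addr0.
  rewrite (le_trans (cabsD _ _)) // !cabsM cabsN cabs1 mul1r e1 cabs_cexp.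
  suff -> : complex.Re (- i%:~R * twopii R / N%:R) = 0 by rewrite expR0; lra.
  rewrite twopiiE -(rmorph_int (real_complex R)) -(rmorph_nat (real_complex R)) -fmorphV /=.
  by simpc => /=; rewrite ?(mul0r, mulr0, oppr0, subr0).
have := cabsD (G N - s - \sum_(i <- F0) b i * (cexp (- (i : int)%:~R * twopii R / N%:R) - 1))
  (\sum_(i <- F0) b i * (cexp (- (i : int)%:~R * twopii R / N%:R) - 1)).
rewrite subrK; lra.
Qed.

Lemma exppoly_cvg0 phi l c : exppoly phi -> cvg0 (fun N => phi (l + c / N%:R) - phi l).
Proof.
move=> [s hs].
have mono (m : lmono R) : cvg0 (fun N => mon m (l + c / N%:R) - mon m l).
  case: m => r k; elim: k => [|k IH].
    have := cvg0Z (cexp (r * l)) (cvg0_cexp (cvg0_inv (r * c))).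
    apply: (@cvg0_le 1) => N; rewrite mul1r /mon /= !expr0 !mulr1.
    by rewrite mulrBr mulr1 -cexpD mulrDr mulrA.
  have h1 := cvg0Z l IH; have h2 := cvg0Z (mon (r, k) l) (cvg0_inv c).
  have h3 : cvg0 (fun N => (mon (r, k) (l + c / N%:R) - mon (r, k) l) * (c / N%:R)).
    apply: (@cvg0_le (cabs c)) IH => N; rewrite cabsM mulrC ler_wpM2r ?cabs_ge0 //.
    rewrite cabsM cabsV ler_piMr ?cabs_ge0 //.
    have -> : N%:R = (N%:R : R)%:C by rewrite rmorph_nat.
    rewrite cabs_real ger0_norm //; case: N => [|N]; first by rewrite invr0.
    by rewrite invf_le1 // ler1n.
  have := cvg0D (cvg0D h1 h2) h3; apply: (@cvg0_le 1) => N; rewrite mul1r.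
  rewrite /mon /= !exprS; set A := cexp _; set B := cexp _; set D := c / _.
  by rewrite le_eqVlt; apply/orP; left; apply/eqP; congr cabs; ring.
have := cvg0_sum s (fun t => cvg0Z t.1 (mono t.2)).
apply: (@cvg0_le 1) => N; rewrite mul1r !hs -sumrB.
rewrite le_eqVlt; apply/orP; left; apply/eqP; congr cabs; apply: eq_bigr => t _.
by rewrite mulrBr.
Qed.

End Circle.

(** * Asymptotic expansions *)

Section Asymptotics.
Variable R : realType.
Local Notation C := R[i].
Implicit Types (F G : R -> C) (a b : nat -> C).

Definition trunc a n : {poly C} := \poly_(k < n) a k.

(** F(x) has the asymptotic expansion \sum_k a_k x^k for x -> 0+; convergence is not implied. *)
Definition asym F a := forall n : nat, exists (M d : R), 0 < d /\
  forall x : R, 0 < x < d -> cabs (F x - (trunc a n).[x%:C]) <= M * x ^+ n.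

Lemma poly_bounded (P : {poly C}) : exists M : R, forall x : R, 0 < x < 1 ->
  cabs P.[x%:C] <= M.
Proof.
exists (\sum_(i < size P) cabs P`_i) => x /andP[x0 x1].
rewrite horner_coef (le_trans (cabs_sum _ _ _)) // ler_sum // => i _.
rewrite cabsM cabsX cabs_real ger0_norm ?(ltW x0) //.
by rewrite ler_piMr ?cabs_ge0 // exprn_ile1 // ltW.
Qed.

Lemma poly_high (P : {poly C}) n : (forall k, (k < n)%N -> P`_k = 0) ->
  exists M : R, forall x : R, 0 < x < 1 -> cabs P.[x%:C] <= M * x ^+ n.
Proof.
move=> h; have [M hM] := poly_bounded (drop_poly n P); exists M => x hx.
have -> : P = drop_poly n P * 'X^n.
  by rewrite -[LHS](poly_take_drop n) (_ : take_poly n P = 0) ?add0r //;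
     apply/polyP => k; rewrite coef_take_poly coef0; case: ifP => // /h.
rewrite hornerM hornerXn cabsM cabsX cabs_real [ `|x| ]ger0_norm; last by case/andP: hx => /ltW.
rewrite ler_wpM2r ?hM // exprn_ge0 //.
by case/andP: hx => /ltW.
Qed.

Lemma asym_bound F a : asym F a -> exists (M d : R), 0 < d /\
  forall x : R, 0 < x < d -> cabs (F x) <= M.
Proof.
move=> /(_ 0%N)[M [d [d0 h]]]; exists M, d; split=> // x hx.
by have := h x hx; rewrite /trunc poly_def big_ord0 horner0 subr0 expr0 mulr1.
Qed.

Lemma asym_eq F G a d : 0 < d -> (forall x, 0 < x < d -> F x = G x) ->
  asym F a -> asym G a.
Proof.
move=> d0 e h n; have [M [d' [d'0 hM]]] := h n.
exists M, (Num.min d d'); split=> [|x]; first by rewrite lt_min d0.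
move=> /andP[x0]; rewrite lt_min => /andP[x1 x2].
by rewrite -e ?x0 // hM // x0.
Qed.

Lemma asymD F G a b : asym F a -> asym G b ->
  asym (fun x => F x + G x) (fun k => a k + b k).
Proof.
move=> ha hb n; have [M [d [d0 h1]]] := ha n; have [N [d' [d'0 h2]]] := hb n.
exists (M + N), (Num.min d d'); split=> [|x]; first by rewrite lt_min d0.
move=> /andP[x0]; rewrite lt_min => /andP[x1 x2].
have -> : trunc (fun k => a k + b k) n = trunc a n + trunc b n.
  by apply/polyP => k; rewrite coefD !coef_poly; case: ifP => _; rewrite ?addr0.
rewrite hornerD opprD addrACA mulrDl (le_trans (cabsD _ _)) //.
by rewrite lerD ?h1 ?h2 ?x0.
Qed.

Lemma asym_poly (P : {poly C}) : asym (fun x => P.[x%:C]) (fun k => P`_k).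
Proof.
move=> n; have [|M hM] := @poly_high (P - trunc (fun k => P`_k) n) n.
  by move=> k kn; rewrite coefB coef_poly kn subrr.
by exists M, 1; split=> // x hx; rewrite -hornerN -hornerD hM.
Qed.

Lemma asymM F G a b : asym F a -> asym G b ->
  asym (fun x => F x * G x) (fun k => \sum_(i < k.+1) a i * b (k - i)%N).
Proof.
move=> ha hb n; have [M [d [d0 h1]]] := ha n; have [N [d' [d'0 h2]]] := hb n.
have [B [d'' [d''0 h3]]] := asym_bound hb.
have [A h4] := poly_bounded (trunc a n).
set ab := (X in trunc X n).
have [|E h5] := @poly_high (trunc a n * trunc b n - trunc ab n) n.
  move=> k kn; rewrite coefB coefM [X in _ - X]coef_poly kn /ab.
  apply/eqP; rewrite subr_eq0; apply/eqP; apply: eq_bigr => i _.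
  rewrite !coef_poly (leq_ltn_trans _ kn) ?(leq_ltn_trans _ kn) //.
    by rewrite leq_subr.
  by rewrite -ltnS.
exists (`|M| * `|B| + `|A| * `|N| + E), (Num.min 1 (Num.min d (Num.min d' d''))).
split=> [|x]; first by rewrite !lt_min ltr01 d0 d'0.
move=> /andP[x0]; rewrite !lt_min => /and4P[x1 x2 x3 x4].
have -> : F x * G x - (trunc ab n).[x%:C] =
   (F x - (trunc a n).[x%:C]) * G x +
   (trunc a n).[x%:C] * (G x - (trunc b n).[x%:C]) +
   (trunc a n * trunc b n - trunc ab n).[x%:C].
  by rewrite hornerD hornerN hornerM; ring.
rewrite (le_trans (cabsD _ _)) // [leRHS]mulrDl lerD ?h5 ?x0 //.
rewrite (le_trans (cabsD _ _)) // [leRHS]mulrDl.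
have xn : 0 <= x ^+ n by rewrite exprn_ge0 // ltW.
rewrite lerD // cabsM.
  rewrite mulrAC ler_pM ?cabs_ge0 //.
    by rewrite (le_trans (h1 x _)) ?x0 // ler_wpM2r // ler_norm.
  by rewrite (le_trans (h3 x _)) ?x0 // ler_norm.
rewrite -mulrA ler_pM ?cabs_ge0 //.
  by rewrite (le_trans (h4 x _)) ?x0 // ler_norm.
by rewrite (le_trans (h2 x _)) ?x0 // ler_wpM2r // ler_norm.
Qed.

Lemma asymZ c F a : asym F a -> asym (fun x => c * F x) (fun k => c * a k).
Proof.
move=> ha n; have [M [d [d0 h]]] := ha n.
exists (cabs c * M), d; split=> // x hx.
have -> : trunc (fun k => c * a k) n = c *: trunc a n.
  by apply/polyP => k; rewrite coefZ !coef_poly; case: ifP => _; rewrite ?mulr0.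
by rewrite hornerZ -mulrBr cabsM -mulrA ler_wpM2l ?cabs_ge0 ?h.
Qed.

Lemma asym_sum (T : Type) (r : seq T) (F : T -> R -> C) (a : T -> nat -> C) :
  (forall t, asym (F t) (a t)) ->
  asym (fun x => \sum_(t <- r) F t x) (fun k => \sum_(t <- r) a t k).
Proof.
move=> h; elim: r => [|t r IH].
  move=> n; exists 0, 1; split=> // x _; rewrite mul0r big_nil.
  rewrite (_ : trunc _ n = 0) ?horner0 ?subr0 ?cabs0 //.
  by apply/polyP => k; rewrite coef_poly big_nil coef0; case: ifP.
have e1 : (fun k => \sum_(s <- t :: r) a s k) = fun k => a t k + \sum_(s <- r) a s k.
  by apply/funext => k; rewrite big_cons.
have e2 : (fun x => \sum_(s <- t :: r) F s x) = fun x => F t x + \sum_(s <- r) F s x.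
  by apply/funext => x; rewrite big_cons.
rewrite e1 e2; exact: asymD.
Qed.

(** The first nonzero coefficient of an expansion of 0 would be bounded by a multiple of x. *)
Lemma asym_uniq F a b : asym F a -> asym F b -> a =1 b.
Proof.
move=> ha hb.
have h0 := asymD ha (asymZ (-1) hb).
suff h k : a k + -1 * b k = 0.
  by move=> k; apply/eqP; rewrite -subr_eq0 -mulN1r h.
move: h0; set c := fun k => a k + -1 * b k; rewrite -/(c k) => h0.
have [n] := ubnP k; elim: n k => // n IH k; rewrite ltnS => kn.
have {kn IH}hc j : (j < k)%N -> c j = 0.
  by move=> jk; apply: IH; exact: leq_trans kn.
have [M [d [d0 hM]]] := h0 k.+1.
have tr : trunc c k.+1 = c k *: 'X^k.
  apply/polyP => j; rewrite coef_poly coefZ coefXn ltnS leq_eqVlt.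
  by case: eqVneq => [->|_] /=; rewrite ?mulr1 ?mulr0 //; case: ifP => // /hc.
apply/eqP; rewrite -cabs_eq0 eq_le cabs_ge0 andbT.
apply/ler_addgt0Pr => e e0; rewrite add0r.
have M0 : 0 < `|M| + 1 by rewrite ltr_wpDl.
pose x := Num.min (d / 2) (e / (`|M| + 1)).
have x0 : 0 < x by rewrite lt_min !divr_gt0.
have xd : x < d by rewrite gt_min ltr_pdivrMr // ltr_pMr // ltr1n.
have := hM x; rewrite x0 xd => /(_ isT).
rewrite tr hornerZ hornerXn mulN1r subrr add0r cabsN cabsM cabsX cabs_real.
rewrite ger0_norm ?(ltW x0) // exprSr mulrA mulrAC ler_pM2r ?exprn_gt0 // => /le_trans.
apply; have : x <= e / (`|M| + 1) by rewrite ge_min lexx orbT.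
rewrite ler_pdivlMr //; have := ler_norm M; nra.
Qed.

(** For x < x1 the terms of index at least n are dominated by (x / x1)^n times the terms at x1. *)
Lemma asym_hsum F a (x1 : R) : 0 < x1 -> asum (fun k => a k * x1%:C ^+ k) ->
  (forall x : R, 0 < x < x1 -> hsum (fun k => a k * x%:C ^+ k) (F x)) -> asym F a.
Proof.
move=> x10 [M hM] h n; exists (M / x1 ^+ n), x1; split=> // x hx.
have /andP[x0 xx1] := hx.
have h1 : hsum (fun k => if (k < n)%N then a k * x%:C ^+ k else 0)
    (trunc a n).[x%:C].
  have -> : (trunc a n).[x%:C] =
      \sum_(i <- iota 0 n) if (i < n)%N then a i * x%:C ^+ i else 0.
    rewrite horner_poly -(big_mkord xpredT (fun i => a i * x%:C ^+ i)).
    rewrite /index_iota subn0; apply: eq_big_seq => i; rewrite mem_iota => /andP[_].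
    by rewrite add0n => ->.
  by apply: hsum_fin => [|i]; rewrite ?iota_uniq // mem_iota add0n /= => /negbTE ->.
have hs := hsumD (h x hx) (hsumZ (-1) h1); rewrite mulN1r in hs.
apply: hsum_bound hs _ => G.
have q0 : 0 <= x / x1 by rewrite divr_ge0 // ltW.
have q1 : x / x1 <= 1 by rewrite ler_pdivrMr // mul1r ltW.
have -> : M / x1 ^+ n * x ^+ n = (x / x1) ^+ n * M by rewrite expr_div_n; ring.
apply: le_trans (ler_wpM2l (exprn_ge0 _ q0) (hM G)).
rewrite mulr_sumr; apply: ler_sum => k _; rewrite mulN1r.
case: ltnP => kn.
  by rewrite subrr cabs0 mulr_ge0 ?exprn_ge0 ?cabs_ge0.
rewrite subr0 !cabsM !cabsX !cabs_real !ger0_norm ?(ltW x0) ?(ltW x10) //.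
rewrite mulrCA ler_wpM2l ?cabs_ge0 //.
have -> : x ^+ k = (x / x1) ^+ k * x1 ^+ k by rewrite -exprMn divfK // gt_eqF.
by rewrite ler_wpM2r ?exprn_ge0 ?(ltW x10) // ler_wiXn2l.
Qed.

End Asymptotics.

(** * Derivatives of complex functions of a real variable *)

Section ComplexDerivatives.
Variable R : realType.
Local Notation C := R[i].
Implicit Types (f g : R -> C) (t : R).

Definition cderiv f (df : C) t :=
  is_derive t 1 (fun x => complex.Re (f x)) (complex.Re df) /\
  is_derive t 1 (fun x => complex.Im (f x)) (complex.Im df).

Lemma cderivD f g df dg t : cderiv f df t -> cderiv g dg t ->
  cderiv (fun x => f x + g x) (df + dg) t.
Proof.
move=> [f1 f2] [g1 g2]; split; rewrite raddfD /=.
  have e : (fun x => complex.Re (f x + g x)) =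
    (fun x => complex.Re (f x)) + (fun x => complex.Re (g x)).
    by apply/funext => x; rewrite raddfD.
  by rewrite e; exact: is_deriveD.
have e : (fun x => complex.Im (f x + g x)) =
  (fun x => complex.Im (f x)) + (fun x => complex.Im (g x)).
  by apply/funext => x; rewrite raddfD.
by rewrite e; exact: is_deriveD.
Qed.

Lemma ReD (z w : C) : complex.Re (z + w) = complex.Re z + complex.Re w.
Proof. by case: z => a b; case: w => c d. Qed.

Lemma ImD (z w : C) : complex.Im (z + w) = complex.Im z + complex.Im w.
Proof. by case: z => a b; case: w => c d. Qed.

Lemma ReM (z w : C) : complex.Re (z * w) =
  complex.Re z * complex.Re w - complex.Im z * complex.Im w.
Proof. by case: z => a b; case: w => c d. Qed.

Lemma ImM (z w : C) : complex.Im (z * w) =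
  complex.Re z * complex.Im w + complex.Im z * complex.Re w.
Proof. by case: z => a b; case: w => c d. Qed.

Lemma cderivM f g df dg t : cderiv f df t -> cderiv g dg t ->
  cderiv (fun x => f x * g x) (df * g t + f t * dg) t.
Proof.
move=> [f1 f2] [g1 g2]; split.
  have -> : (fun x => complex.Re (f x * g x)) =
    (fun x => complex.Re (f x)) * (fun x => complex.Re (g x)) -
    (fun x => complex.Im (f x)) * (fun x => complex.Im (g x)).
    by apply/funext => x; rewrite ReM.
  apply: is_derive_eq; rewrite ReD !ReM /GRing.scale /=; ring.
have -> : (fun x => complex.Im (f x * g x)) =
  (fun x => complex.Re (f x)) * (fun x => complex.Im (g x)) +
  (fun x => complex.Im (f x)) * (fun x => complex.Re (g x)).
  by apply/funext => x; rewrite ImM.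
apply: is_derive_eq; rewrite ImD !ImM /GRing.scale /=; ring.
Qed.

Lemma cderiv_real (h : R -> R) dh t : is_derive t 1 h dh ->
  cderiv (fun x => (h x)%:C) dh%:C t.
Proof. by move=> hd; split=> //=; exact: is_derive_cst. Qed.

Lemma cderiv_cst (c : C) t : cderiv (fun=> c) 0 t.
Proof. by split=> /=; exact: is_derive_cst. Qed.

Lemma cderiv_cexp f df t : cderiv f df t ->
  cderiv (fun x => cexp (f x)) (df * cexp (f t)) t.
Proof.
move=> [f1 f2].
have e1 : is_derive t 1 (fun x => expR (complex.Re (f x)))
    (expR (complex.Re (f t)) * complex.Re df).
  exact: (@is_derive1_comp _ expR).
have c1 : is_derive t 1 (fun x => cos (complex.Im (f x)))
    (- sin (complex.Im (f t)) * complex.Im df).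
  exact: (@is_derive1_comp _ (@cos R)).
have s1 : is_derive t 1 (fun x => sin (complex.Im (f x)))
    (cos (complex.Im (f t)) * complex.Im df).
  exact: (@is_derive1_comp _ (@sin R)).
split.
  rewrite ReM /=.
  have := @is_deriveM _ _ (fun x => expR (complex.Re (f x))) (fun x => cos (complex.Im (f x))) t 1 _ _ e1 c1.
  rewrite (_ : _ * _ = fun x => complex.Re (cexp (f x))); last by apply/funext.
  by move=> hh; apply: (is_derive_eq hh); rewrite /GRing.scale /=; ring.
rewrite ImM /=.
have := @is_deriveM _ _ (fun x => expR (complex.Re (f x))) (fun x => sin (complex.Im (f x))) t 1 _ _ e1 s1.
rewrite (_ : _ * _ = fun x => complex.Im (cexp (f x))); last by apply/funext.
by move=> hh; apply: (is_derive_eq hh); rewrite /GRing.scale /=; ring.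
Qed.

Lemma cderivX f df t n : cderiv f df t ->
  cderiv (fun x => f x ^+ n) (n%:R * f t ^+ n.-1 * df) t.
Proof.
move=> h; elim: n => [|n IH].
  by rewrite !mul0r; under eq_fun do rewrite expr0; exact: cderiv_cst.
have := cderivM h IH; under eq_fun do rewrite -exprS.
suff -> : df * f t ^+ n + f t * (n%:R * f t ^+ n.-1 * df) = n.+1%:R * f t ^+ n.+1.-1 * df by [].
case: n {IH} => [|n] /=; first by rewrite !expr0; ring.
by rewrite exprS -[n.+2]addn2 -[n.+1]addn1 !natrD; ring.
Qed.

(** The mean value theorem is applied to the real and to the imaginary part, whence the factor 2. *)
Lemma cderiv_mvt f (df : R -> C) (n : nat) (M t : R) : t < 0 ->
  (forall s, t <= s <= 0 -> cderiv f (df s) s) ->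
  (forall s, t <= s <= 0 -> cabs (df s) <= M * `|s| ^+ n) -> f 0 = 0 ->
  cabs (f t) <= 2 * M * `|t| ^+ n.+1.
Proof.
move=> t0 hd hM f0.
have bnd (h dh : R -> R) : h 0 = 0 ->
    (forall s, t <= s <= 0 -> is_derive s 1 h (dh s)) ->
    (forall s, t <= s <= 0 -> `|dh s| <= M * `|s| ^+ n) -> `|h t| <= M * `|t| ^+ n.+1.
  move=> h0 hdh hb.
  have d1 x : x \in `]t, 0[ -> is_derive x 1 h (dh x).
    by rewrite in_itv /= => /andP[x1 x2]; apply: hdh; rewrite !ltW.
  have d2 x : x \in `[t, 0] -> derivable h x 1.
    by rewrite in_itv /= => /hdh[].
  have [c] := @MVT R h dh t 0 t0 d1 (derivable_within_continuous d2).
  rewrite in_itv /= => /andP[c1 c2]; rewrite h0 !sub0r => e.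
  rewrite -normrN e normrM normrN exprSr mulrA ler_wpM2r //.
  have M0 : 0 <= M.
    have := hb t; rewrite lexx ltW // => /(_ isT) /(le_trans (normr_ge0 _)).
    by rewrite pmulr_lge0 // exprn_gt0 // normr_gt0 lt_eqF.
  rewrite (le_trans (hb c _)) ?(ltW c1) ?(ltW c2) // ler_wpM2l //.
  by rewrite lerXn2r ?nnegrE // !ltr0_norm // lerN2 ltW.
rewrite (le_trans (cabs_le_ReIm _)) // -mulrA mulr2n mulrDl mul1r lerD //.
  apply: (bnd (fun s => complex.Re (f s)) (fun s => complex.Re (df s))).
  - by rewrite f0.
  - by move=> s /hd[].
  - by move=> s hs; rewrite (le_trans (cabs_ge_Re _)) // hM.
apply: (bnd (fun s => complex.Im (f s)) (fun s => complex.Im (df s))).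
- by rewrite f0.
- by move=> s /hd[].
- by move=> s hs; rewrite (le_trans (cabs_ge_Im _)) // hM.
Qed.

End ComplexDerivatives.

(** * Taylor expansion of powers times logarithms *)

Section PowLog.
Variable R : realType.
Local Notation C := R[i].
Implicit Types (a : C) (t : R).

(* The coefficient of y^j in the binomial coefficient of a + y over k. *)
Fixpoint binomc a (k j : nat) : C :=
  if k is k'.+1 then
    ((a - k'%:R) * binomc a k' j + (if j is j'.+1 then binomc a k' j' else 0))
    / k%:R
  else (j == 0%N)%:R.

(** The coefficient of y^j in (1 + t)^(a + y). *)
Definition powlog a (j : nat) t : C :=
  cexp (a * (ln (1 + t))%:C) * (ln (1 + t))%:C ^+ j / (j`!)%:R.

Definition powlogP a j := if j is j'.+1 then powlog a j' else fun=> 0.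

Lemma cderiv_poly (P : {poly C}) t : cderiv (fun x => P.[x%:C]) P^`().[t%:C] t.
Proof.
elim/poly_ind: P => [|P c IH].
  by under eq_fun do rewrite horner0; rewrite deriv0 horner0; exact: cderiv_cst.
have h1 := cderivD (cderivM IH (cderiv_real (is_derive_id t 1))) (cderiv_cst c t).
have -> : (fun x => (P * 'X + c%:P).[x%:C]) = fun x => P.[x%:C] * x%:C + c.
  by apply/funext => x; rewrite !hornerE.
suff -> : (P * 'X + c%:P)^`().[t%:C] = P^`().[t%:C] * t%:C + P.[t%:C] * 1%:C + 0 by exact: h1.
by rewrite derivD derivM derivX derivC !hornerE.
Qed.

Lemma cderiv_powlog a j t : -1 < t ->
  cderiv (powlog a j) ((a * powlog a j t + powlogP a j t) / (1 + t%:C)) t.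
Proof.
move=> t1; have t0 : 0 < 1 + t by lra.
have hl : is_derive t 1 (fun x => ln (1 + x)) (1 + t)^-1.
  have h1 : is_derive t 1 (fun x => 1 + x) 1.
    have -> : (fun x : R => 1 + x) = (cst (1 : R) : R -> R) + id by [].
    by apply: is_derive_eq; rewrite add0r.
  have := @is_derive1_comp _ (@ln R) (fun x => 1 + x) t _ _ (is_derive1_ln t0) h1.
  by rewrite mulr1.
have hL := cderiv_real hl.
have := cderivM (cderivM (cderiv_cexp (cderivM (cderiv_cst a t) hL)) (cderivX j hL))
   (cderiv_cst ((j`!)%:R^-1) t).
have e1 : ((1 + t)^-1)%:C = (1 + t%:C)^-1 by rewrite fmorphV rmorphD.
have t0C : 1 + t%:C != 0 by rewrite -(rmorph1 (real_complex R)) -rmorphD (inj_eq (@complexI R)) gt_eqF.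
set X := (X in cderiv _ X _ -> _); set Y := (X in _ -> cderiv _ X _).
suff -> : X = Y by [].
rewrite {}/X {}/Y e1 /powlogP /powlog; set L := (ln (1 + t))%:C; set E := cexp _.
case: j => [|j] /=; first by rewrite fact0 !expr0; field.
have f0 : (j`!)%:R != 0 :> C by rewrite pnatr_eq0 -lt0n fact_gt0.
have j0 : (j.+1)%:R != 0 :> C by rewrite pnatr_eq0.
rewrite -/L -/E factS natrM exprS; move: (j.+1)%:R (j`!)%:R (L ^+ j) f0 j0 => v w p w0 v0.
by field; rewrite w0 v0 t0C.
Qed.

(** The differential equation (1 + t) f' = a f + h, in terms of coefficients: truncations satisfy it
    up to a single term of degree n. *)
Lemma trunc_ode a (b c : nat -> C) n :
  (forall m, b m.+1 *+ m.+1 = (a - m%:R) * b m + c m) ->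
  a *: trunc b n + trunc c n - (1 + 'X) * (trunc b n.+1)^`() = - (n%:R * b n) *: 'X^n.
Proof.
move=> key.
apply/polyP => k; rewrite coefB coefD !coefZ mulrDl mul1r coefD coefXM !coef_deriv.
rewrite /trunc !coef_poly coefXn ltnS.
case: (ltngtP k n) => [kn|kn|->].
- rewrite !key mulr0; case: k kn => [|k] kn /=; first by ring.
  rewrite ltnS (ltnW kn) -[_ *+ _]mulr_natr; ring.
- rewrite mulr0 mul0rn; case: k kn => // k kn; rewrite /= ltnS.
  by rewrite leqNgt kn /= mul0rn mulr0 !addr0 subr0.
- rewrite mulr0 mul0rn mulr1; case: n => [|n] /=; first by rewrite !mul0r; ring.
  by rewrite ltnS leqnn -[_ *+ _]mulr_natr; ring.
Qed.

(** Induction on n. By [cderiv_powlog] and [trunc_ode] the derivative of the remainder of order n +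
    1 is a combination of remainders of order n and of t^n, and [cderiv_mvt] integrates the bound.
    The range is nonpositive because t is z_0 / z_2 with z_0 > 0 > z_2. *)
Lemma powlog_taylor a n : forall j, exists M : R, forall t, - 2^-1 <= t <= 0 ->
  cabs (powlog a j t - (trunc (fun k => binomc a k j) n).[t%:C]) <= M * `|t| ^+ n.
Proof.
elim: n => [|n IH] j.
  exists (expR (`|complex.Re a|)) => t /andP[t1 t2].
  rewrite expr0 mulr1 (_ : trunc _ 0 = 0) ?horner0 ?subr0; last by rewrite /trunc poly_def big_ord0.
  have t0 : 0 < 1 + t by lra.
  have l0 : ln (1 + t) <= 0 by rewrite ln_le0 //; lra.
  (* On this range 1 + t >= 1/2 >= e^-1, so the powers of the logarithm are bounded by 1. *)
  have l1 : -1 <= ln (1 + t).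
    rewrite -(expRK (-1)) ler_ln ?posrE ?expR_gt0 //.
    rewrite expRN; have h2 : 2 <= expR 1 :> R by have := expR_ge1Dx (1 : R); lra.
    have : (expR 1)^-1 <= 2^-1 :> R by rewrite lef_pV2 // posrE ?expR_gt0 // (lt_le_trans _ h2).
    by lra.
  rewrite /powlog !cabsM cabsV cabsX cabs_cexp cabs_real -(rmorph_nat (real_complex R)) cabs_real.
  have nl : `|ln (1 + t)| <= 1 by rewrite ler_norml; lra.
  rewrite -mulrA -[leRHS]mulr1 ler_pM ?expR_ge0 //.
  - rewrite ler_expR; case: a => p q /=; rewrite mulr0 subr0.
    rewrite (le_trans (ler_norm _)) // normrM ler_piMr //.
  - rewrite [X in _ / X]ger0_norm ?ler0n // ler_pdivrMr ?ltr0n ?fact_gt0 // mul1r.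
    by rewrite (@le_trans _ _ 1) ?exprn_ile1 // ler1n fact_gt0.
have [M1 h1] := IH j.
have [M2 h2] : exists M : R, forall t, - 2^-1 <= t <= 0 ->
    cabs (powlogP a j t - (trunc (fun k => if j is j'.+1 then binomc a k j' else 0) n).[t%:C])
     <= M * `|t| ^+ n.
  case: j {h1} => [|j]; last exact: IH.
  exists 0 => t _; rewrite mul0r (_ : trunc _ n = 0) ?horner0 ?subr0 ?cabs0 //.
  by apply/polyP => k; rewrite coef_poly coef0; case: ifP.
pose T j n := trunc (fun k => binomc a k j) n.
pose T' n := trunc (fun k => if j is j'.+1 then binomc a k j' else 0) n.
have polyid : a *: T j n + T' n - (1 + 'X) * (T j n.+1)^`() = - (n%:R * binomc a n j) *: 'X^n.
  apply: trunc_ode => m; rewrite -[LHS]mulr_natr /=.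
  by rewrite divfK // pnatr_eq0.
pose B := cabs (n%:R * binomc a n j).
pose M := 2 * (cabs a * M1 + M2 + B).
exists (2 * M) => t /andP[t1 t2].
case: (eqVneq t 0) => [->|tn0].
  rewrite normr0 expr0n mulr0 horner_poly big_ord_recl big1 => [|i _]; last first.
    by rewrite expr0n mulr0.
  rewrite expr0 mulr1 addr0 /powlog addr0 ln1 mulr0 cexp0 mul1r expr0n.
  by case: j {h1 h2 T' polyid B M} => [|j] /=; rewrite ?fact0 ?divr1 ?mul0r subrr cabs0.
have {tn0} t0 : t < 0 by rewrite lt_neqAle tn0.
pose df (s : R) := (a * powlog a j s + powlogP a j s) / (1 + s%:C) + -1 * (T j n.+1)^`().[s%:C].
suff H : cabs (powlog a j t + -1 * (T j n.+1).[t%:C]) <= 2 * M * `|t| ^+ n.+1.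
  by rewrite mulN1r in H.
apply: (@cderiv_mvt R (fun s => powlog a j s + -1 * (T j n.+1).[s%:C]) df n M t t0).
- move=> s /andP[s1 s2]; have s3 : -1 < s by lra.
  have := cderivD (cderiv_powlog a j s3) (cderivM (cderiv_cst (-1) s) (cderiv_poly (T j n.+1) s)).
  by rewrite mul0r add0r.
- move=> s /andP[s1 s2]; have hs : - 2^-1 <= s <= 0 by lra.
  have s0 : 0 < 1 + s by lra.
  have s0C : 1 + s%:C != 0 by rewrite -(rmorph1 (real_complex R)) -rmorphD (inj_eq (@complexI R)) gt_eqF.
  have -> : df s = (a * (powlog a j s - (T j n).[s%:C]) + (powlogP a j s - (T' n).[s%:C])
       + - (n%:R * binomc a n j) * s%:C ^+ n) / (1 + s%:C).
    have := congr1 (fun P : {poly C} => P.[s%:C]) polyid.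
    rewrite -polyC1 !(hornerD, hornerN, hornerZ, hornerM, hornerC, hornerX, hornerXn).
    by rewrite /df => <-; field.
  rewrite cabsM cabsV.
  have -> : cabs (1 + s%:C) = 1 + s.
    by rewrite -(rmorph1 (real_complex R)) -rmorphD cabs_real ger0_norm // ltW.
  rewrite ler_pdivrMr //.
  have := cabsD (a * (powlog a j s - (T j n).[s%:C]) + (powlogP a j s - (T' n).[s%:C]))
     (- (n%:R * binomc a n j) * s%:C ^+ n).
  have := cabsD (a * (powlog a j s - (T j n).[s%:C])) (powlogP a j s - (T' n).[s%:C]).
  rewrite [cabs (- _ * _)]cabsM cabsN -/B cabsX cabs_real [cabs (a * _)]cabsM.
  have := h1 s hs; have := h2 s hs; rewrite -/(T j n) -/(T' n) /M.
  have := cabs_ge0 a; have sn : 0 <= `|s| ^+ n by rewrite exprn_ge0.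
  move: sn (cabs_ge0 (powlog a j s - (T j n).[s%:C])) (cabs_ge0 (powlogP a j s - (T' n).[s%:C])) (cabs_ge0 (n%:R * binomc a n j)).
  rewrite -/B; move: (cabs a) (cabs (powlog _ _ _ - _)) (cabs (powlogP _ _ _ - _)) (`|s| ^+ n) => A X Y S hS hX hY hB hA y x e1 e2.
  have aX : A * X <= A * (M1 * S) by rewrite ler_wpM2l.
  apply: le_trans e2 _; apply: le_trans (lerD e1 (lexx _)) _.
  apply: (@le_trans _ _ ((A * M1 + M2 + B) * S)); first by rewrite !mulrDl -mulrA !lerD.
  have : 0 <= (A * M1 + M2 + B) * S.
    rewrite !mulrDl -mulrA addr_ge0 ?(mulr_ge0 hB hS) // addr_ge0 //.
      exact: le_trans (mulr_ge0 hA hX) aX.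
    exact: le_trans y.
  move: ((A * M1 + M2 + B)) => Z Z0; nra.
- rewrite horner_poly big_ord_recl big1 => [|i _]; last by rewrite expr0n mulr0.
  rewrite expr0 mulr1 addr0 /powlog addr0 ln1 mulr0 cexp0 mul1r expr0n.
  by case: j {h1 h2 T' polyid B M df} => [|j] /=; rewrite ?fact0 ?divr1 ?mul0r ?mulr1 ?mulr0 ?addr0 ?subrr.
Qed.

Lemma asym_powlog a j (r : R) : 0 < r ->
  asym (fun x => powlog a j (- x / r)) (fun k => binomc a k j * (- r%:C) ^- k).
Proof.
move=> r0 n; have [M hM] := powlog_taylor a n j.
exists (M / r ^+ n), (r / 2); split=> [|x /andP[x0 x1]]; first exact: divr_gt0.
have := hM (- x / r); rewrite !mulNr oppr_le0 divr_ge0 ?(ltW x0) ?(ltW r0) // andbT.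
rewrite lerN2 ler_pdivrMr // mulrC => /(_ (ltW x1)).
rewrite normrN ger0_norm ?divr_ge0 ?(ltW x0) ?(ltW r0) // expr_div_n.
rewrite [M / _ * _]mulrAC -mulrA; congr (cabs (_ - _) <= _).
rewrite !horner_poly; apply: eq_bigr => i _; rewrite -mulrA; congr (_ * _).
by rewrite rmorphN rmorphM /= fmorphV -mulrN -invrN exprMn exprVn mulrC.
Qed.

End PowLog.

(** * Modes of twisted modules *)

Section GradedSeparation.
Variables (R : realType) (W : lmodType R[i]) (gr : R[i] -> set W).
Local Notation C := R[i].
Hypothesis gr_direct : direct_sum gr.
Hypothesis gr_fin : forall n, fin_dim_subspace (gr n).

(** A spanning family of least length is free. *)
Lemma fin_dim_basis (A : set W) : fin_dim_subspace A ->
  exists (d : nat) (b : 'I_d -> W),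
    A = [set w | exists c : 'I_d -> C, w = \sum_i c i *: b i] /\
    forall c : 'I_d -> C, \sum_i c i *: b i = 0 -> forall i, c i = 0.
Proof.
move=> [d0 [b0 hb0]].
pose P d := `[< exists b : 'I_d -> W,
  A = [set w | exists c : 'I_d -> C, w = \sum_i c i *: b i] >].
have exP : exists d, P d by exists d0; apply/asboolP; exists b0.
case: (ex_minnP exP) => d /asboolP[b hb] hmin; exists d, b; split=> // c hc j.
apply/eqP; apply: contraT => cj.
case: d b hb hmin c hc j cj => [|d] b hb hmin c hc j cj; first by case: j {cj}.
have /hmin : P d; last by rewrite ltnn.
apply/asboolP; exists (b \o lift j); rewrite hb; apply/seteqP; split=> w [e ->].
  move: hc; rewrite (bigD1_ord j) //= => /eqP; rewrite addr_eq0 => /eqP hc.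
  have hj : b j = \sum_(i < d) (- (c j)^-1 * c (lift j i)) *: b (lift j i).
    rewrite -[LHS]scale1r -(mulVf cj) -scalerA hc scalerN -scaleNr scaler_sumr.
    by apply: eq_bigr => i _; rewrite scalerA.
  exists (fun i => e j * (- (c j)^-1 * c (lift j i)) + e (lift j i)).
  rewrite (bigD1_ord j) //= hj scaler_sumr -big_split /=.
  by apply: eq_bigr => i _; rewrite scalerA scalerDl.
exists (fun i => if unlift j i is Some k then e k else 0).
rewrite (bigD1_ord j) //= unlift_none scale0r add0r.
by apply: eq_bigr => i _; rewrite liftK.
Qed.

Lemma gr_sub n : gr n 0 /\ forall a v w, gr n v -> gr n w -> gr n (a *: v + w).
Proof.
have [d [b ->]] := gr_fin n; split.
  by exists (fun=> 0); rewrite big1 // => i _; rewrite scale0r.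
move=> a _ _ [c ->] [e ->]; exists (fun i => a * c i + e i).
rewrite scaler_sumr -big_split; apply: eq_bigr => i _ /=.
by rewrite scalerDl scalerA.
Qed.

Lemma gr_sum n (T : Type) (r : seq T) (P : pred T) (F : T -> W) :
  (forall t, P t -> gr n (F t)) -> gr n (\sum_(t <- r | P t) F t).
Proof.
move=> h; elim/big_ind: _ => //; first exact: (gr_sub n).1.
by move=> x y hx hy; rewrite -[x]scale1r; apply: (gr_sub n).2.
Qed.

Lemma gr_dec w : exists (s : seq C) (f : C -> W), [/\ uniq s,
  forall i, gr i (f i), forall i, i \notin s -> f i = 0 & w = \sum_(i <- s) f i].
Proof.
have [s [f [hf ->]]] := gr_direct.1 w.
exists (undup s), (fun i => \sum_(j <- s | j == i) f j); split.
- exact: undup_uniq.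
- by move=> i; apply: gr_sum => j /eqP ->.
- move=> i; rewrite mem_undup => hi; rewrite big1_seq // => j /andP[/eqP -> hj].
  by rewrite hj in hi.
by rewrite -(@sum_by_key _ _ _ id s) ?undup_uniq // => c; rewrite mem_undup.
Qed.

Definition gr_supp w : seq C := sval (cid (gr_dec w)).
Definition gr_comp w : C -> W := sval (cid (svalP (cid (gr_dec w)))).

Lemma gr_compP w : [/\ uniq (gr_supp w), forall i, gr i (gr_comp w i),
  forall i, i \notin gr_supp w -> gr_comp w i = 0 &
  w = \sum_(i <- gr_supp w) gr_comp w i].
Proof. exact: (svalP (cid (svalP (cid (gr_dec w))))). Qed.

Lemma gr_comp_uniq w (s : seq C) (f : C -> W) : uniq s -> (forall i, gr i (f i)) ->
  (forall i, i \notin s -> f i = 0) -> w = \sum_(i <- s) f i -> gr_comp w =1 f.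
Proof.
move=> us hf f0 hw i; have [ut hg g0 hw'] := gr_compP w.
pose r := undup (s ++ gr_supp w).
have ext (t : seq C) (h : C -> W) : uniq t -> {subset t <= r} ->
   (forall i, i \notin t -> h i = 0) -> \sum_(j <- t) h j = \sum_(j <- r) h j.
  move=> ut' tr h0; rewrite [RHS](bigID (mem t)) /= [X in _ + X]big1 ?addr0; last exact: h0.
  rewrite -[RHS]big_filter; apply: perm_big; apply: uniq_perm; rewrite ?filter_uniq ?undup_uniq //.
  by move=> j; rewrite mem_filter andb_idr // => /tr.
have e : \sum_(j <- r) (-1 *: f j + gr_comp w j) = 0.
  rewrite big_split /= -scaler_sumr -(ext s f) //; last first.
    by move=> j js; rewrite mem_undup mem_cat js.
  rewrite -(ext (gr_supp w) (gr_comp w)) //; last first.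
    by move=> j js; rewrite mem_undup mem_cat js orbT.
  by rewrite -hw -hw' scaleN1r addNr.
case: (boolP (i \in r)) => ir; last first.
  by move: ir; rewrite mem_undup mem_cat negb_or => /andP[/f0 -> /g0 ->].
have := gr_direct.2 r _ (undup_uniq _) _ e i ir.
rewrite scaleN1r addrC => h; apply/eqP; rewrite -subr_eq0; apply/eqP; apply: h.
by move=> j; apply: (gr_sub j).2.
Qed.

Lemma gr_comp_linear n : linear (gr_comp^~ n).
Proof.
move=> a v w /=; have [us hf f0 hv] := gr_compP v; have [ut hg g0 hw] := gr_compP w.
pose r := undup (gr_supp v ++ gr_supp w).
apply: (@gr_comp_uniq _ r (fun i => a *: gr_comp v i + gr_comp w i)).
- exact: undup_uniq.
- by move=> i; apply: (gr_sub i).2.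
- move=> i; rewrite mem_undup mem_cat negb_or => /andP[/f0 -> /g0 ->].
  by rewrite scaler0 addr0.
have ext (t : seq C) (h : C -> W) : uniq t -> {subset t <= r} ->
   (forall i, i \notin t -> h i = 0) -> \sum_(j <- t) h j = \sum_(j <- r) h j.
  move=> ut' tr h0; rewrite [RHS](bigID (mem t)) /= [X in _ + X]big1 ?addr0; last exact: h0.
  rewrite -[RHS]big_filter; apply: perm_big; apply: uniq_perm; rewrite ?filter_uniq ?undup_uniq //.
  by move=> j; rewrite mem_filter andb_idr // => /tr.
rewrite big_split /= -scaler_sumr -(ext (gr_supp v) (gr_comp v)) //; last first.
  by move=> j js; rewrite mem_undup mem_cat js.
rewrite -(ext (gr_supp w) (gr_comp w)) //; last first.
  by move=> j js; rewrite mem_undup mem_cat js orbT.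
by rewrite -hv -hw.
Qed.

(** The coordinates of the component of weight n, in a basis of the finite-dimensional W_[n], belong
    to the graded dual. *)
Lemma graded_dual_separates v :
  (forall w', graded_dual gr w' -> w' v = 0) -> v = 0.
Proof.
move=> hv; have [us hf f0 ev] := gr_compP v.
rewrite ev big1 // => n _.
have [d [b [hgr free]]] := fin_dim_basis (gr_fin n).
have exc w : exists c : 'I_d -> C, gr_comp w n = \sum_i c i *: b i.
  by have [_ /(_ n) + _ _] := gr_compP w; rewrite hgr.
pose c w := sval (cid (exc w)).
have cE w : gr_comp w n = \sum_i c w i *: b i := svalP (cid (exc w)).
have c_uniq w e : gr_comp w n = \sum_i e i *: b i -> c w =1 e.
  rewrite cE => /eqP; rewrite -subr_eq0 -sumrB => /eqP h i.
  apply/eqP; rewrite -subr_eq0; apply/eqP.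
  apply: (free (fun i => c w i - e i)); rewrite -[RHS]h.
  by apply: eq_bigr => j _; rewrite scalerBl.
have c0 i : c v i = 0.
  apply: (hv (fun w => c w i)); split.
    move=> a x y; rewrite (c_uniq _ (fun j => a * c x j + c y j)) //.
    rewrite gr_comp_linear !cE scaler_sumr -big_split; apply: eq_bigr => j _ /=.
    by rewrite scalerDl scalerA.
  exists [:: n] => m; rewrite inE => mn w hw.
  apply: (c_uniq w (fun=> 0)); rewrite big1 => [|j _]; last by rewrite scale0r.
  rewrite (@gr_comp_uniq w [:: m] (fun j => if j == m then w else 0)) //.
  - by rewrite eq_sym (negbTE mn).
  - by move=> j; case: eqP => [->|_] //; exact: (gr_sub j).1.
  - by move=> j; rewrite inE => /negbTE ->.
  by rewrite big_seq1 eqxx.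
by rewrite cE big1 // => i _; rewrite c0 scale0r.
Qed.

End GradedSeparation.

(** * Linear maps and linear functionals *)

Section LinearHelpers.
Variables (R : realType) (U V : lmodType R[i]).
Local Notation C := R[i].

Lemma lin0 (f : U -> V) : linear f -> f 0 = 0.
Proof. by move=> h; have := h (-1) 0 0; rewrite scaler0 addr0 scaleN1r addNr. Qed.

Lemma linD (f : U -> V) : linear f -> {morph f : x y / x + y}.
Proof. by move=> h x y; have := h 1 x y; rewrite !scale1r. Qed.

Lemma linZ (f : U -> V) : linear f -> forall a x, f (a *: x) = a *: f x.
Proof. by move=> h a x; have := h a x 0; rewrite !addr0 (lin0 h) addr0. Qed.

Lemma lin_sum (f : U -> V) (T : Type) (r : seq T) (P : pred T) (F : T -> U) :
  linear f -> f (\sum_(t <- r | P t) F t) = \sum_(t <- r | P t) f (F t).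
Proof. by move=> h; apply: (big_morph f (linD h) (lin0 h)). Qed.

Lemma scal0 (f : U -> C) : scalar f -> f 0 = 0.
Proof. by move=> h; have := h (-1) 0 0; rewrite scaler0 addr0 mulN1r addNr. Qed.

Lemma scalD (f : U -> C) : scalar f -> {morph f : x y / x + y}.
Proof. by move=> h x y; have := h 1 x y; rewrite scale1r mul1r. Qed.

Lemma scalZ (f : U -> C) : scalar f -> forall a x, f (a *: x) = a * f x.
Proof. by move=> h a x; have := h a x 0; rewrite !addr0 (scal0 h) addr0. Qed.

Lemma scal_sum (f : U -> C) (T : Type) (r : seq T) (P : pred T) (F : T -> U) :
  scalar f -> f (\sum_(t <- r | P t) F t) = \sum_(t <- r | P t) f (F t).
Proof. by move=> h; apply: (big_morph f (scalD h) (scal0 h)). Qed.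

Lemma scalB (f : U -> C) : scalar f -> {morph f : x y / x - y}.
Proof. by move=> h x y; rewrite (scalD h) -scaleN1r (scalZ h) mulN1r. Qed.

Lemma scalar_comp (f : V -> C) (h : U -> V) : scalar f -> linear h -> scalar (f \o h).
Proof. by move=> hf hh a x y /=; rewrite hh hf. Qed.

End LinearHelpers.

(** * Branches of the logarithm on the real axis *)

Section Clog.
Variable R : realType.
Local Notation C := R[i].

Lemma clog_pos (p : int) (x : R) : 0 < x -> clog p x%:C = (ln x)%:C + p%:~R * twopii R.
Proof.
move=> x0; rewrite /clog /carg cabs_real gtr0_norm //= lexx divff ?gt_eqF // acos1 add0r.
rewrite twopiiE -(rmorph_int (real_complex R)) mulrCA -rmorphM /=.
by rewrite [(_ * p%:~R)%R]mulrC; simpc.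
Qed.

Lemma clog_neg (p : int) (x : R) : 0 < x ->
  clog p (- x%:C) = (ln x)%:C + (pi%:C * 'i%C + p%:~R * twopii R).
Proof.
move=> x0; rewrite /clog /carg cabsN cabs_real gtr0_norm //= oppr0 lexx.
rewrite mulNr divff ?gt_eqF // acosN1 twopiiE -(rmorph_int (real_complex R)) mulrCA -rmorphM /=.
by rewrite [(_ * p%:~R)%R]mulrC; simpc.
Qed.

End Clog.

(** * Consequences of equivariance for a chain of vectors *)

Section Structure.
Variables (R : realType) (V : voa R) (g : V -> V) (W : twisted_module g).
Local Notation C := R[i].

Lemma tm_separates (v : W) : (forall w', graded_dual (@tm_gr _ _ _ W) w' -> w' v = 0) -> v = 0.
Proof. exact: (graded_dual_separates (@tm_direct _ _ _ W) (@tm_fin_dim _ _ _ W)). Qed.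

(** The chain stands for v_j = N^j u with S u = alpha u; [g_v] then expresses g = e^(2 pi i (S +
    N)). *)
Variables (d : nat) (alpha : C) (v_ : nat -> V).
Hypothesis v_0 : forall j, (d <= j)%N -> v_ j = 0.
Hypothesis g_v : forall j, g (v_ j) = cexp (twopii R * alpha) *:
  \sum_(k < d) (twopii R ^+ k / (k`!)%:R) *: v_ (j + k)%N.

Lemma chain_log_bound (w : W) : exists K : nat, forall j r k, (K <= k)%N ->
  tm_Y (v_ j) w (r, k) = 0.
Proof.
suff [K hK] : exists K : nat, forall j r k, (j < d)%N -> (K <= k)%N ->
    tm_Y (v_ j) w (r, k) = 0.
  exists K => j r k hk; case: (ltnP j d) => jd; first exact: hK.
  by rewrite v_0 // (lin0 (tm_linl w (r, k))).
elim: d => [|n [K hK]]; first by exists 0%N.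
have [K' hK'] := tm_log (v_ n) w; exists (maxn K K'.+1) => j r k.
rewrite ltnS geq_max leq_eqVlt => /orP[/eqP ->|jn] /andP[k1 k2]; first exact: hK'.
exact: hK.
Qed.

Variables (w : W) (w' : W -> C).
Hypothesis hw' : graded_dual (@tm_gr _ _ _ W) w'.

Lemma chain_exponents : exists rs : seq C, uniq rs /\
  forall j (m : lmono R), w' (tm_Y (v_ j) w m) != 0 -> m.1 \in rs.
Proof.
suff [rs hrs] : exists rs : seq C,
    forall j (m : lmono R), (j < d)%N -> w' (tm_Y (v_ j) w m) != 0 -> m.1 \in rs.
  exists (undup rs); split=> [|j m]; first exact: undup_uniq.
  case: (ltnP j d) => jd; first by rewrite mem_undup; exact: hrs.
  by rewrite v_0 // (lin0 (tm_linl w m)) (scal0 hw'.1) eqxx.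
elim: d => [|n [rs hrs]]; first by exists [::].
have /finite_seqP[ms hms] := tm_fin (v_ n) w hw'.
exists (rs ++ [seq m.1 | m <- ms]) => j m; rewrite ltnS leq_eqVlt mem_cat.
case/orP=> [/eqP ->|jn] hm; last by rewrite (hrs j).
apply/orP; right; apply/mapP; exists m => //.
by have : [set m | w' (tm_Y (v_ n) w m) != 0] m by []; rewrite hms.
Qed.

Definition log_poly (K : nat) (r : C) (v : V) : {poly C} :=
  \poly_(k < K) w' (tm_Y v w (r, k)).

Lemma log_poly_linear K r : linear (log_poly K r).
Proof.
move=> a x y; apply/polyP => k; rewrite coefD coefZ !coef_poly; case: ifP => _.
  by rewrite tm_linl hw'.1.
by rewrite mulr0 addr0.
Qed.

Lemma eval_at_log_poly K (rs : seq C) v p z : uniq rs ->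
  (forall r k, (K <= k)%N -> tm_Y v w (r, k) = 0) ->
  (forall m : lmono R, w' (tm_Y v w m) != 0 -> m.1 \in rs) ->
  eval_at p z (fun m => w' (tm_Y v w m)) =
  \sum_(r <- rs) cexp (r * clog p z) * (log_poly K r v).[clog p z].
Proof.
move=> urs hK hrs; rewrite /eval_at.
rewrite (@fsbig_list _ _ _ [seq (r, k) | r <- rs, k <- iota 0 K]) //.
- rewrite big_allpairs_dep; apply: eq_bigr => r _.
  rewrite horner_poly mulr_sumr -(big_mkord xpredT (fun k => cexp (r * clog p z) *
     (w' (tm_Y v w (r, k)) * clog p z ^+ k))) /index_iota subn0.
  by apply: eq_bigr => k _; rewrite /mono_at /=; ring.
- by apply: allpairs_uniq => //; [exact: iota_uniq | move=> [? ?] [? ?] _ _ [-> ->]].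
- move=> [r k] _ hm; have [->|h] := eqVneq (w' (tm_Y v w (r, k))) 0; first by rewrite mul0r.
  have rrs := hrs _ h; case: (leqP K k) => kK.
    by rewrite hK // (scal0 hw'.1) eqxx in h.
  by case/negP: hm; apply/allpairsP; exists (r, k); rewrite mem_iota add0n.
Qed.

(** Equivariance at positive z is an identity of exponential polynomials in log z; their
    coefficients are compared exponent by exponent. *)
Lemma log_poly_equivariance K r j :
  (forall j r k, (K <= k)%N -> tm_Y (v_ j) w (r, k) = 0) ->
  cexp (r * twopii R) *: (log_poly K r (g (v_ j)) \Po ('X + (twopii R)%:P)) =
  log_poly K r (v_ j).
Proof.
move=> hK; have [rs [urs hrs]] := chain_exponents.
have gE m : tm_Y (g (v_ j)) w m = cexp (twopii R * alpha) *:
   \sum_(k < d) (twopii R ^+ k / (k`!)%:R) *: tm_Y (v_ (j + k)) w m.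
  rewrite g_v (linZ (tm_linl w m)) (lin_sum _ _ _ (tm_linl w m)).
  by congr (_ *: _); apply: eq_bigr => k _; rewrite (linZ (tm_linl w m)).
have hKg r' k : (K <= k)%N -> tm_Y (g (v_ j)) w (r', k) = 0.
  by move=> kK; rewrite gE big1 ?scaler0 // => i _; rewrite hK ?scaler0.
have hrsg (m : lmono R) : w' (tm_Y (g (v_ j)) w m) != 0 -> m.1 \in rs.
  apply: contraR => hm; rewrite gE (scalZ hw'.1) (scal_sum _ _ _ hw'.1) big1 ?mulr0 // => k _.
  rewrite (scalZ hw'.1); suff /eqP -> : w' (tm_Y (v_ (j + k)) w m) == 0 by rewrite mulr0.
  by apply: contraNT hm; exact: hrs.
case: (boolP (r \in rs)) => rrs; last first.
  have z v : (forall m : lmono R, w' (tm_Y v w m) != 0 -> m.1 \in rs) -> log_poly K r v = 0.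
    move=> hv; apply/polyP => k; rewrite coef_poly coef0; case: ifP => // _.
    by apply/eqP; apply: contraNT rrs => /hv.
  by rewrite !z // ?comp_poly0 ?scaler0 //; exact: hrs.
apply/eqP; rewrite -subr_eq0; apply/eqP; move: r rrs; apply: cexp_sum_indep => //.
exists 0, 0 => x _; rewrite add0r.
have ex0 : (expR x)%:C != 0 :> C by rewrite (inj_eq (@complexI R)) gt_eqF // expR_gt0.
have := tm_equivariance 0 (v_ j) w ex0 hw'.
rewrite (eval_at_log_poly _ _ urs hKg hrsg) (eval_at_log_poly _ _ urs (hK j) (hrs j)).
rewrite !clog_pos ?expR_gt0 // expRK mul0r addr0 add0r mul1r => /eqP.
rewrite -subr_eq0 => /eqP h; rewrite -[RHS]h -sumrB; apply: eq_bigr => r _.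
rewrite hornerD hornerN hornerZ horner_comp hornerD hornerX hornerC.
by rewrite mulrBr mulrA -cexpD -mulrDr.
Qed.

(** This is e^((X + c) N) = e^(X N) e^(c N) on a chain, with F_j in the place of N^j u. *)
Lemma exp_chain (c : C) (F : nat -> {poly C}) : (forall j, (d <= j)%N -> F j = 0) ->
  \sum_(j < d) (('X + c%:P) ^+ j * (j`!%:R^-1)%:P) * F j =
  \sum_(a < d) ('X ^+ a * (a`!%:R^-1)%:P) *
     \sum_(k < d) (c ^+ k / k`!%:R) *: F (a + k)%N.
Proof.
move=> F0.
have fz (n : nat) : n`!%:R != 0 :> C by rewrite pnatr_eq0 -lt0n fact_gt0.
pose t (a k : nat) : {poly C} := ('X ^+ a * (a`!%:R^-1)%:P) * (c ^+ k / k`!%:R)%:P.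
have expand (j : nat) : (j < d)%N -> ('X + c%:P) ^+ j * (j`!%:R^-1)%:P =
    \sum_(k < d | (k <= j)%N) t (j - k)%N k.
  move=> jd; rewrite exprDn mulr_suml (big_ord_widen_leq d) //; apply: eq_bigr => k.
  move=> /= kj; rewrite inordK //.
  rewrite /t -polyC_exp -mulr_natr -polyC_natr -!mulrA -!polyCM.
  congr (_ * polyC _); rewrite -(bin_fact kj) !natrM.
  have b0 : 'C(j, k)%:R != 0 :> C by rewrite pnatr_eq0 -lt0n bin_gt0.
  move: (fz (j - k)%N) (fz k) b0; move: (_`!%:R) (_`!%:R) ('C(j, k)%:R) => p q b p0 q0 b0.
  by field; rewrite p0 q0 b0.
under eq_bigr => j _ do rewrite (expand j (ltn_ord j)) mulr_suml big_mkcond.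
rewrite exchange_big /=.
under [RHS]eq_bigr => a _ do rewrite mulr_sumr.
rewrite [RHS]exchange_big /=; apply: eq_bigr => k _.
rewrite -(big_mkord xpredT (fun j => if (k <= j)%N then t (j - k)%N k * F j else 0)).
rewrite (@big_cat_nat _ _ _ k) //=; last exact: ltnW.
rewrite big_nat big1 ?add0r => [|j /andP[_ jk]]; last by rewrite leqNgt jk.
rewrite -{1}[k : nat]add0n big_addn.
rewrite -(big_mkord xpredT (fun a => 'X ^+ a * (a`!%:R^-1)%:P * ((c ^+ k / k`!%:R) *: F (a + k)%N))).
rewrite (@big_cat_nat _ _ _ (d - k) 0 d) //=; last exact: leq_subr.
rewrite [X in _ = _ + X]big_nat [X in _ = _ + X]big1 ?addr0 => [|a /andP[ha _]]; last first.
  have hd : (d <= a + k)%N by rewrite addnC -leq_subLR.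
  by rewrite (F0 _ hd) scaler0 mulr0.
apply: eq_bigr => a _; by rewrite leq_addl addnK /t -[LHS]mulrA -[_ *: F _]mul_polyC.
Qed.

(** The sum Q on the left is the coefficient of x^r in Y(x^N u, x), as a polynomial in X = log x.
    Equivariance gives e^(2 pi i (r + alpha)) Q(X + 2 pi i) = Q(X), so by [poly_shift_eigen] Q is
    constant, and it is 0 unless r + alpha is an integer. *)
Lemma chain_poly K r :
  (forall j r k, (K <= k)%N -> tm_Y (v_ j) w (r, k) = 0) ->
  \sum_(j < d) ('X ^+ j * (j`!%:R^-1)%:P) * log_poly K r (v_ j) =
    (w' (tm_Y (v_ 0) w (r, 0%N)))%:P /\
  (w' (tm_Y (v_ 0) w (r, 0%N)) != 0 -> exists n : int, r + alpha = n%:~R).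
Proof.
move=> hK; set Q := \sum_(j < d) _.
have hQ : cexp (twopii R * (r + alpha)) *: (Q \Po ('X + (twopii R)%:P)) = Q.
  rewrite /Q raddf_sum /=.
  under eq_bigr => j _ do rewrite !rmorphM rmorphXn /= comp_polyX comp_polyC.
  rewrite (exp_chain (twopii R) (F := fun j => log_poly K r (v_ j) \Po ('X + (twopii R)%:P))); last first.
    by move=> j dj; rewrite v_0 // (lin0 (log_poly_linear K r)) comp_poly0.
  rewrite scaler_sumr; apply: eq_bigr => a _; rewrite scalerAr; congr (_ * _).
  rewrite -[RHS](@log_poly_equivariance K r a hK) g_v (linZ (log_poly_linear K r)).
  rewrite (lin_sum _ _ _ (log_poly_linear K r)) comp_polyZ scalerA -cexpD.
  rewrite mulrDr [r * _]mulrC; congr (_ *: _).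
  rewrite raddf_sum; apply: eq_bigr => k _ /=.
  by rewrite (linZ (log_poly_linear K r)) comp_polyZ.
have Q0 : Q.[0] = w' (tm_Y (v_ 0) w (r, 0%N)).
  have hKc : (log_poly K r (v_ 0%N)).[0] = w' (tm_Y (v_ 0%N) w (r, 0%N)).
    rewrite horner_coef0 coef_poly; case: ifP => // /negbT.
    by rewrite -leqNgt => /hK ->; rewrite (scal0 hw'.1).
  rewrite /Q horner_sum; case: d v_0 => [|n] hv.
    by rewrite big_ord0 hv // (lin0 (tm_linl w _)) (scal0 hw'.1).
  rewrite big_ord_recl big1 => [|i _]; last by rewrite !hornerM hornerXn expr0n !mul0r.
  by rewrite addr0 hornerM /= expr0 mul1r fact0 invr1 hornerC mul1r.
case: (poly_shift_eigen (twopii_neq0 R) hQ) => [q0|[mu qc]].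
  by rewrite -Q0 q0 horner0 eqxx; split.
by rewrite -Q0; split=> [//|_]; apply/cexp_twopiiM.
Qed.

End Structure.

(** * Laurent expansions *)

Section Laurent.
Variable R : realType.
Local Notation C := R[i].
Implicit Types (A B : int -> C) (z y : C) (P Q : {poly C}).

Definition mulp P A (i : int) : C := \sum_(a < size P) P`_a * A (i - a%:Z).

Lemma mulp_widen P A i n : (size P <= n)%N ->
  mulp P A i = \sum_(a < n) P`_a * A (i - a%:Z).
Proof.
move=> sn; rewrite /mulp -(big_mkord xpredT (fun a => P`_a * A (i - a%:Z))).
rewrite -(big_mkord xpredT (fun a => P`_a * A (i - a%:Z))).
rewrite [RHS](@big_cat_nat _ _ _ (size P)) //= [X in _ = _ + X]big_nat.
rewrite [X in _ = _ + X]big1 ?addr0 // => a /andP[h _].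
by rewrite nth_default ?mul0r.
Qed.

Lemma mulpD P Q A i : mulp (P + Q) A i = mulp P A i + mulp Q A i.
Proof.
pose n := maxn (size P) (size Q).
rewrite (@mulp_widen (P + Q) A i n) ?size_polyD //.
rewrite (@mulp_widen P A i n) ?leq_maxl // (@mulp_widen Q A i n) ?leq_maxr //.
by rewrite -big_split; apply: eq_bigr => a _; rewrite coefD mulrDl.
Qed.

Lemma mulpZ c P A i : mulp (c *: P) A i = c * mulp P A i.
Proof.
rewrite (@mulp_widen _ A i (size P)) ?size_scale_leq // mulr_sumr.
by apply: eq_bigr => a _; rewrite coefZ mulrA.
Qed.

Lemma mulp0 A i : mulp 0 A i = 0.
Proof. by rewrite /mulp size_poly0 big_ord0. Qed.

Lemma mulpC c A i : mulp c%:P A i = c * A i.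
Proof.
by rewrite (@mulp_widen _ A i 1) ?size_polyC_leq1 // big_ord1 coefC /= subr0.
Qed.

Lemma mulpMX P A i : mulp (P * 'X) A i = mulp P A (i - 1).
Proof.
rewrite (@mulp_widen _ A i (size P).+1); last first.
  by rewrite (leq_trans (size_polyMleq _ _)) // size_polyX addn2.
rewrite big_ord_recl coefMX /= mul0r add0r; apply: eq_bigr => a _.
by rewrite coefMX /=; congr (_ * A _); rewrite /bump /=; lia.
Qed.

Lemma mulp_sum n (F : nat -> {poly C}) A i :
  mulp (\sum_(k < n) F k) A i = \sum_(k < n) mulp (F k) A i.
Proof.
elim: n => [|n IH]; first by rewrite !big_ord0 mulp0.
by rewrite !big_ord_recr /= mulpD IH.
Qed.

Lemma mulpXn n A i : mulp 'X^n A i = A (i - n%:Z).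
Proof.
elim: n i => [|n IH] i; first by rewrite expr0 -polyC1 mulpC mul1r subr0.
by rewrite exprSr mulpMX IH; congr A; lia.
Qed.

Lemma mulpMXn n P A i : mulp (P * 'X^n) A i = mulp P A (i - n%:Z).
Proof.
elim: n i => [|n IH] i; first by rewrite expr0 mulr1 subr0.
by rewrite exprSr mulrA mulpMX IH; congr mulp; lia.
Qed.

Lemma mulpM P Q A i : mulp (P * Q) A i = mulp P (mulp Q A) i.
Proof.
elim/poly_ind: P i => [|P c IH] i; first by rewrite mul0r !mulp0.
rewrite mulrDl !mulpD mul_polyC mulpZ mulpC; congr (_ + _).
by rewrite mulrAC !mulpMX IH.
Qed.

Lemma phiA_mulp y A m (J : nat) : phiA y A m J = mulp (('X + y%:P) ^+ J) A (- m - 1).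
Proof.
rewrite exprDn (mulp_sum J.+1 (fun k => 'X^(J - k) * y%:P ^+ k *+ 'C(J, k))).
rewrite /phiA (@nsumE _ _ J.+1) => [|k hk]; last by rewrite -pmulrn binom_gt // !mul0r.
apply: eq_bigr => k _; have kJ : (k <= J)%N by rewrite -ltnS.
rewrite -scaler_nat -polyC_exp [X in _ *: X]mulrC mul_polyC scalerA mulpZ mulpXn.
rewrite -pmulrn binom_nat; congr (_ * A _); lia.
Qed.

Lemma psi_mulp y A m (J : nat) : psi y A m J = mulp (('X + y%:P) ^+ J) A (- m - 1).
Proof.
rewrite addrC exprDn (mulp_sum J.+1 (fun k => y%:P ^+ (J - k) * 'X^k *+ 'C(J, k))).
rewrite /psi (@nsumE _ _ J.+1) => [|k hk]; last by rewrite -pmulrn binom_gt // !mul0r.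
apply: eq_bigr => k _; have kJ : (k <= J)%N by rewrite -ltnS.
rewrite -scaler_nat -polyC_exp mul_polyC scalerA mulpZ mulpXn.
rewrite -pmulrn binom_nat; congr (_ * _ * A _); try lia.
by rewrite exprnP; congr (_ ^ _); lia.
Qed.

Lemma mul_exprz z (i : int) : z != 0 -> z * z ^ i = z ^ (i + 1).
Proof. by move=> z0; rewrite addrC exprzDr ?unitfE // expr1z. Qed.

Definition Lau A z (S : C) :=
  asum (fun i : int => A i * z ^ i) /\ hsum (fun i : int => A i * z ^ i) S.

Lemma eq_Lau A B z S : A =1 B -> Lau A z S -> Lau B z S.
Proof. by move=> /funext ->. Qed.

Lemma LauD A B z S T : Lau A z S -> Lau B z T -> Lau (fun i => A i + B i) z (S + T).
Proof.
move=> [a1 h1] [a2 h2]; split; under eq_fun do rewrite mulrDl.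
  exact: asumD.
exact: hsumD.
Qed.

Lemma LauZ c A z S : Lau A z S -> Lau (fun i => c * A i) z (c * S).
Proof.
move=> [a1 h1]; split; under eq_fun do rewrite -mulrA.
  exact: asumZ.
exact: hsumZ.
Qed.

Lemma LauX A z S : z != 0 -> Lau A z S -> Lau (fun i => A (i - 1)) z (z * S).
Proof.
move=> z0 [a1 h1].
apply: (@asum_fubini _ int int (fun i => z * (A i * z ^ i)) _ (fun i => i + 1)).
- exact: asumZ.
- exact: hsumZ.
move=> j.
have := @hsum_fin _ _ (fun i : int => if i + 1 == j then z * (A i * z ^ i) else 0) [:: j - 1] isT.
rewrite big_seq1 subrK eqxx mulrCA mul_exprz // subrK; apply=> i.
by rewrite inE => h; case: eqP => // e; case/eqP: h; rewrite -e addrK.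
Qed.

Lemma Lau_mulp P A z S : z != 0 -> Lau A z S -> Lau (mulp P A) z (P.[z] * S).
Proof.
move=> z0 hA; elim/poly_ind: P => [|P c IH].
  rewrite horner0; apply: eq_Lau (LauZ 0 hA) => i.
  by rewrite mulp0 !mul0r.
rewrite !hornerE mulrDl mulrAC [_ * S * z]mulrC.
apply: eq_Lau (LauD (LauX z0 IH) (LauZ c hA)) => i.
by rewrite mulpD mulpMX mulpC.
Qed.

Lemma Lau_poly P z : z != 0 -> Lau (icoef P) z P.[z].
Proof.
move=> z0; pose dl (i : int) : C := (i == 0)%:R.
have hd : Lau dl z 1.
  have e (i : int) : i \notin [:: 0] -> dl i * z ^ i = 0.
    by rewrite inE /dl => /negbTE ->; rewrite mul0r.
  split.
    exists 1 => F; have [hF|hF] := boolP ((0 : int) \in F).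
      rewrite (big_fsetD1 0) //= big1_seq ?addr0 /dl ?eqxx ?mul1r ?cabs1 // => i.
      by rewrite !inE => /andP[_ /andP[/negbTE -> _]]; rewrite mul0r cabs0.
    rewrite big1_seq // => i /andP[_ iF]; rewrite e ?cabs0 // inE.
    by apply: contraNneq hF => <-.
  by have := @hsum_fin _ _ (fun i => dl i * z ^ i) [:: 0] isT e; rewrite big_seq1 /dl eqxx mulr1.
rewrite -[P.[z]]mulr1; apply: eq_Lau (Lau_mulp P z0 hd) => i.
rewrite /mulp /dl; case: i => [k|k] /=.
  case: (ltnP k (size P)) => hk.
    rewrite (bigD1 (Ordinal hk)) //= subrr eqxx mulr1 big1 ?addr0 // => j jk.
    case: eqP => [e|]; last by rewrite mulr0.
    by case/eqP: jk; apply: val_inj => /=; lia.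
  rewrite nth_default // big1 // => j _; have jk := leq_trans (ltn_ord j) hk.
  by case: eqP => [e|]; [exfalso; lia | rewrite mulr0].
by rewrite big1 // => j _; case: eqP => [e|]; [exfalso; lia | rewrite mulr0].
Qed.

Lemma Lau_sub A B z S : Lau A z S -> Lau B z S -> Lau (fun i => A i - B i) z 0.
Proof.
move=> hA hB; rewrite -(subrr S) -[X in Lau _ _ (_ - X)]mul1r -mulNr.
by apply: eq_Lau (LauD hA (LauZ (-1) hB)) => i; rewrite mulN1r.
Qed.

Lemma Lau_circle_uniq A (r : R) : 0 < r ->
  (forall z, cabs z = r -> Lau A z 0) -> forall i, A i = 0.
Proof.
move=> r0 h i.
have rC : r%:C != 0 by rewrite (inj_eq (@complexI R)) gt_eqF.
suff : A i * r%:C ^ i = 0.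
  by move/eqP; rewrite mulf_eq0 expfz_eq0 (negbTE rC) andbF orbF => /eqP.
move: i; apply: circle_uniq; first by have [] := h r%:C; rewrite ?cabs_real ?gtr0_norm.
move=> N a N0; have [|_] := h (r%:C * uroot R N ^+ a).
  rewrite cabsM cabs_real gtr0_norm // cabsX /uroot cabs_cexp.
  rewrite twopiiE -(rmorph_nat (real_complex R)) -fmorphV /=; simpc.
  by rewrite ?(mulr0, mul0r, subr0, addr0, oppr0) expR0 expr1n mulr1.
by apply: eq_hsum => i; rewrite exprzMl ?mulrA // unitfE ?rC // expf_neq0 // uroot_neq0.
Qed.

Lemma Lau_nat A z S (d0 : int) : z != 0 -> (forall i, i < d0 -> A i = 0) ->
  Lau A z S -> asum (fun k : nat => A (d0 + k%:Z) * z ^+ k) /\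
               hsum (fun k : nat => A (d0 + k%:Z) * z ^+ k) (z ^ (- d0) * S).
Proof.
move=> z0 hA [a1 h1].
apply: (@asum_fubini _ int nat (fun i => z ^ (- d0) * (A i * z ^ i)) _ (fun i => absz (i - d0)%R)).
- exact: asumZ.
- exact: hsumZ.
move=> k.
have := @hsum_fin _ _ (fun i : int => if absz (i - d0)%R == k then z ^ (- d0) * (A i * z ^ i) else 0) [:: d0 + k%:Z] isT.
have ek : absz (d0 + k%:Z - d0)%R == k by lia.
have ez : z ^ (- d0) * z ^ (d0 + k%:Z) = z ^+ k.
  by rewrite exprzDr ?unitfE // mulrA -exprzDr ?unitfE // addNr mul1r.
rewrite big_seq1 ek mulrCA ez; apply=> i; rewrite inE => h; case: eqP => // e.
by rewrite hA ?mul0r ?mulr0 //; move/eqP: h; lia.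
Qed.

Lemma asym0 : asym (fun=> 0 : C) (fun=> 0).
Proof.
by have := asymZ 0 (asym_poly (0 : {poly C})); under eq_fun do rewrite mul0r;
   under [X in asym _ X]eq_fun do rewrite mul0r.
Qed.

Lemma Lau_asym A (F : R -> C) (d0 : int) (dl : R) : 0 < dl ->
  (forall i, i < d0 -> A i = 0) -> (forall x : R, 0 < x < dl -> Lau A x%:C (F x)) ->
  asym (fun x => x%:C ^ (- d0) * F x) (fun k : nat => A (d0 + k%:Z)).
Proof.
move=> dl0 hA h.
have xC (x : R) : 0 < x -> x%:C != 0 by move=> x0; rewrite (inj_eq (@complexI R)) gt_eqF.
have d2 : 0 < dl / 2 by rewrite divr_gt0.
have d2' : dl / 2 < dl by rewrite ltr_pdivrMr // ltr_pMr // ltr1n.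
apply: (@asym_hsum _ _ _ (dl / 2)) => //.
  have := h (dl / 2); rewrite d2 d2' => /(_ isT) /(Lau_nat (xC _ d2) hA)[] //.
move=> x /andP[x0 x1].
have := h x; rewrite x0 (lt_trans x1) // => /(_ isT) /(Lau_nat (xC _ x0) hA)[] //.
Qed.

(** A series bounded below is an asymptotic expansion at 0+, so a real interval suffices for
    uniqueness. *)
Lemma Lau_real_uniq A (d0 : int) (dl : R) : 0 < dl -> (forall i, i < d0 -> A i = 0) ->
  (forall x : R, 0 < x < dl -> Lau A x%:C 0) -> forall i, A i = 0.
Proof.
move=> dl0 hA h i; have := Lau_asym dl0 hA h; under eq_fun do rewrite mulr0.
move=> /asym_uniq/(_ asym0) e; case: (ltrP i d0) => hi; first exact: hA.
by have := e (absz (i - d0)%R); rewrite (_ : d0 + _ = i) //; lia.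
Qed.

Lemma Lau_reflect A z S : Lau A z S -> Lau (fun i => A (- i)) z^-1 S.
Proof.
move=> [a1 h1].
apply: (@asum_fubini _ int int (fun i => A i * z ^ i) _ (fun i => - i)) => // j.
have := @hsum_fin _ _ (fun i : int => if - i == j then A i * z ^ i else 0) [:: - j] isT.
rewrite big_seq1 opprK eqxx exprz_inv; apply=> i.
by rewrite inE => h; case: eqP => // e; case/eqP: h; rewrite -e opprK.
Qed.

Lemma Lau_bounded A z S : Lau A z S -> exists M : R, forall i, cabs (A i) * cabs z ^ i <= M.
Proof.
move=> [[M hM] _]; exists M => i; have := hM [fset i]%fset.
by rewrite big_seq_fset1 cabsM cabs_exprz.
Qed.

Lemma geom_unbounded (c q M : R) : 0 <= c -> 1 < q -> (forall n : nat, c * q ^+ n <= M) ->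
  c = 0.
Proof.
move=> c0 q1 h; apply/eqP; rewrite eq_le c0 andbT leNgt; apply/negP => cpos.
have bern n : 1 + n%:R * (q - 1) <= q ^+ n.
  elim: n => [|n IH]; first by rewrite mul0r addr0.
  rewrite exprS -natr1; have n0 : 0 <= n%:R :> R by [].
  have : 0 <= n%:R * (q - 1) * (q - 1) by rewrite !mulr_ge0 // subr_ge0 ltW.
  have := ler_wpM2l (ltW (lt_trans ltr01 q1)) IH; lra.
pose n := Num.truncn (M / (c * (q - 1))).
have cq : 0 < c * (q - 1) by rewrite mulr_gt0 // subr_gt0.
have := truncnS_gt (M / (c * (q - 1))); rewrite -/n ltr_pdivrMr // => h1.
have := h n.+1; have := ler_wpM2l (ltW cpos) (bern n.+1).
by move: h1; set k := n.+1%:R => h1; nra.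
Qed.

(** Induction on J, removing one factor X + y at a time. A series killed by X + y in high degrees is
    geometric there, of ratio - 1 / y; the bound on a circle of radius r > |y| forces it to be 0.
    [trunc_below] is the same in low degrees, with r < |y|. *)
Lemma trunc_above A y (r M : R) (J : nat) (i0 : int) : y != 0 -> cabs y < r ->
  (forall i, cabs (A i) * r ^ i <= M) ->
  (forall i, i0 < i -> mulp (('X + y%:P) ^+ J) A i = 0) ->
  exists i1, forall i, i1 < i -> A i = 0.
Proof.
move=> y0 yr; have ya : 0 < cabs y by rewrite cabs_gt0.
have r0 : 0 < r by exact: lt_trans yr.
elim: J A M => [|J IH] A M hb hA.
  by exists i0 => i /hA; rewrite expr0 -polyC1 mulpC mul1r.
have [|i hi|i1 h1] := IH (mulp ('X + y%:P) A) ((r + cabs y) * M).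
- move=> i; rewrite mulpD -['X]expr1 mulpXn mulpC.
  apply: le_trans (ler_wpM2r _ (cabsD _ _)) _; first by rewrite exprz_ge0 // ltW.
  rewrite !mulrDl lerD //; last by rewrite cabsM -mulrA ler_wpM2l // cabs_ge0.
  have -> : r ^ i = r * r ^ (i - 1).
    by rewrite -[X in X * _]expr1z -exprzDr ?unitfE ?gt_eqF // addrC subrK.
  by rewrite mulrCA ler_wpM2l // ltW.
- by rewrite -mulpM -exprSr hA.
exists i1 => i hi; apply/eqP; rewrite -cabs_eq0; apply/eqP.
have rec (n : nat) : A (i + n%:Z) = (- y^-1) ^+ n * A i.
  elim: n => [|n IHn]; first by rewrite addr0 mul1r.
  have := h1 (i + n.+1%:Z); rewrite mulpD -['X]expr1 mulpXn mulpC.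
  rewrite (_ : i + n.+1%:Z - 1%N%:Z = i + n%:Z); last by lia.
  move=> /(_ _)/eqP; rewrite addr_eq0 IHn => e; have {e}/eqP e := e ltac:(lia).
  by rewrite exprS -mulrA e mulNr mulrN opprK mulKf.
apply: (@geom_unbounded _ (r / cabs y) (M * r ^ (- i))).
- exact: cabs_ge0.
- by rewrite ltr_pdivlMr // mul1r.
move=> n; have := hb (i + n%:Z); rewrite rec cabsM cabsX cabsN cabsV.
rewrite exprzDr ?unitfE ?gt_eqF // => h.
have := ler_wpM2r (exprz_ge0 (- i) (ltW r0)) h; apply: le_trans.
rewrite -exprnP expr_div_n exprVn le_eqVlt; apply/orP; left; apply/eqP.
have ri : r ^ (- i) * r ^ i = 1 by rewrite -exprzDr ?unitfE ?gt_eqF // addNr.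
transitivity (cabs (A i) * (r ^+ n * (cabs y ^+ n)^-1) * (r ^ (- i) * r ^ i)).
  by rewrite ri mulr1.
ring.
Qed.

Lemma trunc_below A y (r M : R) (J : nat) (i0 : int) : 0 < r -> r < cabs y ->
  (forall i, cabs (A i) * r ^ i <= M) ->
  (forall i, i < i0 -> mulp (('X + y%:P) ^+ J) A i = 0) ->
  exists i1, forall i, i < i1 -> A i = 0.
Proof.
move=> r0 yr; have ya : 0 < cabs y by exact: lt_trans yr.
elim: J A M => [|J IH] A M hb hA.
  by exists i0 => i /hA; rewrite expr0 -polyC1 mulpC mul1r.
have [|i hi|i1 h1] := IH (mulp ('X + y%:P) A) ((r + cabs y) * M).
- move=> i; rewrite mulpD -['X]expr1 mulpXn mulpC.
  apply: le_trans (ler_wpM2r _ (cabsD _ _)) _; first by rewrite exprz_ge0 // ltW.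
  rewrite !mulrDl lerD //; last by rewrite cabsM -mulrA ler_wpM2l // cabs_ge0.
  have -> : r ^ i = r * r ^ (i - 1).
    by rewrite -[X in X * _]expr1z -exprzDr ?unitfE ?gt_eqF // addrC subrK.
  by rewrite mulrCA ler_wpM2l // ltW.
- by rewrite -mulpM -exprSr hA.
exists (i1 - 1) => i hi; apply/eqP; rewrite -cabs_eq0; apply/eqP.
have rec (n : nat) : A (i - n%:Z) = (- y) ^+ n * A i.
  elim: n => [|n IHn]; first by rewrite subr0 mul1r.
  have := h1 (i - n%:Z); rewrite mulpD -['X]expr1 mulpXn mulpC.
  rewrite (_ : i - n%:Z - 1%N%:Z = i - n.+1%:Z); last by lia.
  move=> /(_ _)/eqP; rewrite addr_eq0 IHn => e; have {e}/eqP -> := e ltac:(lia).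
  by rewrite exprS -mulrA mulNr.
apply: (@geom_unbounded _ (cabs y / r) (M * r ^ (- i))).
- exact: cabs_ge0.
- by rewrite ltr_pdivlMr // mul1r.
move=> n; have := hb (i - n%:Z); rewrite rec cabsM cabsX cabsN.
rewrite exprzDr ?unitfE ?gt_eqF // => h.
have := ler_wpM2r (exprz_ge0 (- i) (ltW r0)) h; apply: le_trans.
rewrite -exprnN expr_div_n le_eqVlt; apply/orP; left; apply/eqP.
have ri : r ^ (- i) * r ^ i = 1 by rewrite -exprzDr ?unitfE ?gt_eqF // addNr.
transitivity (cabs (A i) * (cabs y ^+ n * (r ^+ n)^-1) * (r ^ (- i) * r ^ i)).
  by rewrite ri mulr1.
ring.
Qed.

(** The monomials are collected by degree; the resulting coefficients do not depend on the point z
    of the domain. *)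
Lemma laurent_of_hsum (I : choiceType) (c : I -> C) (deg : I -> int)
    (D : C -> Prop) (F : C -> C) z0 : D z0 -> (forall z, D z -> z != 0) ->
  (forall z, D z -> asum (fun m => c m * z ^ deg m) /\
                    hsum (fun m => c m * z ^ deg m) (F z)) ->
  exists A : int -> C, (forall i, hsum (fun m => if deg m == i then c m else 0) (A i)) /\
    forall z, D z -> Lau A z (F z).
Proof.
move=> Dz0 Dn h; have z00 := Dn _ Dz0.
have ex i : exists s, hsum (fun m => if deg m == i then c m else 0) s.
  have [a0 _] := h _ Dz0; apply: asum_hsum.
  apply: asum_le (asumZ (z0 ^ (- i)) a0) => m; case: eqP => [<-|_]; last by rewrite cabs0; exact: cabs_ge0.
  by rewrite mulrCA -exprzDr ?unitfE // addNr mulr1.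
pose A i := sval (cid (ex i)); have hA i := svalP (cid (ex i)).
exists A; split=> // z Dz; have [a1 h1] := h _ Dz.
apply: (asum_fubini (deg := deg) a1 h1) => i; rewrite mulrC.
apply: eq_hsum (hsumZ (z ^ i) (hA i)) => m.
by case: (eqVneq (deg m) i) => [<-|ne]; rewrite ?mulr0 // mulrC.
Qed.

End Laurent.

(** * Branches off the real axis, and the Jacobi identity from three circles *)

Section Branches.
Variable R : realType.
Local Notation C := R[i].
Implicit Types (z y : C) (A B E : int -> C) (P : {poly C}).

Lemma cos_carg z : z != 0 -> cos (carg z) = complex.Re z / cabs z.
Proof.
move=> z0; have c0 : 0 < cabs z by rewrite cabs_gt0.
have h : -1 <= complex.Re z / cabs z <= 1.
  by rewrite -ler_norml normrM normfV [X in _ / X]gtr0_norm // ler_pdivrMr // mul1r cabs_ge_Re.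
have k : cos (acos (complex.Re z / cabs z)) = complex.Re z / cabs z by rewrite acosK.
rewrite /carg; case: ifP => _ //.
by rewrite cosB cos2pi sin2pi mul1r mul0r addr0.
Qed.

Lemma sqr_cabs z : cabs z ^+ 2 = complex.Re z ^+ 2 + complex.Im z ^+ 2.
Proof.
apply: complexI; rewrite rmorphXn /= -normr_cabs -add_Re2_Im2 //.
Qed.

Lemma sin_carg z : z != 0 -> sin (carg z) = complex.Im z / cabs z.
Proof.
move=> z0; have c0 : 0 < cabs z by rewrite cabs_gt0.
have h : -1 <= complex.Re z / cabs z <= 1.
  by rewrite -ler_norml normrM normfV [X in _ / X]gtr0_norm // ler_pdivrMr // mul1r cabs_ge_Re.
have k : sin (acos (complex.Re z / cabs z)) = `|complex.Im z| / cabs z.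
  have -> : `|complex.Im z| / cabs z = Num.sqrt ((`|complex.Im z| / cabs z) ^+ 2).
    by rewrite sqrtr_sqr [RHS]ger0_norm // divr_ge0 // cabs_ge0.
  rewrite sin_acos //; congr Num.sqrt.
  rewrite !expr_div_n real_normK ?num_real // sqr_cabs.
  have s0 : complex.Re z ^+ 2 + complex.Im z ^+ 2 != 0.
    by rewrite -sqr_cabs expf_neq0 // gt_eqF.
  by field.
rewrite /carg; case: ifPn => [hi|]; first by rewrite k ger0_norm.
rewrite -ltNge => hi; rewrite sinB cos2pi sin2pi mul1r mul0r sub0r k.
by rewrite ltr0_norm // mulNr opprK.
Qed.

Lemma cexp_clog p z : z != 0 -> cexp (clog p z) = z.
Proof.
move=> z0; have c0 : 0 < cabs z by rewrite cabs_gt0.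
have -> : clog p z = (ln (cabs z) +i* carg z) + p%:~R * twopii R.
  rewrite /clog twopiiE -(rmorph_int (real_complex R)) mulrCA -rmorphM /=.
  by rewrite [(_ * p%:~R)%R]mulrC; simpc.
rewrite cexpD cexp_twopiiz mulr1 /cexp /= lnK ?posrE // cos_carg // sin_carg //.
by rewrite ![cabs z * _]mulrC !divfK ?gt_eqF //; case: (z).
Qed.

Lemma clog_polar (r t : R) : 0 < r -> 0 <= t < pi *+ 2 ->
  clog 0 (r%:C * cexp (0 +i* t)) = ln r +i* t.
Proof.
move=> r0 /andP[t0 t2].
have ca : cabs (r%:C * cexp (0 +i* t)) = r.
  by rewrite cabsM cabs_real gtr0_norm // cabs_cexp /= expR0 mulr1.
rewrite /clog ca mulr0z mulr0 addr0; congr (_ +i* _).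
rewrite /carg ca /cexp /= expR0 !mul1r; simpc => /=.
rewrite mulrAC divff ?gt_eqF // mul1r pmulr_rge0 //.
case: (lerP t pi) => tp.
  have -> : 0 <= sin t by apply: sin_ge0_pi; rewrite t0.
  by rewrite cosK // in_itv /= t0.
have h : 0 < sin (pi *+ 2 - t).
  apply: sin_gt0_pi; rewrite subr_gt0 t2 /=; move: tp; rewrite mulr2n; lra.
have e : sin (pi *+ 2 - t) = - sin t by rewrite sinB cos2pi sin2pi mul1r mul0r sub0r.
rewrite e oppr_gt0 in h; rewrite leNgt h /=.
have -> : cos t = cos (pi *+ 2 - t) by rewrite cosB cos2pi sin2pi mul1r mul0r addr0.
rewrite cosK ?subKr // in_itv /= subr_ge0 ltW //=.
by move: tp; rewrite mulr2n; lra.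
Qed.

(** These points tend to the positive axis from below, where the branch tends to log r + 2 pi i and
    not to its value log r on the axis. *)
Lemma clog_uroot (r : R) N : 0 < r -> (1 < N)%N ->
  clog 0 (r%:C * (uroot R N)^-1) = (ln r)%:C + twopii R + (- twopii R) / N%:R.
Proof.
move=> r0 N1; have N0 : N%:R != 0 :> R by rewrite pnatr_eq0 -lt0n (ltn_trans _ N1).
pose t : R := pi *+ 2 - pi *+ 2 / N%:R.
have Ni : N%:R^-1 = (N%:R^-1 : R)%:C by rewrite fmorphV rmorph_nat.
have -> : (uroot R N)^-1 = cexp (0 +i* t).
  rewrite /uroot -cexpN (_ : 0 +i* t = - (twopii R / N%:R) + 1%:~R * twopii R).
    by rewrite cexpD cexp_twopiiz mulr1.
  by rewrite mul1r /t /twopii Ni; apply/eqP; rewrite eq_complex /=; apply/andP; split; apply/eqP; ring.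
rewrite clog_polar // /t.
  by rewrite /twopii Ni; apply/eqP; rewrite eq_complex /=; apply/andP; split; apply/eqP; ring.
have p0 : 0 < pi *+ 2 :> R by rewrite pmulrn_lgt0 // pi_gt0.
rewrite subr_ge0 ltrBlDr ltrDl divr_gt0 ?ltr0n ?(ltn_trans _ N1) // andbT.
by rewrite ler_pdivrMr ?ltr0n ?(ltn_trans _ N1) // ler_peMr ?(ltW p0) // ler1n ltnW.
Qed.

Lemma weak_of_Lau E y (r : R) (K t : nat) P : 0 < r -> cabs y != r ->
  (forall z, cabs z = r -> Lau E z (z ^- K * P.[z] * (z + y) ^- t)) ->
  forall i, mulp (('X + y%:P) ^+ t) E (i - K%:Z) = icoef P i.
Proof.
move=> r0 yr h i; apply/eqP; rewrite -subr_eq0; apply/eqP; rewrite -mulpMXn.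
move: i; apply: (Lau_circle_uniq r0) => z hz.
have z0 : z != 0 by rewrite -cabs_eq0 hz gt_eqF.
have zy : z + y != 0.
  by rewrite addr_eq0; apply: contraNneq yr => e; rewrite -hz e cabsN.
apply: Lau_sub (Lau_poly _ z0).
rewrite (_ : P.[z] = (('X + y%:P) ^+ t * 'X^K).[z] * (z ^- K * P.[z] * (z + y) ^- t)).
  exact/Lau_mulp/h.
rewrite hornerM hornerXn horner_exp hornerD hornerX hornerC.
have := expf_neq0 t zy; have := expf_neq0 K z0.
move: ((z + y) ^+ t) (z ^+ K) => a b a0 b0; field; by rewrite a0 b0.
Qed.

(** Uniqueness on circles gives the weak identities ([weak_of_Lau]). The truncation that
    [jacobi_of_weak] asks for is deduced from convergence on these circles. *)
Lemma jacobi_of_Lau A B E y (ra rb rc : R) (K J : nat) P :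
  y != 0 -> cabs y < ra -> 0 < rb < cabs y -> 0 < rc < cabs y ->
  (forall z, cabs z = ra -> Lau A z (z ^- K * P.[z] * (z + y) ^- J)) ->
  (forall z, cabs z = rb -> Lau B z (z ^- K * P.[z] * (z + y) ^- J)) ->
  (forall x, cabs x = rc -> Lau E x ((x - y) ^- K * P.[x - y] * x ^- J)) ->
  forall m n, phiA y A m n - psi y B m n = psi (- y) E n m.
Proof.
move=> y0 hra /andP[rb0 hrb] /andP[rc0 hrc] hA hB hE.
have ra0 : 0 < ra by apply: le_lt_trans hra; exact: cabs_ge0.
pose Q := P \Po ('X - y%:P).
have QP : Q \Po ('X + y%:P) = P.
  by rewrite /Q -comp_polyA comp_polyB comp_polyX comp_polyC addrK comp_polyXr.
have wA := weak_of_Lau ra0 (negbT (lt_eqF hra)) hA.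
have wB := weak_of_Lau rb0 (negbT (gt_eqF hrb)) hB.
have hE' x : cabs x = rc -> Lau E x (x ^- J * Q.[x] * (x + - y) ^- K).
  move=> /hE; rewrite /Q horner_comp hornerD hornerN hornerX hornerC.
  by rewrite [X in Lau _ _ X -> _](_ : _ = x ^- J * P.[x - y] * (x - y) ^- K) //; ring.
have Nyrc : cabs (- y) != rc by rewrite cabsN gt_eqF.
have wE := weak_of_Lau rc0 Nyrc hE'.
have hr (r : R) : 0 < r -> cabs r%:C = r by move=> r0; rewrite cabs_real gtr0_norm.
have [MA bA] := Lau_bounded (hA _ (hr _ ra0)).
have [MB bB] := Lau_bounded (hB _ (hr _ rb0)).
have [ME bE] := Lau_bounded (hE' _ (hr _ rc0)).
rewrite (hr _ ra0) in bA; rewrite (hr _ rb0) in bB; rewrite (hr _ rc0) in bE.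
have [a0 tA] : exists a0, forall i, a0 < i -> A i = 0.
  apply: (@trunc_above _ A y ra MA J (size P)%:Z) => // i hi.
  rewrite (_ : i = i + K%:Z - K%:Z) ?wA; last by rewrite addrK.
  case: i hi => [i|i] hi; last by lia.
  by rewrite -PoszD /= nth_default // (leq_trans _ (leq_addr _ _)) // ltnW // -ltz_nat.
have [b0 tB] : exists b0, forall i, i < b0 -> B i = 0.
  apply: (@trunc_below _ B y rb MB J (- K%:Z)) => // i hi.
  rewrite (_ : i = i + K%:Z - K%:Z) ?wB; last by rewrite addrK.
  by case e : (i + K%:Z) => [j|j] //; exfalso; lia.
have [c0 tE] : exists c0, forall i, i < c0 -> E i = 0.
  apply: (@trunc_below _ E (- y) rc ME K (- J%:Z)); rewrite ?cabsN // => i hi.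
  rewrite (_ : i = i + J%:Z - J%:Z) ?wE; last by rewrite addrK.
  by case e : (i + J%:Z) => [j|j] //; exfalso; lia.
apply: (@jacobi_of_weak R y A B E a0 b0 c0 J K Q) => //.
- move=> m; rewrite phiA_mulp QP -wA; congr mulp; ring.
- move=> m; rewrite psi_mulp QP -wB; congr mulp; ring.
- move=> n; rewrite psi_mulp -wE; congr mulp; ring.
Qed.

End Branches.

(** * Weights *)

Section ModuleL0.
Variables (R : realType) (V : voa R) (g : V -> V) (W : twisted_module g).
Local Notation C := R[i].
Hypothesis g_linear : linear g.
Hypothesis g_omega : g (voa_omega V) = voa_omega V.
Local Notation gdual := (graded_dual (@tm_gr _ _ _ W)).

(** A fixed vector is a chain of length 1 with alpha = 0. This applies to omega on any module and to
    every vector of V on an untwisted one. *)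
Lemma fixed_modes (v : V) (w : W) (m : lmono R) : g v = v -> tm_Y v w m <> 0 ->
  exists n : int, m = (n%:~R, 0%N).
Proof.
move=> gv; pose v_ j : V := if j is 0%N then v else 0.
have v0 j : (1 <= j)%N -> v_ j = 0 by case: j.
have gch j : g (v_ j) = cexp (twopii R * 0) *:
    \sum_(k < 1) (twopii R ^+ k / (k`!)%:R) *: v_ (j + k)%N.
  rewrite big_ord1 expr0 fact0 divr1 mulr0 cexp0 !scale1r addn0.
  by case: j => [|j] //=; rewrite lin0.
have [K hK] := chain_log_bound v0 w.
case: m => r k hm.
have [w' [hw' hw'm]] : exists w', gdual w' /\ w' (tm_Y v w (r, k)) <> 0.
  apply: contra_notP hm => h; apply: tm_separates => w' hw'.
  by apply: contrapT => hh; apply: h; exists w'.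
have [hpoly hint] := chain_poly v0 gch hw' r hK.
move: hpoly; rewrite big_ord1 expr0 fact0 invr1 polyC1 !mul1r => /(congr1 (fun P : {poly C} => P`_k)).
have kK : (k < K)%N by rewrite ltnNge; apply/negP => /(hK 0%N r) e; apply: hm.
rewrite coef_poly kK coefC /=; case: eqP => [k0 _|_ /hw'm//].
rewrite k0 in hw'm *; have [n] := hint (introN eqP hw'm).
by rewrite addr0 => ->; exists n.
Qed.

Definition L0 (w : W) : W := tm_Y (voa_omega V) w (- 2, 0%N).

Lemma L0_linear : linear L0. Proof. exact: tm_linr. Qed.

Definition L0sub (n : C) (w : W) : W := L0 w - n *: w.

Lemma tm_grP n w : tm_gr n w <-> exists m : nat, iter m (L0sub n) w = 0.
Proof. by rewrite tm_L0. Qed.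

Lemma L0_gr n w : tm_gr n w -> tm_gr n (L0 w).
Proof.
move=> /tm_grP[m hm]; apply/tm_grP; exists m.
have comm k x : iter k (L0sub n) (L0 x) = L0 (iter k (L0sub n) x).
  elim: k => [//|k IH]; rewrite !iterS IH /L0sub.
  by rewrite -!scaleNr (linD L0_linear) (linZ L0_linear).
by rewrite comm hm (lin0 L0_linear).
Qed.

Lemma gdual_L0 w' : gdual w' -> gdual (w' \o L0).
Proof.
move=> [hs [s hw]]; split; first exact: (scalar_comp hs L0_linear).
by exists s => n ns w /L0_gr; exact: hw.
Qed.

(** Recovers the integer from an exponent known to be integral; otherwise the value has no
    meaning. *)
Definition degl (m : lmono R) : int := Num.floor (complex.Re m.1).

Lemma degl_int (n : int) k : degl (n%:~R, k) = n.
Proof. by rewrite /degl /= -(rmorph_int (real_complex R)) /= intrKfloor. Qed.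

Lemma carg_bounds (z : C) : z != 0 -> 0 <= carg z <= pi *+ 2.
Proof.
move=> z0; have c0 : 0 < cabs z by rewrite cabs_gt0.
have h : -1 <= complex.Re z / cabs z <= 1.
  by rewrite -ler_norml normrM normfV [X in _ / X]gtr0_norm // ler_pdivrMr // mul1r cabs_ge_Re.
have := acos_ge0 h; have := acos_lepi h; have := pi_gt0 R; rewrite /carg.
by case: ifP => _; rewrite mulr2n; lra.
Qed.

Lemma carg_left (z : C) : complex.Re z < 0 -> `|carg z - pi| < pi / 2.
Proof.
move=> hz; have z0 : z != 0 by apply: contraTneq hz => ->; rewrite /= ltxx.
have c0 : 0 < cabs z by rewrite cabs_gt0.
have hc : cos `|carg z - pi| > 0.
  rewrite cos_norm cosB cospi sinpi mulr0 addr0 mulrN1 oppr_gt0 cos_carg //.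
  by rewrite ltr_pdivrMr // mul0r.
rewrite ltNge; apply/negP => hp.
have /andP[a0 a1] := carg_bounds z0; have p0 := pi_gt0 R.
have b1 : `|carg z - pi| <= pi by rewrite ler_norml; move: a1; rewrite mulr2n; lra.
have : cos `|carg z - pi| <= cos (pi / 2).
  rewrite le_eqVlt; move: hp; rewrite le_eqVlt => /orP[/eqP <-|hp]; first by rewrite eqxx.
  by apply/orP; right; rewrite ltr_cos ?in_itv /= ?normr_ge0 ?b1 //; lra.
by rewrite cos_pihalf leNgt hc.
Qed.

Lemma hsum_fiber (I : choiceType) (T : eqType) (c : I -> C) (p : pred I) (h : T -> I)
    (r : seq T) (s : C) : injective h -> uniq r -> (forall t, t \in r -> p (h t)) ->
  (forall i, p i -> i \notin map h r -> c i = 0) ->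
  hsum (fun i => if p i then c i else 0) s -> s = \sum_(t <- r) c (h t).
Proof.
move=> hi ur hp hc hs; apply: hsum_uniq hs _.
have -> : \sum_(t <- r) c (h t) = \sum_(i <- map h r) if p i then c i else 0.
  by rewrite big_map; apply: eq_big_seq => t /hp ->.
apply: hsum_fin; first by rewrite map_inj_uniq.
by move=> i hn; case: ifP => // /hc; apply.
Qed.

Section Commutator.
Variables (v : V) (w : W) (w' : W -> C) (rho : R) (ms : seq (lmono R)).
Hypotheses (hw' : gdual w') (rho0 : 0 < rho) (ums : uniq ms).
Hypothesis hA : forall m, m \notin ms -> w' (L0 (tm_Y v w m)) = 0.
Hypothesis hB : forall m, m \notin ms -> w' (tm_Y v (L0 w) m) = 0.
Hypothesis hC : forall m, m \notin ms -> w' (tm_Y (voa_L 0 v) w m) = 0.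
Hypothesis hD : forall m, m \notin ms -> w' (tm_Y (voa_L (-1) v) w m) = 0.
Let l2 : C := (ln rho)%:C + pi%:C * 'i%C.
Let z2 : C := - rho%:C.

Let clog_z2 : clog 0 z2 = l2.
Proof. by rewrite /z2 clog_neg // mul0r addr0. Qed.

Let rhoC : rho%:C != 0 :> C. Proof. by rewrite (inj_eq (@complexI R)) gt_eqF. Qed.

Let cabs_z2 : cabs z2 = rho.
Proof. by rewrite /z2 cabsN cabs_real gtr0_norm. Qed.

(** The component m = 1, n = 0 of the Jacobi identity for omega and [v], at z_2 = - rho. As omega is
    fixed by [g], the three expansions are Laurent series on full annuli, and [jacobi_of_Lau]
    applies. *)
Lemma commutator_at :
  \sum_(m <- ms) w' (L0 (tm_Y v w m)) * mon m l2
  - \sum_(m <- ms) w' (tm_Y v (L0 w) m) * mon m l2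
  = z2 * (\sum_(m <- ms) w' (tm_Y (voa_L (-1) v) w m) * mon m l2)
    + \sum_(m <- ms) w' (tm_Y (voa_L 0 v) w m) * mon m l2.
Proof.
have [f [t hf]] := tm_duality (voa_omega V) v w hw'.
pose Gl l : C := \sum_(c <- f) c.1 * (mon (c.2 ord0) l * mon (c.2 (lift ord0 ord0)) l2).
have GlE z : lp_eval f [tuple 0; 0] [tuple z; z2] = Gl (clog 0 z).
  rewrite /lp_eval /Gl; apply: eq_bigr => c _; congr (_ * _).
  by rewrite !big_ord_recl big_ord0 mulr1 /mono_at /mon !(tnth_nth 0) /= clog_z2.
have expG : exppoly Gl.
  apply: exppoly_sum => c; apply: exppolyM (exppolyC _) _.
  by apply: exppolyM (exppoly_mon _) (exppolyC _).
pose cA (m : lmono R * lmono R) := w' (tm_Y (voa_omega V) (tm_Y v w m.2) m.1) * mon m.2 l2.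
pose cB (m : lmono R * lmono R) := w' (tm_Y v (tm_Y (voa_omega V) w m.1) m.2) * mon m.2 l2.
pose cE (m : int * lmono R) := w' (tm_Y (voa_Y (voa_omega V) v m.1) w m.2) * mon m.2 l2.
have mono_deg (z : C) (m : lmono R) (x : W) (y : C) : z != 0 -> (tm_Y (voa_omega V) x m <> 0 \/ y = 0) ->
    y * mono_at 0 z m = y * z ^ degl m.
  move=> z0 [h|->]; last by rewrite !mul0r.
  have [n ->] := fixed_modes g_omega h; rewrite degl_int /mono_at /= expr0 mulr1.
  by rewrite cexpMz cexp_clog.
have mono_z2 m : mono_at 0 z2 m = mon m l2 by rewrite /mono_at clog_z2.
(* The correlation function with z_2 fixed, as a function of z_1 = z. *)
pose F z := Gl (clog 0 z) * (z - z2) ^- t.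
have rzn z : 0 < cabs z < rho -> z != 0 by move=> /andP[+ _]; rewrite cabs_gt0.
have [A [fA LA]] : exists A, (forall i, hsum (fun m => if degl m.1 == i then cA m else 0) (A i)) /\
    forall z, rho < cabs z -> Lau A z (F z).
  apply: (@laurent_of_hsum R _ cA (fun m => degl m.1) (fun z => rho < cabs z) F (rho + 1)%:C).
  - by rewrite cabs_real gtr0_norm ?ltrDl ?ltr01 // addr_gt0.
  - by move=> z hz; rewrite -cabs_gt0 (lt_trans rho0).
  move=> z hz; have z0 : z != 0 by rewrite -cabs_gt0 (lt_trans rho0).
  have hz2 : 0 < cabs z2 < cabs z by rewrite cabs_z2 rho0.
  have [p _ _] := hf 0 z z2; have [hs hv] := p hz2.
  have eA m : w' (tm_Y (voa_omega V) (tm_Y v w m.2) m.1) * mono_at 0 z m.1 * mono_at 0 z2 m.2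
     = cA m * z ^ degl m.1.
    rewrite /cA /= -(mono_z2 m.2) [RHS]mulrAC; congr (_ * _).
    apply: (mono_deg z m.1 (tm_Y v w m.2) _ z0).
    case: (pselect (tm_Y (voa_omega V) (tm_Y v w m.2) m.1 = 0)) => [->|h]; last by left.
    by right; rewrite (scal0 hw'.1).
  rewrite /F -GlE; split.
    by apply: asum_le (abs_summable_asum hs) => m; rewrite eA.
  by apply: eq_hsum (sums_to_hsum hv) => m; exact: eA.
have [B [fB LB]] : exists B, (forall i, hsum (fun m => if degl m.1 == i then cB m else 0) (B i)) /\
    forall z, 0 < cabs z < rho -> Lau B z (F z).
  apply: (@laurent_of_hsum R _ cB (fun m => degl m.1) (fun z => 0 < cabs z < rho) F (rho / 2)%:C) => //.
  - by rewrite cabs_real gtr0_norm ?divr_gt0 //= ltr_pdivrMr // ltr_pMr // ltr1n.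
  move=> z hz; have z0 := rzn _ hz.
  have hz2 : 0 < cabs z < cabs z2 by rewrite cabs_z2.
  have [_ p _] := hf 0 z z2; have [hs hv] := p hz2.
  have eB m : w' (tm_Y v (tm_Y (voa_omega V) w m.1) m.2) * mono_at 0 z m.1 * mono_at 0 z2 m.2
     = cB m * z ^ degl m.1.
    rewrite /cB /= -(mono_z2 m.2) [RHS]mulrAC; congr (_ * _).
    apply: (mono_deg z m.1 w _ z0).
    case: (pselect (tm_Y (voa_omega V) w m.1 = 0)) => [->|h]; last by left.
    by right; rewrite (lin0 (tm_linr v m.2)) (scal0 hw'.1).
  rewrite /F -GlE; split.
    by apply: asum_le (abs_summable_asum hs) => m; rewrite eB.
  by apply: eq_hsum (sums_to_hsum hv) => m; exact: eB.
(* After multiplication by (z - z_2)^t the series B is single-valued and continuous on the circle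
   |z| = r < rho, while its sum [Gl (clog 0 z)] is computed with a logarithm that jumps by 2 pi i
   across the positive axis. Approaching the axis from below gives the periodicity. *)
have perG : halfline (fun l => Gl (l + twopii R) = Gl l).
  exists 0, (ln rho) => x xr; rewrite add0r.
  pose r := expR x; have r0 : 0 < r by exact: expR_gt0.
  have rrho : r < rho by rewrite -(lnK (x := rho)) ?posrE // ltr_expR.
  pose T := mulp (('X + rho%:C%:P) ^+ t) B.
  have LT z : cabs z = r -> Lau T z (Gl (clog 0 z)).
    move=> hz; have hz' : 0 < cabs z < rho by rewrite hz r0.
    have zz2 : z - z2 != 0.
      by rewrite subr_eq0; apply: contraTneq hz' => ->; rewrite cabs_z2 ltxx andbF.
    rewrite (_ : Gl _ = (('X + rho%:C%:P) ^+ t).[z] * F z); first exact/Lau_mulp/LB/hz'/rzn.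
    rewrite /F horner_exp hornerD hornerX hornerC -[rho%:C]opprK -/z2 mulrCA mulfV ?mulr1 //.
    exact: expf_neq0.
  have cr : cabs r%:C = r by rewrite cabs_real gtr0_norm.
  have [aT hT] := LT _ cr.
  have cont := @circle_cont R _ _ (fun N => Gl (clog 0 (r%:C * (uroot R N)^-1))) aT hT.
  have {}cont : cvg0 (fun N => Gl (clog 0 (r%:C * (uroot R N)^-1)) - Gl (clog 0 r%:C)).
    apply: cont => N N0.
    have [|_] := LT (r%:C * (uroot R N)^-1).
      rewrite cabsM cr cabsV /uroot cabs_cexp twopiiE -(rmorph_nat (real_complex R)) -fmorphV /=.
      by simpc; rewrite /= ?(mulr0, mul0r, subr0, addr0, oppr0) expR0 invr1 mulr1.
    apply: eq_hsum => i; rewrite exprzMl ?mulrA // unitfE ?invr_eq0 ?uroot_neq0 //.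
    by rewrite (inj_eq (@complexI R)) gt_eqF.
  have c2 := exppoly_cvg0 ((ln r)%:C + twopii R) (- twopii R) expG.
  have e1 : clog 0 r%:C = x%:C by rewrite clog_pos // mul0r addr0 /r expRK.
  have e2 : (ln r)%:C = x%:C :> C by rewrite /r expRK.
  rewrite e1 in cont; rewrite e2 in c2.
  apply/eqP; rewrite -subr_eq0; apply/eqP; apply: cvg0_const => e e0.
  have [N1 h1] := cvg0D cont (cvg0Z (-1) c2) e0; exists (maxn 1 N1) => N.
  rewrite gtn_max => /andP[N1' N1'']; have := h1 N N1''.
  rewrite clog_uroot // e2; apply: le_lt_trans; rewrite le_eqVlt; apply/orP; left.
  by apply/eqP; congr cabs; ring.
have [K [P hP]] := exppoly_periodic expG perG.
have FE z : z != 0 -> F z = z ^- K * P.[z] * (z + rho%:C) ^- t.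
  by move=> z0; rewrite /F hP cexp_clog // /z2 opprK.
have [E [fE LE]] : exists E, (forall i, hsum (fun m => if m.1 == i then cE m else 0) (E i)) /\
    forall x, 0 < cabs x < rho -> Lau E x ((x - rho%:C) ^- K * P.[x - rho%:C] * x ^- t).
  apply: (@laurent_of_hsum R _ cE (fun m => m.1) (fun z => 0 < cabs z < rho)
     (fun x => (x - rho%:C) ^- K * P.[x - rho%:C] * x ^- t) (rho / 2)%:C) => //.
  - by rewrite cabs_real gtr0_norm ?divr_gt0 //= ltr_pdivrMr // ltr_pMr // ltr1n.
  move=> x hx; have x0 := rzn _ hx.
  (* The argument of z_1 = x - rho is thus within pi / 2 of that of z_2, as the third case of
     duality requires. *)
  have rez : complex.Re (x - rho%:C) < 0.
    have -> : complex.Re (x - rho%:C) = complex.Re x - rho by case: (x).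
    rewrite subr_lt0 (le_lt_trans (ler_norm _)) // (le_lt_trans (cabs_ge_Re _)) //.
    by case/andP: hx.
  have z0 : x - rho%:C != 0 by apply: contraTneq rez => ->; rewrite /= ltxx.
  have ez : x - rho%:C - z2 = x by rewrite /z2 opprK subrK.
  have hz2 : 0 < cabs (x - rho%:C - z2) < cabs z2 by rewrite ez cabs_z2.
  have [_ _ p] := hf 0 (x - rho%:C) z2; have [hs hv] := p hz2.
  have ca : carg z2 = pi.
    by rewrite /z2 /carg cabsN cabs_real gtr0_norm //= oppr0 lexx mulNr divff ?gt_eqF // acosN1.
  have {}hv := hv (ltac:(by rewrite ca; exact: carg_left)).
  rewrite ez in hs hv; rewrite GlE in hv.
  have eE m : w' (tm_Y (voa_Y (voa_omega V) v m.1) w m.2) * x ^ m.1 * mono_at 0 z2 m.2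
     = cE m * x ^ m.1 by rewrite /cE mono_z2 mulrAC.
  split; first by apply: asum_le (abs_summable_asum hs) => m; rewrite eE.
  rewrite hP cexp_clog // in hv.
  exact: (eq_hsum eE (sums_to_hsum hv)).
have r2 : 0 < rho / 2 < rho by rewrite divr_gt0 //= ltr_pdivrMr // ltr_pMr // ltr1n.
have cr : cabs rho%:C = rho by rewrite cabs_real gtr0_norm.
have := @jacobi_of_Lau R A B E rho%:C (rho + 1) (rho / 2) (rho / 2) K t P rhoC.
rewrite cr ltrDl ltr01 r2 => /(_ isT isT isT).
move=> /(_ _ _ _ 1 0) J.
have {J} : phiA rho%:C A 1 0 - psi rho%:C B 1 0 = psi (- rho%:C) E 0 1.
  apply: J.
  - move=> z hz; have h : rho < cabs z by rewrite hz ltrDl.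
    by rewrite -FE; [exact: LA | rewrite -cabs_gt0 (lt_trans rho0)].
  - move=> z hz; have h : 0 < cabs z < rho by rewrite hz.
    by rewrite -FE; [exact: LB | exact: rzn].
  - by move=> x hx; apply: LE; rewrite hx.
have -> : phiA rho%:C A 1 0 = A (-2).
  rewrite /phiA (@nsumE _ _ 1) => [|k hk]; last by rewrite (@binom_gt R 0 k) ?mul0r.
  by rewrite big_ord1 binom0 expr0 !mul1r.
have -> : psi rho%:C B 1 0 = B (-2).
  rewrite /psi (@nsumE _ _ 1) => [|k hk]; last by rewrite (@binom_gt R 0 k) ?mul0r.
  by rewrite big_ord1 binom0 expr0z !mul1r.
have -> : psi (- rho%:C) E 0 1 = z2 * E (-1) + E (-2).
  rewrite /psi (@nsumE _ _ 2) => [|k hk]; last by rewrite (@binom_gt R 1 k) ?mul0r.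
  rewrite big_ord_recl big_ord1 binom0 (binom_nat R 1 1) binn !mul1r.
  by [].
have m2 : (-2)%:~R = - 2 :> C by rewrite mulrNz.
have -> : A (-2) = \sum_(m <- ms) w' (L0 (tm_Y v w m)) * mon m l2.
  apply: (@hsum_fiber _ _ cA (fun m => degl m.1 == -2) (fun m => ((- 2, 0%N) : lmono R, m)) ms _ _ ums _ _ (fA (-2))).
  - by move=> a b [].
  - by move=> m _; rewrite -m2 degl_int.
  move=> [m1 m'] /= /eqP hm nm; rewrite /cA /=.
  case: (pselect (tm_Y (voa_omega V) (tm_Y v w m') m1 = 0)) => [->|h].
    by rewrite (scal0 hw'.1) mul0r.
  have [n em] := fixed_modes g_omega h; rewrite em degl_int in hm; rewrite em hm m2.
  rewrite -/(L0 _) hA ?mul0r //; apply: contra nm => m'ms; apply/mapP.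
  by exists m' => //; rewrite em hm m2.
have -> : B (-2) = \sum_(m <- ms) w' (tm_Y v (L0 w) m) * mon m l2.
  apply: (@hsum_fiber _ _ cB (fun m => degl m.1 == -2) (fun m => ((- 2, 0%N) : lmono R, m)) ms _ _ ums _ _ (fB (-2))).
  - by move=> a b [].
  - by move=> m _; rewrite -m2 degl_int.
  move=> [m1 m'] /= /eqP hm nm; rewrite /cB /=.
  case: (pselect (tm_Y (voa_omega V) w m1 = 0)) => [->|h].
    by rewrite (lin0 (tm_linr v m')) (scal0 hw'.1) mul0r.
  have [n em] := fixed_modes g_omega h; rewrite em degl_int in hm; rewrite em hm m2.
  rewrite -/(L0 _) hB ?mul0r //; apply: contra nm => m'ms; apply/mapP.
  by exists m' => //; rewrite em hm m2.
have -> : E (-1) = \sum_(m <- ms) w' (tm_Y (voa_L (-1) v) w m) * mon m l2.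
  apply: (@hsum_fiber _ _ cE (fun m => m.1 == -1) (fun m => (-1, m)) ms _ _ ums _ _ (fE (-1))) => //.
    by move=> a b [].
  move=> [i m'] /= /eqP -> nm; rewrite /cE /= -[voa_Y _ _ _]/(voa_L (-1) v) hD ?mul0r //.
  by apply: contra nm => m'ms; apply/mapP; exists m'.
have -> // : E (-2) = \sum_(m <- ms) w' (tm_Y (voa_L 0 v) w m) * mon m l2.
apply: (@hsum_fiber _ _ cE (fun m => m.1 == -2) (fun m => (-2, m)) ms _ _ ums _ _ (fE (-2))) => //.
  by move=> a b [].
move=> [i m'] /= /eqP -> nm; rewrite /cE /= -[voa_Y _ _ _]/(voa_L 0 v) hC ?mul0r //.
by apply: contra nm => m'ms; apply/mapP; exists m'.
Qed.

End Commutator.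

End ModuleL0.

Lemma sum_supp (T : eqType) (V : nmodType) (s t : seq T) (F : T -> V) :
  uniq s -> uniq t -> {subset s <= t} -> (forall i, i \notin s -> F i = 0) ->
  \sum_(i <- s) F i = \sum_(i <- t) F i.
Proof.
move=> us ut st F0; rewrite [RHS](bigID (mem s)) /= [X in _ + X]big1 ?addr0; last exact: F0.
rewrite -[RHS]big_filter; apply: perm_big; apply: uniq_perm; rewrite ?filter_uniq //.
by move=> j; rewrite mem_filter andb_idr // => /st.
Qed.

Lemma zmod_shuffle (Z : zmodType) (A B D E F : Z) :
  A + D + (E + F) - (B + D + E) = F + (A - B).
Proof.
apply/eqP; rewrite subr_eq; apply/eqP.
rewrite -(addrA B D E) (addrA _ B) -(addrA F (A - B)) subrK (addrC F A).
by rewrite -(addrA A D) (addrA D E) (addrC _ F) -(addrA A F).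
Qed.

(** * The commutator with L(0) and the truncation of modes *)

Section Weights.
Variables (R : realType) (V : voa R) (g : V -> V) (W : twisted_module g).
Local Notation C := R[i].
Hypothesis g_linear : linear g.
Hypothesis g_omega : g (voa_omega V) = voa_omega V.
Local Notation gdual := (graded_dual (@tm_gr _ _ _ W)).

Lemma finite_cover (P : set (lmono R)) : finite_set P ->
  exists ms : seq (lmono R), forall m, P m -> m \in ms.
Proof. by move=> /finite_seqP[ms ->]; exists ms. Qed.

(** Letting rho vary in [commutator_at] compares coefficients of exponential polynomials in log z_2.
    The factor z_2 shifts exponents by 1, and the L(-1)-derivative property turns the corresponding
    term into the last bracket. *)
Lemma L0_commutator v (w : W) r k :
  L0 (tm_Y v w (r, k)) = tm_Y v (L0 w) (r, k) + tm_Y (voa_L 0 v) w (r, k)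
    + (r *: tm_Y v w (r, k) + (k.+1)%:R *: tm_Y v w (r, k.+1)).
Proof.
apply/eqP; rewrite -subr_eq0; apply/eqP; apply: tm_separates => w' hw'.
have [ms1 h1] := finite_cover (tm_fin v w (gdual_L0 hw')).
have [ms2 h2] := finite_cover (tm_fin v (L0 w) hw').
have [ms3 h3] := finite_cover (tm_fin (voa_L 0 v) w hw').
have [ms4 h4] := finite_cover (tm_fin (voa_L (-1) v) w hw').
pose ms := undup (ms1 ++ ms2 ++ ms3 ++ ms4).
have cover (P : lmono R -> C) (t : seq (lmono R)) : {subset t <= ms} ->
    (forall m, P m != 0 -> m \in t) -> forall m, m \notin ms -> P m = 0.
  by move=> ts hP m hm; apply/eqP; apply: contraNT hm => /hP/ts.
have hA := cover _ ms1 _ h1; have hB := cover _ ms2 _ h2.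
have hC := cover _ ms3 _ h3; have hD := cover _ ms4 _ h4.
have {}hA := hA ltac:(by move=> m hm; rewrite mem_undup !mem_cat hm ?orbT).
have {}hB := hB ltac:(by move=> m hm; rewrite mem_undup !mem_cat hm ?orbT).
have {}hC := hC ltac:(by move=> m hm; rewrite mem_undup !mem_cat hm ?orbT).
have {}hD := hD ltac:(by move=> m hm; rewrite mem_undup !mem_cat hm ?orbT).
pose fA m := w' (L0 (tm_Y v w m)); pose fB m := w' (tm_Y v (L0 w) m).
pose fC m := w' (tm_Y (voa_L 0 v) w m); pose fD m := w' (tm_Y (voa_L (-1) v) w m).
pose up (m : lmono R) : lmono R := (m.1 + 1, m.2).
pose dn (m : lmono R) : lmono R := (m.1 - 1, m.2).
have upK : cancel up dn by case=> a b; rewrite /up /dn /= addrK.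
have dnK : cancel dn up by case=> a b; rewrite /up /dn /= subrK.
pose mt := undup (ms ++ map up ms).
have f0 : forall m, m \in mt -> fA m - fB m - fC m - fD (dn m) = 0.
  apply: mon_indep; first exact: undup_uniq.
  exists (pi%:C * 'i%C), 0 => x _; set l := _ + _.
  have := @commutator_at R V g W g_linear g_omega v w w' (expR x) ms hw' (expR_gt0 x)
    (undup_uniq _) hA hB hC hD.
  rewrite expRK [x%:C + _]addrC -/l -/fA -/fB -/fC -/fD.
  have hz : - (expR x)%:C = cexp l :> C.
    rewrite /l cexpD cexp_real; have -> : cexp (pi%:C * 'i%C) = -1 :> C.
      have -> : pi%:C * 'i%C = 0 +i* pi :> C by simpc.
      rewrite /cexp /= expR0 cospi sinpi !mul1r.
      by apply/eqP; rewrite eq_complex /= oppr0 !eqxx.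
    by rewrite mulN1r.
  rewrite hz => h.
  have ext F : (forall m, m \notin ms -> F m = 0) ->
      \sum_(m <- ms) F m * mon m l = \sum_(m <- mt) F m * mon m l.
    move=> F0; apply: sum_supp; [exact: undup_uniq|exact: undup_uniq| |].
      by move=> m hm; rewrite mem_undup mem_cat hm.
    by move=> m /F0 ->; rewrite mul0r.
  have extD : cexp l * \sum_(m <- ms) fD m * mon m l = \sum_(m <- mt) fD (dn m) * mon m l.
    rewrite mulr_sumr.
    transitivity (\sum_(m <- map up ms) fD (dn m) * mon m l).
      rewrite big_map; apply: eq_bigr => m _; rewrite upK mulrCA; congr (_ * _).
      by rewrite /mon /up /= mulrDl mul1r [cexp (m.1 * l + l)]cexpD; ring.
    apply: sum_supp; [|exact: undup_uniq| |].
    - by rewrite map_inj_uniq ?undup_uniq //; exact: can_inj upK.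
    - by move=> m hm; rewrite mem_undup mem_cat hm orbT.
    move=> m hm; rewrite /fD hD ?mul0r //; apply: contra hm => hm.
    by rewrite -(dnK m) map_f.
  move: h; rewrite extD (ext fA hA) (ext fB hB) (ext fC hC) => /eqP.
  rewrite -subr_eq0 => /eqP h; rewrite -[RHS]h.
  transitivity (\sum_(m <- mt) fA m * mon m l - \sum_(m <- mt) fB m * mon m l
     - \sum_(m <- mt) fC m * mon m l - \sum_(m <- mt) fD (dn m) * mon m l).
    by rewrite -!sumrB; apply: eq_bigr => m _; ring.
  by ring.
have f0' m : fA m - fB m - fC m - fD (dn m) = 0.
  case: (boolP (m \in mt)) => [/f0 //|]; rewrite mem_undup mem_cat negb_or => /andP[n1 n2].
  have -> : fA m = 0 by exact: hA.
  have -> : fB m = 0 by exact: hB.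
  have -> : fC m = 0 by exact: hC.
  have -> : fD (dn m) = 0; last by rewrite !subr0.
  by apply: hD; apply: contra n2 => hm; rewrite -(dnK m) map_f.
have := f0' (r, k); rewrite /fA /fB /fC /fD /dn /=.
rewrite -tm_derivative /fderiv /= subrK !(scalB hw'.1) !(scalD hw'.1) => h.
by rewrite -[RHS]h; ring.
Qed.

(** Induction on the order of nilpotency of L(0) - a on [w], and descending on the power k of log x:
    by the commutator, L(0) - (a + n + r) sends the mode of index k to a multiple of the mode k + 1
    plus the mode k applied to (L(0) - a) w. *)
Lemma gr_modes v (n : int) (w : W) (a : C) r k : voa_gr n v -> tm_gr a w ->
  tm_gr (a + n%:~R + r) (tm_Y v w (r, k)).
Proof.
move=> hv /tm_grP[p]; elim: p w r k => [|p IH] w r k.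
  move=> /= ->; rewrite (lin0 (tm_linr v (r, k))).
  exact: (gr_sub (@tm_fin_dim _ _ _ W) _).1.
rewrite iterSr => hp.
have [K hK] := tm_log v w.
have step j : tm_gr (a + n%:~R + r) (tm_Y v w (r, j.+1)) ->
    tm_gr (a + n%:~R + r) (tm_Y v w (r, j)).
  move=> h1; have : tm_gr (a + n%:~R + r) (L0sub (a + n%:~R + r) (tm_Y v w (r, j))).
    have -> : L0sub (a + n%:~R + r) (tm_Y v w (r, j)) =
        (j.+1)%:R *: tm_Y v w (r, j.+1) + tm_Y v (L0sub a w) (r, j).
      rewrite /L0sub L0_commutator (voa_L0 hv) (linZ (tm_linl w (r, j))).
      rewrite (linD (tm_linr v (r, j))) -[- (a *: w)]scaleNr (linZ (tm_linr v (r, j))).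
      rewrite scaleNr !scalerDl; exact: zmod_shuffle.
    by apply: (gr_sub (@tm_fin_dim _ _ _ W) _).2 => //; exact: IH.
  by move=> /tm_grP[q hq]; apply/tm_grP; exists q.+1; rewrite iterSr.
have base j : tm_gr (a + n%:~R + r) (tm_Y v w (r, (K.+1 + j)%N)).
  rewrite hK ?ltn_addr //; exact: (gr_sub (@tm_fin_dim _ _ _ W) _).1.
have [kK|kK] := leqP K.+1 k; first by rewrite -(subnKC kK).
have : forall i, (i <= K.+1)%N -> tm_gr (a + n%:~R + r) (tm_Y v w (r, (K.+1 - i)%N)).
  elim=> [_|i IHi iK]; first by rewrite subn0 -[K.+1]addn0.
  by apply: step; rewrite -subSn // subSS; apply: IHi; exact: ltnW.
by move=> /(_ (K.+1 - k)%N (leq_subr _ _)); rewrite subKn // ltnW.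
Qed.

Lemma voa_ind (P : V -> Prop) : (forall n v, voa_gr n v -> P v) ->
  P 0 -> (forall x y, P x -> P y -> P (x + y)) -> forall v, P v.
Proof.
move=> h1 h0 hD v; have [s [f [hf ->]]] := (voa_direct V).1 v.
by elim/big_ind: _ => // i _; exact: h1 (hf i).
Qed.

Lemma tm_ind (P : W -> Prop) : (forall n w, tm_gr n w -> P w) ->
  P 0 -> (forall x y, P x -> P y -> P (x + y)) -> forall w, P w.
Proof.
move=> h1 h0 hD w; have [s [f [hf ->]]] := (@tm_direct _ _ _ W).1 w.
by elim/big_ind: _ => // i _; exact: h1 (hf i).
Qed.

Lemma gr_lower_nat (a : C) : exists N : nat, forall j, (N <= j)%N ->
  forall w, @tm_gr _ _ _ W (a - j%:R) w -> w = 0.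
Proof.
have [l0 hl] := @tm_gr_lower _ _ _ W a; exists `|l0|.+1 => j hj w.
have -> : a - j%:R = a + (- j%:Z)%:~R by rewrite mulrNz -pmulrn.
by rewrite hl => [-> //|]; lia.
Qed.

Lemma modes_lower v (w : W) r : exists N : nat, forall j k, (N <= j)%N ->
  tm_Y v w (r - j%:R, k) = 0.
Proof.
move: v; apply: voa_ind => [n v hv||x y [N hN] [M hM]]; last first.
- exists (maxn N M) => j k; rewrite geq_max => /andP[n1 n2].
  by rewrite (linD (tm_linl w _)) hN // hM // addr0.
- by exists 0%N => j k _; rewrite (lin0 (tm_linl w _)).
move: w; apply: tm_ind => [a w hw||x y [N hN] [M hM]]; last first.
- exists (maxn N M) => j k; rewrite geq_max => /andP[n1 n2].
  by rewrite (linD (tm_linr v _)) hN // hM // addr0.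
- by exists 0%N => j k _; rewrite (lin0 (tm_linr v _)).
have [N hN] := gr_lower_nat (a + n%:~R + r); exists N => j k /hN; apply.
by rewrite -addrA; exact: gr_modes.
Qed.

Lemma gdualD w1 w2 : gdual w1 -> gdual w2 -> gdual (fun w => w1 w + w2 w).
Proof.
move=> [s1 [t1 h1]] [s2 [t2 h2]]; split.
  by move=> a x y; rewrite s1 s2; ring.
exists (t1 ++ t2) => n; rewrite mem_cat negb_or => /andP[n1 n2] w hw.
by rewrite (h1 n) // (h2 n) // addr0.
Qed.

Lemma gdual_mode v m w' : gdual w' -> gdual (fun w => w' (tm_Y v w m)).
Proof.
move=> hw'; move: v; apply: voa_ind => [n v hv||x y hx hy].
- split; first exact: (scalar_comp hw'.1 (tm_linr v m)).
  have [s hs] := hw'.2; exists [seq c - n%:~R - m.1 | c <- s] => a ha w hw.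
  case: m ha => r k ha; apply: (hs (a + n%:~R + r)); last exact: gr_modes.
  by apply: contra ha => h; apply/mapP; exists (a + n%:~R + r) => //=; ring.
- split; first by move=> a x y; rewrite !(lin0 (tm_linl _ m)) (scal0 hw'.1) mulr0 addr0.
  by exists [::] => a _ w _; rewrite (lin0 (tm_linl _ m)) (scal0 hw'.1).
have := gdualD hx hy; congr gdual; apply/funext => w.
by rewrite (linD (tm_linl w m)) (scalD hw'.1).
Qed.

(** The functional sees finitely many weights c, and W_[c - n - r - j] = 0 for all of them once j is
    large. The bound is uniform in [w]. *)
Lemma modes_upper v w' r : gdual w' -> exists N : nat, forall j k (w : W), (N <= j)%N ->
  w' (tm_Y v w (r + j%:R, k)) = 0.
Proof.
move=> hw'; move: v; apply: voa_ind => [n v hv||x y [N hN] [M hM]]; last first.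
- exists (maxn N M) => j k w; rewrite geq_max => /andP[n1 n2].
  by rewrite (linD (tm_linl w _)) (scalD hw'.1) hN // hM // addr0.
- by exists 0%N => j k w _; rewrite (lin0 (tm_linl w _)) (scal0 hw'.1).
have [s hs] := hw'.2.
have [N hN] : exists N : nat, forall j c, (N <= j)%N -> c \in s ->
    forall w, @tm_gr _ _ _ W (c - n%:~R - r - j%:R) w -> w = 0.
  elim: s {hs} => [|c s [N hN]]; first by exists 0%N.
  have [M hM] := gr_lower_nat (c - n%:~R - r); exists (maxn N M) => j c'.
  rewrite geq_max inE => /andP[n1 n2] /orP[/eqP ->|cs]; [exact: hM | exact: hN].
exists N => j k w hj; move: w; apply: tm_ind => [a w hw||x y hx hy]; last first.
- by rewrite (linD (tm_linr v _)) (scalD hw'.1) hx hy addr0.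
- by rewrite (lin0 (tm_linr v _)) (scal0 hw'.1).
case: (boolP (a + n%:~R + (r + j%:R) \in s)) => hin; last first.
  by apply: (hs _ hin); exact: gr_modes.
have -> : w = 0 by apply: (hN j _ hj hin); move: hw; congr tm_gr; ring.
by rewrite (lin0 (tm_linr v _)) (scal0 hw'.1).
Qed.

End Weights.

(** * Logarithms of automorphisms *)

Section Logarithm.
Variables (R : realType) (V : voa R) (g S N : V -> V).
Local Notation C := R[i].
Hypotheses (g_linear : linear g) (hL : is_log g S N).

Lemma iter_linear (f : V -> V) n : linear f -> linear (iter n f).
Proof. by move=> hf; elim: n => [|n IH] a x y //=; rewrite IH hf. Qed.

Let S_linear : linear S. Proof. by have [[]] := hL. Qed.
Let N_linear : linear N. Proof. by have [[]] := hL. Qed.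

Lemma log_nil v : exists m : nat, iter m N v = 0.
Proof. by have [_ _ [h _] _ _] := hL; exact: h. Qed.

Lemma log_comm a k v : S v = a *: v -> S (iter k N v) = a *: iter k N v.
Proof.
move=> hv; have [_ _ [_ h] _ _] := hL.
by elim: k => [//|k IH]; rewrite iterS h IH (linZ N_linear).
Qed.

Lemma log_exp a v m : S v = a *: v -> iter m N v = 0 -> g v = cexp (twopii R * a) *:
  \sum_(k < m) (twopii R ^+ k / (k`!)%:R) *: iter k N v.
Proof. by have [_ _ _ _ h] := hL; exact: h. Qed.

Lemma log_eigenspace a v : S v = a *: v -> S (g v) = a *: g v.
Proof.
move=> hv; have [m hm] := log_nil v; rewrite (log_exp hv hm).
rewrite (linZ S_linear) (lin_sum _ _ _ S_linear) scalerA [a * _]mulrC -scalerA; congr (_ *: _).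
rewrite scaler_sumr; apply: eq_bigr => k _.
by rewrite (linZ S_linear) (log_comm _ hv) !scalerA mulrC.
Qed.

(** Apply N^q with q largest such that N^q v is nonzero: only the term k = 0 of the exponential of 2
    pi i N survives. *)
Lemma log_eigenvalue a mu v : S v = a *: v -> g v = mu *: v -> v != 0 ->
  mu = cexp (twopii R * a).
Proof.
move=> hv gv v0; have ex : exists m, iter m N v == 0.
  by have [m hm] := log_nil v; exists m; apply/eqP.
case: (ex_minnP ex) => [[|q]] /eqP hq qmin; first by rewrite /= in hq; rewrite hq eqxx in v0.
have Nq : iter q N v != 0 by apply/negP => /qmin; rewrite ltnn.
have lq := iter_linear q N_linear.
have e : mu *: iter q N v = cexp (twopii R * a) *: iter q N v.
  rewrite -(linZ lq) -gv (log_exp hv hq) (linZ lq) (lin_sum _ _ _ lq); congr (_ *: _).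
  rewrite big_ord_recl big1 ?addr0 => [|k _].
    by rewrite expr0 fact0 divr1 scale1r.
  rewrite (linZ lq) -iterD /= (_ : (q + bump 0 k)%N = (k + q.+1)%N); last by rewrite /bump; lia.
  by rewrite iterD hq (lin0 (iter_linear k N_linear)) scaler0.
apply/eqP; rewrite -subr_eq0; move/eqP: e; rewrite -subr_eq0 -scalerBl scaler_eq0.
by rewrite (negbTE Nq) orbF.
Qed.

Lemma log_shift a mu v : S v = a *: v -> S (g v - mu *: v) = a *: (g v - mu *: v).
Proof.
move=> hv; rewrite -scaleNr (linD S_linear) (linZ S_linear) (log_eigenspace hv) hv.
by rewrite scalerDr !scalerA mulrC.
Qed.

Lemma log_gen_eigenvalue m a mu v : S v = a *: v -> cexp (twopii R * a) != mu ->
  iter m (fun x => g x - mu *: x) v = 0 -> v = 0.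
Proof.
move=> + hmu; elim: m v => [//|m IH] v hv; rewrite iterSr => /IH h.
apply: contrapT => /eqP v0; move/eqP: hmu; apply; apply: esym; apply: (log_eigenvalue hv _ v0).
apply/eqP; rewrite -subr_eq0; apply/eqP/h; exact: log_shift.
Qed.

(** By directness each S-component of [u] is a generalized eigenvector of [g]. A nonzero component
    of S-eigenvalue i then satisfies e^(2 pi i i) = e^(2 pi i alpha), and real parts in [0, 1) force
    i = alpha. *)
Lemma eigen_of_gen alpha u : 0 <= complex.Re alpha < 1 ->
  gen_eigenspace g (cexp (twopii R * alpha)) u -> S u = alpha *: u.
Proof.
move=> ha [m hm]; have [_ [dir1 dir2] _ hRe _] := hL.
have [s [f [hf eu]]] := dir1 u.
pose f' i := \sum_(c <- s | c == i) f c.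
have hf' i : S (f' i) = i *: f' i.
  rewrite /f' (lin_sum _ _ _ S_linear) scaler_sumr.
  by apply: eq_bigr => c /eqP <-; exact: hf.
have eu' : u = \sum_(i <- undup s) f' i.
  rewrite eu; apply: (sum_by_key (key := id)); first exact: undup_uniq.
  by move=> c; rewrite mem_undup.
set D := fun v : V => _ in hm.
have linDD : linear D.
  by move=> a x y; rewrite /D g_linear scalerDr scalerBr !scalerA opprD addrACA [_ * a]mulrC.
have SD k i : S (iter k D (f' i)) = i *: iter k D (f' i).
  elim: k => [|k IH] /=; first exact: hf'.
  exact: log_shift.
have z i : i \in undup s -> iter m D (f' i) = 0.
  apply: (dir2 (undup s) (fun i => iter m D (f' i))); first exact: undup_uniq.
    by move=> j; exact: SD.
  have lm := iter_linear m linDD.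
  by rewrite -[RHS]hm [in RHS]eu' (lin_sum _ _ _ lm).
rewrite eu' (lin_sum _ _ _ S_linear) scaler_sumr; apply: eq_big_seq => i hi.
rewrite hf'; case: (eqVneq (cexp (twopii R * i)) (cexp (twopii R * alpha))) => [e|ne]; last first.
  by rewrite (log_gen_eigenvalue (hf' i) ne (z i hi)) !scaler0.
case: (eqVneq (f' i) 0) => [->|fi0]; first by rewrite !scaler0.
have := hRe _ _ (hf' i) fi0.
have : cexp (twopii R * (i - alpha)) = 1.
  by rewrite mulrBr cexpD e -cexpD subrr cexp0.
move=> /cexp_twopiiM[n hn].
have -> : i = alpha + n%:~R by rewrite -hn addrC subrK.
rewrite -(rmorph_int (real_complex R)).
have -> : complex.Re (alpha + (n%:~R)%:C) = complex.Re alpha + n%:~R by case: (alpha).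
have aux (x y : R) : 0 <= x < 1 -> 0 <= x + y < 1 -> -1 < y < 1.
  by move=> /andP[? ?] /andP[? ?]; apply/andP; split; lra.
move=> /(aux _ _ ha)/andP[n1 n2].
have -> : n = 0.
  have m1 : (-1 : int) < n by rewrite -(ltr_int R) rmorphN.
  have m2 : n < (1 : int) by rewrite -(ltr_int R).
  by lia.
by rewrite addr0.
Qed.

End Logarithm.

(** * The log-free part of a vertex operator *)

Section ChainModes.
Variables (R : realType) (V : voa R) (g : V -> V) (W : twisted_module g).
Local Notation C := R[i].
Variables (d : nat) (alpha : C) (v_ : nat -> V).
Hypothesis v_0 : forall j, (d <= j)%N -> v_ j = 0.
Hypothesis g_v : forall j, g (v_ j) = cexp (twopii R * alpha) *:
  \sum_(k < d) (twopii R ^+ k / (k`!)%:R) *: v_ (j + k)%N.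

(* This expresses Y_W(u, x) = Y_(W,0)(x^(- N) u, x). *)
Lemma chain_modes (w : W) r j k :
  tm_Y (v_ j) w (r, k) = ((-1) ^+ k / k`!%:R) *: tm_Y (v_ (j + k)%N) w (r, 0%N).
Proof.
apply/eqP; rewrite -subr_eq0; apply/eqP/(@tm_separates _ _ _ W) => w' hw'.
rewrite (scalB hw'.1) (scalZ hw'.1).
have [K hK] := chain_log_bound v_0 w.
pose LP s := log_poly w w' K r (v_ s).
have Phi s : \sum_(i < d) ('X ^+ i * (i`!%:R^-1)%:P) * LP (s + i)%N =
    (w' (tm_Y (v_ s) w (r, 0%N)))%:P.
  have v0s i : (d <= i)%N -> v_ (s + i)%N = 0 by move=> h; apply: v_0; lia.
  have gs i : g (v_ (s + i)%N) = cexp (twopii R * alpha) *: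
      \sum_(k < d) (twopii R ^+ k / (k`!)%:R) *: v_ (s + (i + k))%N.
    by rewrite g_v; congr (_ *: _); apply: eq_bigr => a _; rewrite addnA.
  have [] := @chain_poly _ _ _ W d alpha (fun i => v_ (s + i)%N) v0s gs w w' hw' K r (fun i => hK _).
  by rewrite addn0.
have LP0 s : (d <= s)%N -> LP s = 0.
  move=> h; apply/polyP => i; rewrite coef_poly coef0 v_0 // (lin0 (tm_linl w _)).
  by rewrite (scal0 hw'.1) if_same.
pose Q := \sum_(a < d) ((-1) ^+ a / a`!%:R * w' (tm_Y (v_ (j + a)%N) w (r, 0%N))) *: 'X^a.
(* Equality is tested at the natural numbers x. Evaluating [exp_chain] with c = x at X = - x
   annihilates (X + c)^i for i > 0, which inverts the relation [Phi]. *)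
have LPQ : LP j = Q.
  apply/eqP; rewrite -subr_eq0; apply/eqP/(@poly_natmul_roots R _ 1 (oner_neq0 _)) => n.
  set x := _ * 1; apply/eqP; rewrite hornerD hornerN subr_eq0; apply/eqP.
  have F0 i : (d <= i)%N -> ((LP (j + i)%N).[x])%:P = 0 :> {poly C}.
    by move=> h; rewrite LP0 ?horner0 //; lia.
  have := @exp_chain R d x (fun i => ((LP (j + i)%N).[x])%:P) F0.
  move=> /(congr1 (fun P : {poly C} => P.[- x])); rewrite !horner_sum.
  have -> : \sum_(i < d) ((('X + x%:P) ^+ i * (i`!%:R^-1)%:P) * ((LP (j + i)%N).[x])%:P).[- x]
      = (LP j).[x].
    case: (d) LP0 => [|d'] LP0'.
      by rewrite big_ord0 LP0' ?horner0.
    rewrite big_ord_recl big1 ?addr0 => [|i _].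
      by rewrite expr0 mul1r hornerM !hornerC fact0 invr1 mul1r addn0.
    by rewrite !hornerM horner_exp hornerD hornerX hornerC addNr exprS mul0r !mul0r.
  move=> ->; apply: eq_bigr => a _.
  rewrite hornerM [RHS]hornerZ hornerM !hornerXn hornerC horner_sum.
  have := congr1 (fun P : {poly C} => P.[x]) (Phi (j + a)%N); rewrite hornerC => <-.
  rewrite horner_sum [in RHS]mulrAC !mulr_sumr; apply: eq_bigr => b _.
  rewrite !hornerM hornerXn hornerZ !hornerC addnA [(- x) ^+ a]exprNn.
  by ring.
have := congr1 (fun P : {poly C} => P`_k) LPQ; rewrite /LP coef_poly.
have -> : (if (k < K)%N then w' (tm_Y (v_ j) w (r, k)) else 0) = w' (tm_Y (v_ j) w (r, k)).
  by case: ltnP => // h; rewrite hK // (scal0 hw'.1).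
move=> ->; rewrite coef_sum; have [kd|kd] := ltnP k d; last first.
  rewrite v_0 ?(lin0 (tm_linl w _)) ?(scal0 hw'.1) ?mulr0 ?subr0; last by lia.
  apply: big1 => a _; rewrite coefZ coefXn (_ : k == a = false) ?mulr0 //.
  by apply/negbTE; rewrite gtn_eqF // (leq_trans (ltn_ord a)).
rewrite (bigD1 (Ordinal kd)) //= big1 ?addr0 => [|a ak].
  by rewrite coefZ coefXn eqxx mulr1 subrr.
by rewrite coefZ coefXn eq_sym (_ : _ == _ = false) ?mulr0 //; apply/negbTE; rewrite -val_eqE in ak.
Qed.

Lemma chain_mode0 (w : W) r j k : tm_Y (v_ j) w (r, k) <> 0 ->
  (j + k < d)%N /\ exists n : int, r = n%:~R - alpha.
Proof.
rewrite chain_modes => h; split.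
  rewrite ltnNge; apply/negP => /v_0 e; apply: h.
  by rewrite e (lin0 (tm_linl w _)) scaler0.
have {}h : tm_Y (v_ (j + k)%N) w (r, 0%N) <> 0 by move=> e; apply: h; rewrite e scaler0.
have [w' [hw' hw'm]] : exists w', graded_dual (@tm_gr _ _ _ W) w' /\ w' (tm_Y (v_ (j + k)%N) w (r, 0%N)) <> 0.
  apply: contra_notP h => h; apply: tm_separates => w' hw'.
  by apply: contrapT => hh; apply: h; exists w'.
have [K hK] := chain_log_bound v_0 w.
have v0s i : (d <= i)%N -> v_ (j + k + i)%N = 0 by move=> ?; apply: v_0; lia.
have gs i : g (v_ (j + k + i)%N) = cexp (twopii R * alpha) *:
    \sum_(a < d) (twopii R ^+ a / (a`!)%:R) *: v_ (j + k + (i + a))%N.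
  by rewrite g_v; congr (_ *: _); apply: eq_bigr => a _; rewrite addnA.
have [_] := @chain_poly _ _ _ W d alpha (fun i => v_ (j + k + i)%N) v0s gs w w' hw' K r (fun i => hK _).
rewrite addn0 => /(_ (introN eqP hw'm))[n hn]; exists n; by rewrite -hn addrK.
Qed.

Lemma chain_sum (w : W) (w' : W -> C) r l : graded_dual (@tm_gr _ _ _ W) w' ->
  \sum_(k < d) \sum_(j < d) l ^+ j / j`!%:R * (w' (tm_Y (v_ j) w (r, (k : nat))) * l ^+ k)
  = w' (tm_Y (v_ 0%N) w (r, 0%N)).
Proof.
move=> hw'.
have hK j r' k : (d <= k)%N -> tm_Y (v_ j) w (r', k) = 0.
  by move=> dk; apply: contrapT => /chain_mode0[]; lia.
have [/(congr1 (fun P : {poly C} => P.[l])) + _] := chain_poly v_0 g_v hw' r hK.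
rewrite hornerC => <-; rewrite horner_sum exchange_big /=; apply: eq_bigr => j _.
rewrite !hornerM hornerXn hornerC /log_poly horner_poly mulr_sumr.
by apply: eq_bigr => k _; ring.
Qed.

End ChainModes.

(** * Branches of correlation functions *)

Section CorrelationBranches.
Variable R : realType.
Local Notation C := R[i].

(** A turn about the origin multiplies a term by its ratio and adds 2 pi i to the logarithm. If the
    total is constant in p, [geom_poly_indep] leaves only the ratio 1 without logarithm; the
    constant G is counted with the ratio 1. *)
Lemma geom_keys (cs : seq (C * (C * nat))) (b G : C) :
  (forall t, t \in cs -> t.2.1 != 0) ->
  (forall p : nat, \sum_(t <- cs) t.1 * t.2.1 ^+ p * (b + p%:R * twopii R) ^+ t.2.2 = G) ->
  forall key, key != (1, 0%N) -> \sum_(t <- cs | t.2 == key) t.1 = 0.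
Proof.
move=> cs0 hG [lam l] hkey.
pose P r : {poly C} := \sum_(t <- cs | t.2.1 == r) t.1 *: 'X^(t.2.2) - (if r == 1 then G else 0)%:P.
pose L : {poly C} := b%:P + twopii R *: 'X.
pose rs := undup (1 :: map (fun t : C * (C * nat) => t.2.1) cs).
have rs1 : 1 \in rs by rewrite mem_undup inE eqxx.
have key_rs t : t \in cs -> t.2.1 \in rs.
  by move=> ht; rewrite mem_undup inE (map_f (fun t : C * (C * nat) => t.2.1) ht) orbT.
have Q0 : forall r, r \in rs -> P r \Po L = 0.
  apply: geom_poly_indep; first exact: undup_uniq.
    rewrite mem_undup inE eq_sym oner_eq0 /=; apply/mapP => -[t ht e0].
    by move: (cs0 t ht); rewrite -e0 eqxx.
  move=> p; have hL : L.[p%:R] = b + p%:R * twopii R.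
    by rewrite /L hornerD hornerC hornerZ hornerX mulrC.
  transitivity (\sum_(r <- rs) \sum_(t <- cs | t.2.1 == r) t.1 * t.2.1 ^+ p * (b + p%:R * twopii R) ^+ t.2.2
      - \sum_(r <- rs) (if r == 1 then G else 0)).
    rewrite -sumrB; apply: eq_bigr => r _.
    rewrite horner_comp hL /P hornerD hornerN hornerC mulrBr horner_sum mulr_sumr; congr (_ - _).
      by apply: eq_bigr => t /eqP ->; rewrite hornerZ hornerXn mulrCA mulrA.
    by case: eqP => [->|_]; rewrite ?expr1n ?mul1r ?mulr0.
  rewrite -(sum_by_key (fun t : C * (C * nat) => t.1 * t.2.1 ^+ p * (b + p%:R * twopii R) ^+ t.2.2)
     (undup_uniq _) key_rs) hG (bigD1_seq 1) ?undup_uniq //= eqxx big1 ?addr0 ?subrr //.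
  by move=> r /negbTE ->.
have [lrs|lrs] := boolP (lam \in rs); last first.
  rewrite big_seq_cond big1 // => t /andP[ht /eqP e]; move: lrs.
  by rewrite (_ : lam = t.2.1) ?key_rs // e.
have P0 : P lam = 0.
  have := congr1 (fun Q => Q \Po ((twopii R)^-1 *: ('X - b%:P))) (Q0 _ lrs).
  have -> : (P lam \Po L) \Po ((twopii R)^-1 *: ('X - b%:P)) = P lam.
    rewrite -comp_polyA (_ : L \Po _ = 'X) ?comp_polyXr // /L comp_polyD comp_polyC comp_polyZ.
    by rewrite comp_polyX scalerA mulfV ?twopii_neq0 // scale1r addrC subrK.
  by rewrite comp_poly0.
have := congr1 (fun Q : {poly C} => Q`_l) P0; rewrite coef0 coefB coef_sum coefC => h.
rewrite -[RHS]h [X in _ = _ - X](_ : _ = 0) ?subr0; last first.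
  by case: eqP => // l0; case: eqP => // l1; move: hkey; rewrite l0 l1 eqxx.
rewrite big_mkcond [RHS]big_mkcond /=; apply: eq_bigr => -[a [r k]] _ /=.
rewrite coefZ coefXn xpair_eqE; case: (r == lam) => //=.
by rewrite eq_sym; case: (l == k); rewrite ?mulr1 ?mulr0.
Qed.

(** This is s - sigma when e^(2 pi i s) = e^(2 pi i sigma); otherwise the value has no meaning. *)
Definition zshift (s sigma : C) : int := Num.floor (complex.Re (s - sigma)).

Lemma cexp_zshift (s sigma l : C) (K : nat) :
  cexp (twopii R * s) = cexp (twopii R * sigma) -> (absz (zshift s sigma) <= K)%N ->
  cexp (s * l) = cexp (sigma * l) * cexp l ^- K * cexp l ^+ absz (zshift s sigma + K%:Z).
Proof.
move=> e hK; have : cexp (twopii R * (s - sigma)) = 1.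
  by rewrite mulrBr cexpD e -cexpD subrr cexp0.
move=> /cexp_twopiiM[n hn].
have zn : zshift s sigma = n.
  by rewrite /zshift hn -(rmorph_int (real_complex R)) /= intrKfloor.
rewrite zn in hK *; rewrite (_ : s = sigma + n%:~R); last by rewrite -hn addrC subrK.
rewrite mulrDl cexpD cexpMz -mulrA; congr (_ * _).
have h : (absz (n + K%:Z))%:Z = n + K by lia.
have c0 := cexp_neq0 l.
by rewrite [cexp l ^+ absz _]exprnP h [cexp l ^- K]exprnN -expfzDr // addrCA addNr addr0.
Qed.

Variables (ts : seq (C * (lmono R * lmono R))) (rho : R).
Hypothesis rho0 : 0 < rho.
Let term (t : C * (lmono R * lmono R)) l0 l1 := t.1 * (mon t.2.1 l0 * mon t.2.2 l1).
Let H l0 l1 := \sum_(t <- ts) term t l0 l1.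
Let key (t : C * (lmono R * lmono R)) : C * nat := (cexp (twopii R * t.2.2.1), t.2.2.2).
Let bpi : C := pi%:C * 'i%C.

(** Here z_1 = - tau and z_0 = rho - tau: no dependence on the branch of log z_1 when |z_1| < |z_2|.
    In [branch3], z_0 = x and z_1 = x - rho: no change under a turn of z_0 about 0. *)
Hypothesis branch2 : forall tau : R, 0 < tau < rho -> exists G, forall p : nat,
  H (ln (rho - tau))%:C ((ln tau)%:C + bpi + p%:R * twopii R) = G.
Hypothesis branch3 : forall x : R, 0 < x < rho ->
  H ((ln x)%:C + twopii R) ((ln (rho - x))%:C + bpi) = H (ln x)%:C ((ln (rho - x))%:C + bpi).

Lemma cexp_bpi : cexp bpi = -1 :> C.
Proof.
have -> : bpi = 0 +i* pi :> C by rewrite /bpi; simpc.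
rewrite /cexp /= expR0 cospi sinpi !mul1r.
by apply/eqP; rewrite eq_complex /= oppr0 !eqxx.
Qed.

Lemma cexp_ln (x : R) : 0 < x -> cexp (ln x)%:C = x%:C :> C.
Proof. by move=> x0; rewrite cexp_real lnK. Qed.

(* The terms with a given value of e^(2 pi i s) and a given power of l1 form an  *)
(* eigenvector of the shift l1 -> l1 + 2 pi i up to lower powers of l1.          *)
Lemma branch_keys kk l0 l1 : kk != (1, 0%N) -> cexp l1 = cexp l0 - rho%:C ->
  \sum_(t <- ts | key t == kk) term t l0 l1 = 0.
Proof.
move=> hkk h01.
have [/hasP[ta hta /eqP ka]|/hasPn hn] := boolP (has (fun t => key t == kk) ts); last first.
  by rewrite big_seq_cond big1 // => t /andP[/hn/negbTE ->].
pose sg := ta.2.2.1.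
pose n (t : C * (lmono R * lmono R)) := zshift t.2.2.1 sg : int.
pose K := (\sum_(t <- ts) absz (n t))%N.
have nK t : t \in ts -> (absz (n t) <= K)%N.
  by move=> ht; rewrite /K (big_rem t) //= leq_addr.
have ksg t : key t == kk -> cexp (twopii R * t.2.2.1) = cexp (twopii R * sg) /\ t.2.2.2 = kk.2.
  by move=> /eqP e; split; [move: (congr1 fst ka); rewrite -e /= => -> | rewrite -e].
(* On the curve z_1 = z_0 - rho the exponents of z_1 in this class differ from [sg] by integers of
   modulus at most K; once z_1^(sg - K) is taken out, polynomials in z_0 = e^l remain. *)
pose Phi l := \sum_(t <- ts | key t == kk)
  t.1 * mon t.2.1 l * (cexp l - rho%:C) ^+ absz (n t + K%:Z).
have hterm l l' : cexp l' = cexp l - rho%:C -> \sum_(t <- ts | key t == kk) term t l l' =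
    cexp (sg * l') * cexp l' ^- K * l' ^+ kk.2 * Phi l.
  move=> hl; rewrite /Phi mulr_sumr big_seq_cond [RHS]big_seq_cond.
  apply: eq_bigr => t /andP[ht /ksg[k1 k2]].
  rewrite /term {2}/mon k2 (@cexp_zshift _ sg l' K k1 (nK t ht)) -hl -/(n t); ring.
rewrite hterm // (_ : Phi l0 = 0) ?mulr0 //.
have ePhi : exppoly Phi.
  apply: exppoly_sum => t; apply: exppolyM; first exact: exppolyM (exppolyC _) (exppoly_mon _).
  apply: exppolyX; apply: exppolyD (exppolyC _).
  by apply: eq_exppoly (exppoly_cexp 1) => l; rewrite mul1r.
move: l0 {h01}; apply: (exppoly_eq0 ePhi); exists 0, (ln rho) => x xr; rewrite add0r.
pose tau := rho - expR x.
have ex0 := expR_gt0 x.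
have xrho : expR x < rho by rewrite -(lnK (x := rho)) ?posrE // ltr_expR.
have tau0 : 0 < tau < rho by rewrite subr_gt0 xrho ltrBlDr ltrDl.
have [G hG] := branch2 tau0.
have etau : (ln (rho - tau))%:C = x%:C :> C by rewrite subKr expRK.
rewrite etau in hG; set b := (ln tau)%:C + bpi in hG.
have eb : cexp b = cexp x%:C - rho%:C.
  rewrite cexpD cexp_bpi cexp_ln ?(andP tau0).1 // mulrN1 cexp_real /tau rmorphB /=; ring.
(* With z_0 fixed, the branches of log z_1 isolate this class of terms. *)
have zero : \sum_(t <- ts | key t == kk) term t x%:C b = 0.
  pose cs := [seq (t.1 * mon t.2.1 x%:C * cexp (t.2.2.1 * b), key t) | t <- ts].
  have cs0 t : t \in cs -> t.2.1 != 0.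
    by move=> /mapP[t' _ ->]; rewrite /= cexp_neq0.
  have hcs p : \sum_(t <- cs) t.1 * t.2.1 ^+ p * (b + p%:R * twopii R) ^+ t.2.2 = G.
    rewrite -(hG p) big_map; apply: eq_bigr => t _; rewrite /term /=.
    have -> : mon t.2.2 (b + p%:R * twopii R) = cexp (t.2.2.1 * b)
        * cexp (twopii R * t.2.2.1) ^+ p * (b + p%:R * twopii R) ^+ t.2.2.2.
      by rewrite /mon mulrDr cexpD -cexpMn; congr (_ * cexp _ * _); ring.
    by ring.
  have := geom_keys cs0 hcs hkk; rewrite big_map /= => h.
  transitivity (b ^+ kk.2 * \sum_(t <- ts | key t == kk) t.1 * mon t.2.1 x%:C * cexp (t.2.2.1 * b)).
    by rewrite mulr_sumr; apply: eq_bigr => t /ksg[_ k2]; rewrite /term {2}/mon k2; ring.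
  by rewrite h mulr0.
(* Its imaginary part is pi, so the power of the logarithm can be divided out. *)
have b0 : b != 0.
  apply/eqP => /(congr1 (@complex.Im R)); rewrite /b /bpi; simpc => /= /eqP.
  by rewrite gt_eqF ?pi_gt0.
move/eqP: zero; rewrite hterm // !mulf_eq0 expf_eq0 (negbTE b0) andbF orbF.
by rewrite (negbTE (cexp_neq0 _)) invr_eq0 expf_eq0 (negbTE (cexp_neq0 _)) andbF => /eqP.
Qed.

(** Only the class (1, 0) survives, so that H = z_1^-K Phi(l0) on the curve, with Phi an exponential
    polynomial; [branch3] makes Phi periodic. *)
Lemma branch_rational : exists (K J : nat) (P : {poly C}), forall l0 l1,
  cexp l1 = cexp l0 - rho%:C -> H l0 l1 = cexp l1 ^- K * P.[cexp l0] * cexp l0 ^- J.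
Proof.
pose n (t : C * (lmono R * lmono R)) := zshift t.2.2.1 0 : int.
pose K := (\sum_(t <- ts) absz (n t))%N.
have nK t : t \in ts -> (absz (n t) <= K)%N.
  by move=> ht; rewrite /K (big_rem t) //= leq_addr.
pose Phi l := \sum_(t <- ts | key t == (1, 0%N))
  t.1 * mon t.2.1 l * (cexp l - rho%:C) ^+ absz (n t + K%:Z).
have hterm l l' : cexp l' = cexp l - rho%:C -> H l l' = cexp l' ^- K * Phi l.
  move=> hl; pose rs := undup ((1, 0%N) :: map key ts).
  have key_rs t : t \in ts -> key t \in rs.
    by move=> ht; rewrite mem_undup inE (map_f key ht) orbT.
  have k1rs : ((1, 0%N) : C * nat) \in rs by rewrite mem_undup inE eqxx.
  rewrite /H (sum_by_key _ (undup_uniq _) key_rs) (bigD1_seq _ k1rs (undup_uniq _)) /=.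
  rewrite [X in _ + X]big1 ?addr0 => [|kk hkk]; last exact: branch_keys.
  rewrite /Phi mulr_sumr big_seq_cond [RHS]big_seq_cond; apply: eq_bigr => t /andP[ht /eqP ke].
  have k1' : cexp (twopii R * t.2.2.1) = cexp (twopii R * 0).
    by rewrite mulr0 cexp0; exact: (congr1 fst ke).
  have k2 : t.2.2.2 = 0%N by exact: (congr1 snd ke).
  rewrite /term {2}/mon k2 (@cexp_zshift _ 0 l' K k1' (nK t ht)) -hl -/(n t) mul0r cexp0; ring.
have ePhi : exppoly Phi.
  apply: exppoly_sum => t; apply: exppolyM; first exact: exppolyM (exppolyC _) (exppoly_mon _).
  apply: exppolyX; apply: exppolyD (exppolyC _).
  by apply: eq_exppoly (exppoly_cexp 1) => l; rewrite mul1r.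
have [|J [P hP]] := exppoly_periodic ePhi; last first.
  by exists K, J, P => l0 l1 /hterm ->; rewrite hP; ring.
exists 0, (ln rho) => x xr; rewrite add0r.
have ex0 := expR_gt0 x.
have xrho : expR x < rho by rewrite -(lnK (x := rho)) ?posrE // ltr_expR.
have hx : 0 < expR x < rho by rewrite ex0.
have := branch3 hx; rewrite expRK; set l1 := _ + bpi.
have e1 : cexp l1 = cexp x%:C - rho%:C.
  by rewrite cexpD cexp_bpi cexp_ln ?subr_gt0 // mulrN1 cexp_real rmorphB /=; ring.
rewrite (hterm _ _ e1) hterm; last by rewrite cexpD cexp_twopii mulr1.
by apply: mulfI; rewrite invr_eq0 expf_neq0 // cexp_neq0.
Qed.

End CorrelationBranches.

(** * Weak commutativity and associativity from values on the real axis *)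

Section WeakReal.
Variable R : realType.
Local Notation C := R[i].
Implicit Types (A B : int -> C) (P Q : {poly C}).

Lemma mulp_above P A (a0 i : int) : (forall i, a0 < i -> A i = 0) ->
  a0 + (size P)%:Z < i -> mulp P A i = 0.
Proof.
move=> hA hi; rewrite /mulp big1 // => a _; rewrite hA ?mulr0 //.
by rewrite ltrBrDr (le_lt_trans _ hi) // lerD2l lez_nat ltnW.
Qed.

Lemma mulp_below P A (a0 i : int) : (forall i, i < a0 -> A i = 0) ->
  i < a0 -> mulp P A i = 0.
Proof. by move=> hA hi; rewrite /mulp big1 // => a _; rewrite hA ?mulr0 //; lia. Qed.

Lemma icoef_above P (i : int) : (size P)%:Z < i -> icoef P i = 0.
Proof. by case: i => // n hn; rewrite /icoef /= nth_default // ltnW // -ltz_nat. Qed.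

Lemma Lau_opp A (z S : C) : z != 0 -> Lau A (- z) S -> Lau (fun i => (-1) ^ i * A i) z S.
Proof.
move=> z0 [h1 h2].
have e i : A i * (- z) ^ i = (-1) ^ i * A i * z ^ i.
  have -> : (- z) ^ i = (-1) ^ i * z ^ i :> C.
    by rewrite -[- z]mulN1r exprzMl // ?unitfE // oppr_eq0 oner_eq0.
  by rewrite mulrCA mulrA.
split; first by apply: asum_le h1 => i; rewrite e.
exact: eq_hsum e h2.
Qed.

Lemma sign_exprz_eq0 A i : (-1) ^ i * A i = 0 -> A i = 0.
Proof. by move/eqP; rewrite mulf_eq0 expfz_eq0 oppr_eq0 oner_eq0 andbF => /eqP. Qed.

Section Weak.
Variables (rho : R) (K J : nat) (P : {poly C}).
Hypothesis rho0 : 0 < rho.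

Let T := ('X + rho%:C%:P) ^+ J * 'X^K : {poly C}.
Let Q := P \Po ('X + rho%:C%:P).

Let Lau_weak A (z : C) : z != 0 -> z + rho%:C != 0 ->
  Lau A z (z ^- K * P.[z + rho%:C] * (z + rho%:C) ^- J) ->
  Lau (fun i => mulp T A i - icoef Q i) z 0.
Proof.
move=> z0 zr h; apply: Lau_sub (Lau_poly _ z0).
rewrite (_ : Q.[z] = T.[z] * (z ^- K * P.[z + rho%:C] * (z + rho%:C) ^- J)).
  exact: Lau_mulp.
rewrite /T /Q horner_comp hornerM hornerXn horner_exp hornerD hornerX hornerC.
have := expf_neq0 J zr; have := expf_neq0 K z0.
move: ((z + _) ^+ J) (z ^+ K) => a b b0 a0; field; by rewrite a0 b0.
Qed.

(** Clearing denominators with [T] leaves the polynomial [Q]. The difference is bounded above, and z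
    -> 1 / z makes it a series bounded below that sums to 0 near 0, as in [Lau_real_uniq]. *)
Lemma weak_outer A (a0 : int) : (forall i, a0 < i -> A i = 0) ->
  (forall tau : R, rho < tau -> Lau A (- tau%:C)
     ((- tau%:C) ^- K * P.[- tau%:C + rho%:C] * (- tau%:C + rho%:C) ^- J)) ->
  forall i, mulp (('X + rho%:C%:P) ^+ J) A (i - K%:Z) = icoef Q i.
Proof.
move=> hA h i; apply/eqP; rewrite -subr_eq0; apply/eqP; rewrite -mulpMXn -/T.
pose D i := mulp T A i - icoef Q i; rewrite -/(D i).
pose nT : int := (size T)%:Z; pose nQ : int := (size Q)%:Z.
have [nT0 nQ0] : 0 <= nT /\ 0 <= nQ by [].
pose b : int := `|a0| + nT + nQ + 1.
have Dhi j : b < j -> D j = 0.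
  move=> hj; have h1 : a0 + nT < j by rewrite /b in hj; move: (nT) (nQ) nT0 nQ0 hj => x y; lia.
  have h2 : nQ < j by rewrite /b in hj; move: (nT) (nQ) nT0 nQ0 hj {h1} => x y; lia.
  by rewrite /D (mulp_above hA h1) (icoef_above h2) subr0.
suff h0 : forall j, (-1) ^ j * D (- j) = 0 by have := sign_exprz_eq0 (A := fun j => D (- j)) (h0 (- i)); rewrite opprK.
have ri : 0 < rho^-1 by rewrite invr_gt0.
apply: (@Lau_real_uniq _ (fun j => (-1) ^ j * D (- j)) (- b) _ ri) => [j hj|x /andP[x0 xr]].
  by rewrite Dhi ?mulr0 //; lia.
have xC : x%:C != 0 :> C by rewrite (inj_eq (@complexI R)) gt_eqF.
apply: (Lau_opp (A := fun j => D (- j))) => //.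
have hx : rho < x^-1 by rewrite -[rho]invrK ltf_pV2 ?posrE.
rewrite (_ : - x%:C = (- (x^-1)%:C)^-1); last by rewrite invrN fmorphV invrK.
have xiC : (x^-1)%:C != 0 :> C by rewrite fmorphV invr_eq0.
apply: Lau_reflect; apply: Lau_weak (h _ hx); first by rewrite oppr_eq0.
by rewrite addrC subr_eq0 (inj_eq (@complexI R)) lt_eqF.
Qed.

Lemma weak_inner B (b0 : int) : (forall i, i < b0 -> B i = 0) ->
  (forall tau : R, 0 < tau < rho -> Lau B (- tau%:C)
     ((- tau%:C) ^- K * P.[- tau%:C + rho%:C] * (- tau%:C + rho%:C) ^- J)) ->
  forall i, mulp (('X + rho%:C%:P) ^+ J) B (i - K%:Z) = icoef Q i.
Proof.
move=> hB h i; apply/eqP; rewrite -subr_eq0; apply/eqP; rewrite -mulpMXn -/T.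
pose D i := mulp T B i - icoef Q i; rewrite -/(D i).
pose b : int := - `|b0|.
have Dlo j : j < b -> D j = 0.
  move=> hj; rewrite /D (@mulp_below _ _ b0) //; last by rewrite /b in hj; lia.
  by case: j hj => j hj; rewrite /icoef ?subr0 //; rewrite /b in hj; exfalso; lia.
apply: sign_exprz_eq0; move: i.
apply: (@Lau_real_uniq _ (fun j => (-1) ^ j * D j) b _ rho0) => [j hj|x /andP[x0 xr]].
  by rewrite Dlo ?mulr0.
have xC : x%:C != 0 :> C by rewrite (inj_eq (@complexI R)) gt_eqF.
apply: Lau_opp => //; apply: Lau_weak; first by rewrite oppr_eq0.
  by rewrite addrC subr_eq0 (inj_eq (@complexI R)) gt_eqF.
by apply: h; rewrite x0.
Qed.

Variables (d : nat) (alpha : C) (Cc : nat -> int -> C) (c0 : int).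
Hypothesis c00 : c0 <= 0.
Hypothesis hCc : forall j (i : int), i < c0 -> Cc j i = 0.
Let l2 : C := (ln rho)%:C + pi%:C * 'i%C.

(** Up to the factor z_2^-k, the coefficient of x_0^k in (z_2 + x_0)^alpha (log (z_2 + x_0))^j / j!,
    where log z_2 = [l2]. *)
Definition twist_coef (j k : nat) : C :=
  \sum_(a < j.+1) cexp (alpha * l2) * l2 ^+ a / a`!%:R * binomc alpha k (j - a).

(** With [Cc j] the series of Y(Y(v_j, x_0) w_1, z_2), this is the coefficient of x_0^i in Y(Y((z_2
    + x_0)^(S + N) u, x_0) w_1, z_2). *)
Definition twist_iterate (i : int) : C :=
  nsum (fun k => \sum_(j < d) twist_coef j k * (- rho%:C) ^- k * Cc j (i - k%:Z)).

Lemma asym_twist j : asym (fun x => cexp (alpha * ((ln (rho - x))%:C + pi%:C * 'i%C))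
    * ((ln (rho - x))%:C + pi%:C * 'i%C) ^+ j / j`!%:R)
  (fun k => twist_coef j k * (- rho%:C) ^- k).
Proof.
pose F x := \sum_(a < j.+1) cexp (alpha * l2) * l2 ^+ a / a`!%:R * powlog alpha (j - a) (- x / rho).
apply: (@asym_eq _ F _ _ rho rho0) => [x /andP[x0 xr]|].
  have e : (ln (rho - x))%:C + pi%:C * 'i%C = l2 + (ln (1 + - x / rho))%:C.
    have -> : rho - x = rho * (1 + - x / rho).
      by rewrite mulrDr mulr1 mulrCA divff ?gt_eqF // mulr1.
    rewrite lnM ?posrE //; last by rewrite mulNr subr_gt0 ltr_pdivrMr // mul1r.
    by rewrite rmorphD /= /l2; ring.
  rewrite e /F; set t := - x / rho; set L := (ln _)%:C.
  have -> : cexp (alpha * (l2 + L)) = cexp (alpha * l2) * cexp (alpha * L).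
    by rewrite -cexpD -mulrDr.
  rewrite exprDn mulr_sumr mulr_suml (reindex_inj rev_ord_inj) /=.
  apply: eq_bigr => a _; rewrite subSS /powlog -/L (subKn (leq_ord a)).
  have /(congr1 (fun n : nat => n%:R : C)) := bin_fact (leq_ord a); rewrite !natrM => <-.
  rewrite -[(_ * _) *+ _]mulr_natr.
  have nz (n : nat) : (n`!%:R : C) != 0 by rewrite pnatr_eq0 -lt0n fact_gt0.
  have bb : ('C(j, a)%:R : C) != 0 by rewrite pnatr_eq0 -lt0n bin_gt0 leq_ord.
  have := nz a; have := nz (j - a)%N; move: bb.
  move: ('C(j, a)%:R : C) (a`!%:R : C) ((j - a)`!%:R : C) (l2 ^+ _) (L ^+ _) (cexp (alpha * l2)) (cexp _).
  move=> x1' x2' x3' x4' x5' x6' x7' h1 h2 h3; field; by rewrite h1 h2 h3.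
rewrite /F; apply: (asym_eq (F := F) ltr01 (fun _ _ => erefl)).
have -> : (fun k => twist_coef j k * (- rho%:C) ^- k) = (fun k => \sum_(a < j.+1)
    cexp (alpha * l2) * l2 ^+ a / a`!%:R * (binomc alpha k (j - a) * (- rho%:C) ^- k)).
  by apply/funext => k; rewrite /twist_coef mulr_suml; apply: eq_bigr => a _; rewrite mulrA.
by apply: asym_sum => a; apply: asymZ; exact: asym_powlog.
Qed.

Lemma twist_iterateE i n : i < c0 + n%:Z -> twist_iterate i =
  \sum_(k < n) \sum_(j < d) twist_coef j k * (- rho%:C) ^- k * Cc j (i - k%:Z).
Proof.
move=> hi; apply: nsumE => k hk; apply: big1 => j _; rewrite hCc ?mulr0 //; lia.
Qed.

Lemma weak_iterate (S : nat -> R -> C) :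
  (forall j (x : R), 0 < x < rho -> Lau (Cc j) x%:C (S j x)) ->
  (forall x : R, 0 < x < rho ->
     \sum_(j < d) cexp (alpha * ((ln (rho - x))%:C + pi%:C * 'i%C))
       * ((ln (rho - x))%:C + pi%:C * 'i%C) ^+ j / j`!%:R * S j x
     = (x%:C - rho%:C) ^- K * P.[x%:C] * x%:C ^- J) ->
  forall i, mulp (('X - rho%:C%:P) ^+ K) twist_iterate (i - J%:Z) = icoef P i.
Proof.
move=> hS hF i; rewrite -mulpMXn; set U := _ * _.
(* The factor x^(- c0) makes the expansions start in degree 0. *)
pose F x := \sum_(j < d) (cexp (alpha * ((ln (rho - x))%:C + pi%:C * 'i%C))
       * ((ln (rho - x))%:C + pi%:C * 'i%C) ^+ j / j`!%:R) * (x%:C ^ (- c0) * S j x).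
have aF : asym F (fun n => twist_iterate (c0 + n%:Z)).
  have -> : (fun n : nat => twist_iterate (c0 + n%:Z)) = (fun n => \sum_(j < d)
      \sum_(k < n.+1) (twist_coef j k * (- rho%:C) ^- k) * Cc j (c0 + (n - k)%N%:Z)).
    apply/funext => n; rewrite (@twist_iterateE _ n.+1); last by rewrite ltrD2l ltz_nat.
    rewrite exchange_big /=; apply: eq_bigr => j _; apply: eq_bigr => k _; congr (_ * Cc j _).
    have : (k <= n)%N by rewrite -ltnS.
    by lia.
  apply: asym_sum => j.
  have hj := @Lau_asym R (Cc j) (S j) c0 rho rho0 (@hCc j) (hS j).
  exact: (asymM (asym_twist j) hj).
have aT := asymM (asym_poly U) aF.
have aP : asym (fun x => x%:C ^ (- c0) * P.[x%:C]) (fun n => icoef P (c0 + n%:Z)).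
  apply: (Lau_asym rho0) => [[i'|i'] hi'|x /andP[x0 _]] //; first by exfalso; lia.
  by apply: Lau_poly; rewrite (inj_eq (@complexI R)) gt_eqF.
have {}aT : asym (fun x => x%:C ^ (- c0) * P.[x%:C])
    (fun k => \sum_(a < k.+1) U`_a * twist_iterate (c0 + (k - a)%N%:Z)).
  apply: (asym_eq rho0) aT => x hx; have /andP[x0 xr] := hx.
  have -> : F x = x%:C ^ (- c0) * ((x%:C - rho%:C) ^- K * P.[x%:C] * x%:C ^- J).
    by rewrite -hF // mulr_sumr; apply: eq_bigr => j _; ring.
  rewrite /U hornerM hornerXn horner_exp hornerD hornerN hornerX hornerC.
  have xC : x%:C != 0 :> C by rewrite (inj_eq (@complexI R)) gt_eqF.
  have xrC : x%:C - rho%:C != 0 :> C by rewrite subr_eq0 (inj_eq (@complexI R)) lt_eqF.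
  have := expf_neq0 J xC; have := expf_neq0 K xrC.
  move: ((x%:C - _) ^+ K) (x%:C ^+ J) (x%:C ^ _) => a b c a0 b0; field; by rewrite a0 b0.
have key := asym_uniq aT aP.
have E0 j : j < c0 -> twist_iterate j = 0.
  by move=> hj; rewrite (@twist_iterateE _ 0%N) ?big_ord0 // addr0.
have [hi|hi] := ltP i c0.
  by rewrite (mulp_below _ E0) //; case: i hi => // i hi; exfalso; lia.
have [n ->] : exists n : nat, i = c0 + n%:Z by exists (absz (i - c0)); lia.
rewrite -key /mulp; pose m := maxn (size U) n.+1.
transitivity (\sum_(a < m) U`_a * twist_iterate (c0 + n%:Z - a%:Z)).
  by rewrite -(@mulp_widen _ U twist_iterate _ m) // leq_maxl.
rewrite (big_ord_widen m (fun a => U`_a * twist_iterate (c0 + (n - a)%N%:Z))) ?leq_maxr //.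
rewrite [RHS]big_mkcond /=; apply: eq_bigr => a _; case: ltnP => h.
  by congr (_ * twist_iterate _); lia.
by rewrite E0 ?mulr0 //; lia.
Qed.

Lemma jacobi_of_real A B (a0 b0 : int) (S : nat -> R -> C) :
  (forall i, a0 < i -> A i = 0) -> (forall i, i < b0 -> B i = 0) ->
  (forall tau : R, rho < tau -> Lau A (- tau%:C)
     ((- tau%:C) ^- K * P.[- tau%:C + rho%:C] * (- tau%:C + rho%:C) ^- J)) ->
  (forall tau : R, 0 < tau < rho -> Lau B (- tau%:C)
     ((- tau%:C) ^- K * P.[- tau%:C + rho%:C] * (- tau%:C + rho%:C) ^- J)) ->
  (forall j (x : R), 0 < x < rho -> Lau (Cc j) x%:C (S j x)) ->
  (forall x : R, 0 < x < rho ->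
     \sum_(j < d) cexp (alpha * ((ln (rho - x))%:C + pi%:C * 'i%C))
       * ((ln (rho - x))%:C + pi%:C * 'i%C) ^+ j / j`!%:R * S j x
     = (x%:C - rho%:C) ^- K * P.[x%:C] * x%:C ^- J) ->
  forall m n, phiA rho%:C A m n - psi rho%:C B m n = psi (- rho%:C) twist_iterate n m.
Proof.
move=> hA hB LA LB LC hF.
have rhoC : rho%:C != 0 :> C by rewrite (inj_eq (@complexI R)) gt_eqF.
have wA := weak_outer hA LA; have wB := weak_inner hB LB; have wE := weak_iterate LC hF.
have E0 j : j < c0 -> twist_iterate j = 0.
  by move=> hj; rewrite (@twist_iterateE _ 0%N) ?big_ord0 // addr0.
apply: (@jacobi_of_weak R rho%:C A B twist_iterate a0 b0 c0 J K P) => //.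
- move=> m; rewrite phiA_mulp -/Q -wA; congr mulp; ring.
- move=> m; rewrite psi_mulp -/Q -wB; congr mulp; ring.
- move=> n; rewrite psi_mulp polyCN -wE; congr mulp; ring.
Qed.

End Weak.
End WeakReal.

(** * Arguments of real numbers *)

Section Carg.
Variable R : realType.
Local Notation C := R[i].

Lemma carg_pos (x : R) : 0 < x -> carg (x%:C : C) = 0.
Proof.
by move=> x0; rewrite /carg cabs_real gtr0_norm //= lexx divff ?gt_eqF // acos1.
Qed.

Lemma carg_neg (x : R) : 0 < x -> carg (- x%:C : C) = pi.
Proof.
by move=> x0; rewrite /carg cabsN cabs_real gtr0_norm //= oppr0 lexx mulNr divff ?gt_eqF // acosN1.
Qed.

End Carg.

(** * Intertwining operators *)

Section Evaluation.
Variable R : realType.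
Local Notation C := R[i].
Implicit Types (f : lmono R -> C).

(** The value at log x = l of a finite sum of monomials; infinitely many nonzero terms give 0 by
    convention. *)
Definition gev f (l : C) : C := \sum_(c \in [set: lmono R]) f c * mon c l.

Lemma gevE f l (r : seq (lmono R)) : uniq r -> (forall c, f c != 0 -> c \in r) ->
  gev f l = \sum_(c <- r) f c * mon c l.
Proof.
move=> ur hr; apply: fsbig_list => // c _ hc; apply/eqP; rewrite mulf_eq0; apply/orP; left.
by apply: contraNT hc => /hr.
Qed.

Lemma gev0 f l : (forall c, f c = 0) -> gev f l = 0.
Proof. by move=> h; rewrite (@gevE f l [::]) ?big_nil // => c; rewrite h eqxx. Qed.

Variables (d : nat) (alpha l2 : C) (T : nat -> lmono R -> lmono R -> C).
Hypothesis T_mode : forall j m1 m2, T j m1 m2 != 0 ->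
  (m1.2 < d)%N /\ exists n : int, m1.1 = n%:~R - alpha.
Hypothesis T_sum : forall r l m2,
  \sum_(k < d) \sum_(j < d) l ^+ j / j`!%:R * (T j (r, (k : nat)) m2 * l ^+ k) = T 0 (r, 0%N) m2.
Hypothesis T_fin : forall j m1, exists ms : seq (lmono R), forall m2, T j m1 m2 != 0 -> m2 \in ms.

(** Summed against z_1^alpha (log z_1)^j / j!, the terms of a given power of z_1 collapse by [T_sum]
    to the log-free one, whose exponent becomes integral. Absolute convergence allows the
    regrouping. [T j] stands for the matrix coefficients of v_j in any of the three arrangements. *)
Lemma chain_laurent (z l1 : C) (S : nat -> C) : cexp l1 = z ->
  (forall j, asum (fun m : lmono R * lmono R => T j m.1 m.2 * mon m.1 l1 * mon m.2 l2) /\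
             hsum (fun m : lmono R * lmono R => T j m.1 m.2 * mon m.1 l1 * mon m.2 l2) (S j)) ->
  Lau (fun n => gev (T 0 (n%:~R - alpha, 0%N)) l2) z
    (\sum_(j < d) cexp (alpha * l1) * l1 ^+ j / j`!%:R * S j).
Proof.
move=> ez hT.
pose phi (j : nat) : C := cexp (alpha * l1) * l1 ^+ j / j`!%:R.
pose a (m : lmono R * lmono R) := \sum_(j < d) phi j * (T j m.1 m.2 * mon m.1 l1 * mon m.2 l2).
pose deg (m : lmono R * lmono R) : int := Num.floor (complex.Re (m.1.1 + alpha)).
have degE (n : int) k m2 : deg ((n%:~R - alpha, k), m2) = n.
  by rewrite /deg /= subrK -(rmorph_int (real_complex R)) /= intrKfloor.
apply: (@asum_fubini R _ _ a _ deg).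
- by apply: asum_sum => j; apply: asumZ; exact: (hT j).1.
- by apply: hsum_sum => j; apply: hsumZ; exact: (hT j).2.
move=> n; pose r0 : C := n%:~R - alpha.
have [msf hms] := choice (fun jk : nat * nat => T_fin jk.1 (r0, jk.2)).
pose ms := undup (flatten [seq msf jk | jk <- [seq (j, k) | j <- iota 0 d, k <- iota 0 d]]).
have inms j k m2 : (j < d)%N -> (k < d)%N -> T j (r0, k) m2 != 0 -> m2 \in ms.
  move=> jd kd /(hms (j, k)) h; rewrite mem_undup; apply/flattenP; exists (msf (j, k)) => //.
  by apply: map_f; apply/allpairsP; exists (j, k); rewrite !mem_iota.
have [d0|d0] := posnP d.
  have T0 j m1 m2 : T j m1 m2 = 0.
    by apply/eqP; apply: contraT => /T_mode[]; rewrite d0.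
  rewrite gev0 // mul0r; refine (eq_hsum _ (@hsum0 _ _)) => m.
  by case: ifP => // _; rewrite /a big1 // => j _; rewrite T0 !mul0r mulr0.
pose rr := [seq ((r0, k), m2) | k <- iota 0 d, m2 <- ms] : seq (lmono R * lmono R).
have urr : uniq rr.
  apply: allpairs_uniq; [exact: iota_uniq|exact: undup_uniq|].
  by move=> [k m2] [k' m2'] _ _ /= [-> ->].
have -> : gev (T 0 (n%:~R - alpha, 0%N)) l2 * z ^ n =
    \sum_(m <- rr) if deg m == n then a m else 0.
  rewrite (@gevE _ _ ms) ?undup_uniq //; last by move=> c; apply: inms.
  rewrite big_allpairs_dep /= exchange_big /= mulr_suml; apply: eq_bigr => m2 _.
  have -> : \sum_(i <- iota 0 d) (if deg (((r0, i) : lmono R), m2) == n then a ((r0, i), m2) else 0)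
     = \sum_(k < d) a ((r0, (k : nat)), m2).
    rewrite -(big_mkord xpredT (fun k => a ((r0, k), m2))) /index_iota subn0.
    by apply: eq_bigr => k _; rewrite /r0 degE eqxx.
  rewrite -(T_sum r0 l1 m2) -ez -cexpMz mulrAC mulr_suml mulr_suml; apply: eq_bigr => k _.
  rewrite /a mulr_suml mulr_suml; apply: eq_bigr => j _; rewrite /phi /mon /=.
  have -> : cexp (n%:~R * l1) = cexp (r0 * l1) * cexp (alpha * l1).
    by rewrite -cexpD -mulrDl subrK.
  by ring.
apply: hsum_fin => // m hm; case: ifP => // /eqP hdeg; rewrite /a big1 // => j _.
have [->|Tn0] := eqVneq (T j m.1 m.2) 0; first by rewrite !mul0r mulr0.
exfalso; move/negP: hm; apply; have [kd [n' hn']] := T_mode Tn0.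
case: m hdeg Tn0 kd hn' => [[r k] m2] /= hdeg Tn0 kd hn'; rewrite hn' degE in hdeg.
rewrite hn' hdeg -/r0 in Tn0 *.
apply/allpairsP; exists (k, m2); split=> //; first by rewrite mem_iota.
exact: (inms j k m2 (ltn_ord j) kd Tn0).
Qed.

End Evaluation.

(** * The Jacobi identity at a point of the negative axis *)

Section IntertwiningJacobi.
Variables (R : realType) (V : voa R) (g : V -> V).
Variables (W1 : twisted_module (@id V)) (W2 W3 : twisted_module g).
Variable Y : twisted_intertwining W1 W2 W3.
Local Notation C := R[i].
Hypotheses (g_linear : linear g) (g_omega : g (voa_omega V) = voa_omega V).
Variables (d : nat) (alpha : C) (v_ : nat -> V).
Hypothesis v_0 : forall j, (d <= j)%N -> v_ j = 0.
Hypothesis g_v : forall j, g (v_ j) = cexp (twopii R * alpha) *: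
  \sum_(k < d) (twopii R ^+ k / (k`!)%:R) *: v_ (j + k)%N.
Variables (w1 : W1) (w2 : W2) (w' : W3 -> C).
Hypothesis hw' : graded_dual (@tm_gr _ _ _ W3) w'.

Lemma id_linear : linear (@id V). Proof. by []. Qed.

Definition prod_coef (i : int) (c : lmono R) : C :=
  w' (tm_Y (v_ 0) (Y w1 w2 c) (i%:~R - alpha, 0%N)).
Definition rprod_coef (i : int) (c : lmono R) : C :=
  w' (Y w1 (tm_Y (v_ 0) w2 (i%:~R - alpha, 0%N)) c).
Definition iterate_coef (j : nat) (i : int) (c : lmono R) : C :=
  w' (Y (tm_Y (v_ j) w1 (i%:~R, 0%N)) w2 c).

Lemma prod_coef_fin v m : exists ms : seq (lmono R), forall c,
  w' (tm_Y v (Y w1 w2 c) m) != 0 -> c \in ms.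
Proof. exact: finite_cover (io_fin Y w1 w2 (gdual_mode g_linear g_omega v m hw')). Qed.

Lemma io_coef_fin x y : exists ms : seq (lmono R), forall c, w' (Y x y c) != 0 -> c \in ms.
Proof. exact: finite_cover (io_fin Y x y hw'). Qed.

Lemma prod_coef_upper : exists a0 : int, forall i c, a0 < i -> prod_coef i c = 0.
Proof.
have [N hN] := @modes_upper R V g W3 g_linear g_omega (v_ 0) w' (- alpha) hw'.
exists N%:Z => -[i|i] c hi; last by exfalso; lia.
by rewrite /prod_coef -pmulrn addrC hN // ltnW // -ltz_nat.
Qed.

Lemma rprod_coef_lower : exists b0 : int, forall i c, i < b0 -> rprod_coef i c = 0.
Proof.
have [N hN] := @modes_lower R V g W2 g_linear g_omega (v_ 0) w2 (- alpha).
exists (- N%:Z) => i c hi.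
have -> : i = - (absz i)%:Z by lia.
rewrite /rprod_coef mulrNz -pmulrn addrC hN; last by lia.
by rewrite (lin0 (io_linr Y w1 c)) (scal0 hw'.1).
Qed.

Lemma iterate_modes_lower : exists c0 : int, c0 <= 0 /\ forall j i, i < c0 -> tm_Y (v_ j) w1 (i%:~R, 0%N) = 0.
Proof.
have [Nf hN] := choice (fun j => @modes_lower R V id W1 id_linear erefl (v_ j) w1 0).
have [M hM] : exists M, forall j, (j < d)%N -> (Nf j <= M)%N.
  by exists (\max_(j < d) Nf j)%N => j jd; exact: (leq_bigmax (Ordinal jd)).
exists (- M%:Z); split=> [|j i hi]; first by lia.
have [jd|jd] := ltnP j d; last by rewrite v_0 // (lin0 (tm_linl w1 _)).
have -> : i = - (absz i)%:Z by lia.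
rewrite mulrNz -pmulrn -[- _]add0r hN //.
by have := hM _ jd; lia.
Qed.

(** The three Laurent expansions [LA], [LB], [LC] of one function H are fed to [branch_rational] and
    then to [jacobi_of_real]. *)
Lemma io_jacobi (rho : R) : 0 < rho -> let l2 := (ln rho)%:C + pi%:C * 'i%C in
  forall m n, phiA rho%:C (fun i => gev (prod_coef i) l2) m n
    - psi rho%:C (fun i => gev (rprod_coef i) l2) m n
    = psi (- rho%:C) (twist_iterate rho d alpha (fun j i => gev (iterate_coef j i) l2)) n m.
Proof.
move=> rho0 l2; set bpi := pi%:C * 'i%C in l2 *; pose z2 : C := - rho%:C.
have cl2 : clog 0 z2 = l2 by rewrite clog_neg // mul0r addr0.
have cz2 : cabs z2 = rho by rewrite cabsN cabs_real gtr0_norm.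
have hpi := pi_gt0 R.
have [f hf] := choice (fun j => io_duality Y (v_ j) w1 w2 hw').
pose hj j l0 l1 : C := \sum_(c <- f j) c.1 * (mon (c.2 x0) l0 * (mon (c.2 x1) l1 * mon (c.2 x2) l2)).
have hjE j (p0 p1 : int) (z0 z1 : C) :
    lp_eval (f j) [tuple p0; p1; 0] [tuple z0; z1; z2] = hj j (clog p0 z0) (clog p1 z1).
  rewrite /lp_eval /hj; apply: eq_bigr => c _; congr (_ * _).
  rewrite !big_ord_recl big_ord0 mulr1 /mono_at /mon !(tnth_nth 0) /= cl2.
  have -> : lift ord0 (lift ord0 ord0) = x2 by apply/val_inj.
  have -> : lift ord0 ord0 = x1 by apply/val_inj.
  by have -> : ord0 = x0 by apply/val_inj.
(* Monomials of z_1^alpha (log z_1)^j / j! times the finite sum of v_j, with z_2 fixed and its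
   powers absorbed in the coefficient. *)
pose mk (j : nat) (c : C * lmonos R 3) : C * (lmono R * lmono R) :=
  (c.1 * mon (c.2 x2) l2 / j`!%:R, (c.2 x0, ((alpha, j) : lmono R) + c.2 x1)).
pose ts := flatten [seq map (mk j) (f j) | j <- iota 0 d].
pose H l0 l1 := \sum_(t <- ts) t.1 * (mon t.2.1 l0 * mon t.2.2 l1).
have HE l0 l1 : H l0 l1 = \sum_(j < d) cexp (alpha * l1) * l1 ^+ j / j`!%:R * hj j l0 l1.
  rewrite /H big_flatten /= big_map -(big_mkord xpredT (fun j => cexp (alpha * l1) * l1 ^+ j / j`!%:R * hj j l0 l1)).
  rewrite /index_iota subn0; apply: eq_bigr => j _; rewrite big_map /hj mulr_sumr.
  by apply: eq_bigr => c _; rewrite /mk /= monD [mon (alpha, j) l1]/mon /=; ring.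
have rC (x : R) : 0 < x -> cabs (x%:C : C) = x by move=> x0; rewrite cabs_real gtr0_norm.
have clogn p (x : R) : 0 < x -> clog p (- x%:C) = (ln x)%:C + bpi + p%:~R * twopii R :> C.
  by move=> x0; rewrite clog_neg // addrA.
have cexpn p (x : R) : 0 < x -> cexp ((ln x)%:C + bpi + p%:~R * twopii R) = - x%:C :> C.
  by move=> x0; rewrite cexpD cexp_twopiiz mulr1 cexpD cexp_ln // /bpi cexp_bpi mulrN1.
have subz (a : R) : - a%:C - z2 = (rho - a)%:C by rewrite /z2 opprK addrC rmorphB.
(* Here z_1 = - tau and z_0 = - (tau - rho) both have argument pi. *)
have LA tau : rho < tau -> Lau (fun i => gev (prod_coef i) l2) (- tau%:C)
    (H ((ln (tau - rho))%:C + bpi) ((ln tau)%:C + bpi)).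
  move=> ht; have t0 : 0 < tau := lt_trans rho0 ht.
  have dt : 0 < tau - rho by rewrite subr_gt0.
  rewrite HE; apply: (@chain_laurent R d alpha l2 (fun j m1 m2 => w' (tm_Y (v_ j) (Y w1 w2 m2) m1)) _ _ _
    (- tau%:C) ((ln tau)%:C + bpi) (fun j => hj j ((ln (tau - rho))%:C + bpi) ((ln tau)%:C + bpi))).
  - move=> j [r k] m2 /= h.
    have h0 : tm_Y (v_ j) (Y w1 w2 m2) (r, k) <> 0 by move=> e; rewrite e (scal0 hw'.1) eqxx in h.
    by have [? ?] := chain_mode0 v_0 g_v h0; split=> //; lia.
  - by move=> r l m2; exact: (chain_sum v_0 g_v).
  - by move=> j m1; exact: prod_coef_fin.
  - by have := cexpn 0 tau t0; rewrite mul0r addr0.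
  move=> j; have h2 : 0 < cabs z2 < cabs (- tau%:C : C) by rewrite cz2 rho0 cabsN rC.
  have [p _ _] := hf j 0 0 0 (- tau%:C) z2; have [hs hv] := p h2.
  have es : - tau%:C - z2 = - (tau - rho)%:C by rewrite subz -rmorphN opprB.
  rewrite es carg_neg // carg_neg // subrr hjE !clogn // !mul0r !addr0 in hv.
  have eq1 m : w' (tm_Y (v_ j) (Y w1 w2 m.2) m.1) * mono_at 0 (- tau%:C) m.1 * mono_at 0 z2 m.2
      = w' (tm_Y (v_ j) (Y w1 w2 m.2) m.1) * mon m.1 ((ln tau)%:C + bpi) * mon m.2 l2.
    by rewrite /mono_at cl2 clogn // mul0r addr0.
  split; first by refine (asum_le _ (abs_summable_asum hs)) => m; rewrite eq1.
  apply: (eq_hsum eq1); apply: sums_to_hsum; apply: hv.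
  by rewrite oppr_lt0 !divr_gt0.
(* Here z_0 = rho - tau > 0, so arg z_0 - arg z_1 = - pi. Duality takes log z_0 in the branch of
   z_2, while the branch p1 of log z_1 stays free. *)
have LB tau (p1 : int) : 0 < tau < rho -> Lau (fun i => gev (rprod_coef i) l2) (- tau%:C)
    (H (ln (rho - tau))%:C ((ln tau)%:C + bpi + p1%:~R * twopii R)).
  move=> /andP[t0 ht].
  have dt : 0 < rho - tau by rewrite subr_gt0.
  rewrite HE; apply: (@chain_laurent R d alpha l2 (fun j m1 m2 => w' (Y w1 (tm_Y (v_ j) w2 m1) m2)) _ _ _
    (- tau%:C) ((ln tau)%:C + bpi + p1%:~R * twopii R)
    (fun j => hj j (ln (rho - tau))%:C ((ln tau)%:C + bpi + p1%:~R * twopii R))).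
  - move=> j [r k] m2 /= h.
    have h0 : tm_Y (v_ j) w2 (r, k) <> 0.
      by move=> e; rewrite e (lin0 (io_linr Y w1 m2)) (scal0 hw'.1) eqxx in h.
    by have [? ?] := chain_mode0 v_0 g_v h0; split=> //; lia.
  - move=> r l m2.
    apply/eqP; rewrite -subr_eq0; apply/eqP.
    pose F v := w' (Y w1 v m2).
    have hF : scalar F by exact: (scalar_comp hw'.1 (io_linr Y w1 m2)).
    rewrite -[w' (Y w1 (tm_Y (v_ 0) w2 (r, 0%N)) m2)]/(F _).
    (* [chain_sum] concerns functionals in the graded dual, and w' composed with a mode of Y(w_1, x)
       is a different functional; hence the detour through an identity of vectors of W_2. *)
    rewrite (_ : tm_Y (v_ 0) w2 (r, 0%N) = \sum_(k < d) \sum_(j < d) (l ^+ j / j`!%:R * l ^+ k) *: tm_Y (v_ j) w2 (r, (k : nat))).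
      rewrite (scal_sum _ _ _ hF) -sumrB big1 // => k _; rewrite (scal_sum _ _ _ hF) -sumrB big1 // => j _.
      by rewrite (scalZ hF) /F; ring.
    apply/eqP; rewrite -subr_eq0; apply/eqP; apply: tm_separates => w'' hw''.
    rewrite (scalB hw''.1) -(chain_sum v_0 g_v w2 r l hw'').
    rewrite (scal_sum _ _ _ hw''.1) -sumrB big1 // => k _; rewrite (scal_sum _ _ _ hw''.1) -sumrB big1 // => j _.
    by rewrite (scalZ hw''.1); ring.
  - by move=> j m1; exact: io_coef_fin.
  - exact: cexpn.
  move=> j; have h2 : 0 < cabs (- tau%:C : C) < cabs z2 by rewrite cz2 cabsN rC ?t0.
  have [_ p _] := hf j p1 0 0 (- tau%:C) z2; have [hs hv] := p h2.
  rewrite subz carg_pos // carg_neg // sub0r hjE clogn // clog_pos // mul0r addr0 in hv.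
  have eq1 m : w' (Y w1 (tm_Y (v_ j) w2 m.1) m.2) * mono_at p1 (- tau%:C) m.1 * mono_at 0 z2 m.2
      = w' (Y w1 (tm_Y (v_ j) w2 m.1) m.2) * mon m.1 ((ln tau)%:C + bpi + p1%:~R * twopii R) * mon m.2 l2.
    by rewrite /mono_at cl2 clogn.
  split; first by refine (asum_le _ (abs_summable_asum hs)) => m; rewrite eq1.
  apply: (eq_hsum eq1); apply: sums_to_hsum; apply: hv.
  by rewrite !ltrN2 mulrS mulr2n; apply/andP; split; move: hpi; lra.
(* Here z_0 = x > 0, and z_1 = x - rho has the argument of z_2; the branch p of log z_0 is free. On
   the untwisted W_1 each v_j is a chain of length 1 with alpha = 0. *)
have LC j (x : R) (p : int) : 0 < x < rho -> Lau (fun i => gev (iterate_coef j i) l2) x%:C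
    (hj j ((ln x)%:C + p%:~R * twopii R) ((ln (rho - x))%:C + bpi)).
  move=> /andP[x0 hx].
  have dx : 0 < rho - x by rewrite subr_gt0.
  pose T (i : nat) (m1 m2 : lmono R) : C := if i is 0%N then w' (Y (tm_Y (v_ j) w1 m1) w2 m2) else 0.
  set l0 := (ln x)%:C + p%:~R * twopii R.
  have tint m1 m2 : w' (Y (tm_Y (v_ j) w1 m1) w2 m2) != 0 -> exists n : int, m1 = (n%:~R, 0%N).
    move=> h; apply: (@fixed_modes _ _ _ W1 id_linear (v_ j) w1) => // e.
    by rewrite e (lin0 (io_linl Y w2 m2)) (scal0 hw'.1) eqxx in h.
  have := @chain_laurent R 1 0 l2 T _ _ _ x%:C l0
    (fun i => if i is 0%N then hj j l0 ((ln (rho - x))%:C + bpi) else 0).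
  have -> : (fun n : int => gev (T 0 (n%:~R - 0, 0%N)) l2) = (fun i => gev (iterate_coef j i) l2).
    by apply/funext => i; rewrite subr0.
  rewrite big_ord1 mul0r cexp0 expr0 fact0 divr1 !mul1r; apply.
  - case=> [|i] m1 m2; last by rewrite /T eqxx.
    by move=> /tint[n ->]; split=> //; exists n; rewrite subr0.
  - by move=> r l m2; rewrite !big_ord1 expr0 fact0 divr1 !mul1r mulr1.
  - case=> [|i] m1; first exact: io_coef_fin.
    by exists [::] => m2; rewrite eqxx.
  - by rewrite cexpD cexp_twopiiz mulr1 cexp_ln.
  case=> [|i]; last first.
    have e m : 0 = T i.+1 m.1 m.2 * mon m.1 l0 * mon m.2 l2 by rewrite !mul0r.
    by split; [refine (asum_le _ (@asum0 _ _)) => m; rewrite -e | exact: (eq_hsum e (@hsum0 _ _))].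
  have es : - (rho - x)%:C - z2 = x%:C by rewrite subz subKr.
  have h2 : 0 < cabs (- (rho - x)%:C - z2) < cabs z2 by rewrite es rC // cz2 x0.
  have [_ _ q] := hf j 0 0 p (- (rho - x)%:C) z2; have [hs hv] := q h2.
  rewrite carg_neg // /z2 carg_neg // subrr -/z2 es hjE clogn // clog_pos // mul0r addr0 in hv.
  have eq1 m : w' (Y (tm_Y (v_ j) w1 m.1) w2 m.2) * mono_at p (- (rho - x)%:C - z2) m.1 * mono_at 0 z2 m.2
      = T 0%N m.1 m.2 * mon m.1 l0 * mon m.2 l2.
    by rewrite /mono_at cl2 es clog_pos.
  split; first by refine (asum_le _ (abs_summable_asum hs)) => m; rewrite eq1.
  apply: (eq_hsum eq1); apply: sums_to_hsum; rewrite es; apply: hv.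
  by rewrite oppr_lt0 !divr_gt0.
(* The coefficients of the Laurent series do not involve the branch, hence neither does its sum; the
   same holds in [br3]. *)
have br2 tau : 0 < tau < rho -> exists G, forall p : nat,
    H (ln (rho - tau))%:C ((ln tau)%:C + bpi + p%:R * twopii R) = G.
  move=> ht; exists (H (ln (rho - tau))%:C ((ln tau)%:C + bpi + 0%:~R * twopii R)) => p.
  exact: (hsum_uniq (LB tau p ht).2 (LB tau 0 ht).2).
have br3 (x : R) : 0 < x < rho ->
    H ((ln x)%:C + twopii R) ((ln (rho - x))%:C + bpi) = H (ln x)%:C ((ln (rho - x))%:C + bpi).
  move=> hx; rewrite !HE; apply: eq_bigr => j _; congr (_ * _).
  have := hsum_uniq (LC j x 1 hx).2 (LC j x 0 hx).2; by rewrite mul1r mul0r addr0.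
have [K [J [P hP]]] := branch_rational rho0 br2 br3.
have {}hP l0 l1 : cexp l1 = cexp l0 - rho%:C -> H l0 l1 = cexp l1 ^- K * P.[cexp l0] * cexp l0 ^- J.
  exact: hP.
have [a0 hA] := prod_coef_upper; have [b0 hB] := rprod_coef_lower; have [c0 [c00 hC]] := iterate_modes_lower.
have cn (x : R) : 0 < x -> cexp ((ln x)%:C + bpi) = - x%:C :> C.
  by move=> h; have := cexpn 0 x h; rewrite mul0r addr0.
apply: (@jacobi_of_real R rho K J P rho0 d alpha _ c0 c00 _ _ _ a0 b0
  (fun j x => hj j (ln x)%:C ((ln (rho - x))%:C + bpi))).
- by move=> j i hi; apply: gev0 => c; rewrite /iterate_coef hC // (lin0 (io_linl Y w2 c)) (scal0 hw'.1).
- by move=> i hi; apply: gev0 => c; exact: hA.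
- by move=> i hi; apply: gev0 => c; exact: hB.
- move=> tau ht; have t0 : 0 < tau := lt_trans rho0 ht.
  have dt : 0 < tau - rho by rewrite subr_gt0.
  have e0 : - tau%:C + rho%:C = - (tau - rho)%:C by rewrite rmorphB /= opprB addrC.
  have hc : cexp ((ln tau)%:C + bpi) = cexp ((ln (tau - rho))%:C + bpi) - rho%:C.
    by rewrite !cn // -e0 addrK.
  by have := LA tau ht; rewrite (hP _ _ hc) (cn _ t0) (cn _ dt) -e0.
- move=> tau ht; have /andP[t0 tr] := ht; have dt : 0 < rho - tau by rewrite subr_gt0.
  have e0 : (rho - tau)%:C = - tau%:C + rho%:C by rewrite rmorphB /= addrC.
  have hc : cexp ((ln tau)%:C + bpi) = cexp (ln (rho - tau))%:C - rho%:C.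
    by rewrite cn // cexp_ln // e0 addrK.
  by have := LB tau 0 ht; rewrite mul0r addr0 (hP _ _ hc) (cn _ t0) (cexp_ln dt) e0.
- by move=> j x hx; have := LC j x 0 hx; rewrite mul0r addr0.
move=> x hx; have /andP[x0' xr] := hx; have dx : 0 < rho - x by rewrite subr_gt0.
have e0 : - (rho - x)%:C = x%:C - rho%:C by rewrite rmorphB /= opprB.
have hc : cexp ((ln (rho - x))%:C + bpi) = cexp (ln x)%:C - rho%:C.
  by rewrite cn // cexp_ln // e0.
by rewrite -/bpi -HE (hP _ _ hc) (cn _ dx) (cexp_ln x0') e0.
Qed.

End IntertwiningJacobi.

Lemma sum_zero_tail (Z : nmodType) (F : nat -> Z) (K K' : nat) :
  (forall k, (K <= k)%N -> F k = 0) -> (K <= K')%N -> \sum_(k < K') F k = \sum_(k < K) F k.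
Proof. by move=> h hK; rewrite -!nsumE // => k /(leq_trans hK); exact: h. Qed.

(** The substitution j = a + b; the square a, b < d adds only vanishing terms to the triangle. *)
Lemma chain_reindex (Z : nmodType) (X : nat -> nat -> Z) (d q : nat) :
  (forall a b, (d <= a + b)%N -> X a b = 0) ->
  \sum_(j < d) \sum_(a < j.+1) (if (a <= q)%N then X a (j - a)%N else 0)
  = \sum_(a < q.+1) \sum_(b < d) X a b.
Proof.
move=> hX; pose X' a b := if (a <= q)%N then X a b else 0.
have hX' a b : (d <= a + b)%N -> X' a b = 0 by move=> h; rewrite /X' hX // if_same.
transitivity (\sum_(a < d) \sum_(b < d) X' a b); last first.
  pose G a := \sum_(b < d) X' a b.
  have Gd a : (d <= a)%N -> G a = 0 by move=> h; apply: big1 => b _; rewrite hX' // (leq_trans h) // leq_addr.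
  have Gq a : (q.+1 <= a)%N -> G a = 0 by move=> h; apply: big1 => b _; rewrite /X' leqNgt h.
  rewrite -[LHS](nsumE Gd) (nsumE Gq); apply: eq_bigr => a _; apply: eq_bigr => b _.
  by rewrite /X' -ltnS ltn_ord.
transitivity (\sum_(j < d) \sum_(a < d | (a < j.+1)%N) X' a (j - a)%N).
  by apply: eq_bigr => j _; rewrite -(big_ord_widen d (fun a => X' a (j - a)%N)) // ltn_ord.
rewrite (exchange_big_dep xpredT) //=; apply: eq_bigr => a _.
have -> : \sum_(i < d | (a < i.+1)%N) X' a (i - a)%N = \sum_(0 + a <= i < d) X' a (i - a)%N.
  rewrite -(big_mkord (fun i => (a < i.+1)%N) (fun i => X' a (i - a)%N)) add0n.
  rewrite (big_cat_nat (n := a)) //= ?(ltnW (ltn_ord a)) // big_nat_cond big_pred0 ?add0r.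
    by rewrite big_nat_cond [RHS]big_nat_cond; apply: eq_bigl => i; rewrite ?ltnS andbT; case: (a <= i)%N; rewrite /= ?andbT ?andbF.
  by move=> i; rewrite ?ltnS /=; case: ltnP => // h; rewrite leqNgt h.
rewrite big_addn big_mkord; transitivity (\sum_(b < d - a) X' a b).
  by apply: eq_bigr => b _; rewrite addnK.
by apply/esym/sum_zero_tail; [move=> k hk; apply: hX'; rewrite -leq_subLR | exact: leq_subr].
Qed.

(** * Shifts and independence of finite sums of monomials *)

Section GevTheory.
Variable R : realType.
Local Notation C := R[i].
Implicit Types (f h : lmono R -> C).

Definition fsupp f := exists ms : seq (lmono R), forall c, f c != 0 -> c \in ms.

(** Multiplication by x^r (log x)^a. *)
Definition gshift (r : C) (a : nat) f : lmono R -> C :=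
  fun c => if (a <= c.2)%N then f (c.1 - r, (c.2 - a)%N) else 0.

Lemma fsuppZ x f : fsupp f -> fsupp (fun c => x * f c).
Proof.
by move=> [ms h]; exists ms => c; rewrite mulf_eq0 negb_or => /andP[_]; exact: h.
Qed.

Lemma fsuppD f h : fsupp f -> fsupp h -> fsupp (fun c => f c + h c).
Proof.
move=> [m1 h1] [m2 h2]; exists (m1 ++ m2) => c; rewrite mem_cat.
case: (eqVneq (f c) 0) => [->|/h1 ->//]; rewrite add0r => /h2 ->; exact: orbT.
Qed.

Lemma fsupp0 : fsupp (fun=> 0). Proof. by exists [::] => c; rewrite eqxx. Qed.

Lemma fsupp_sum n (F : nat -> lmono R -> C) : (forall k, fsupp (F k)) ->
  fsupp (fun c => \sum_(k < n) F k c).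
Proof.
move=> h; elim: n => [|n IH].
  by have := fsupp0; congr fsupp; apply/funext => c; rewrite big_ord0.
by have := fsuppD IH (h n); congr fsupp; apply/funext => c; rewrite big_ord_recr.
Qed.

Lemma gevZ x f l : fsupp f -> gev (fun c => x * f c) l = x * gev f l.
Proof.
move=> hf; have [ms h] := hf; have h' c : x * f c != 0 -> c \in undup ms.
  by rewrite mem_undup mulf_eq0 negb_or => /andP[_]; exact: h.
rewrite (gevE l (undup_uniq ms) h') (gevE (f := f) l (undup_uniq ms)).
  by rewrite mulr_sumr; apply: eq_bigr => c _; rewrite mulrA.
by move=> c; rewrite mem_undup; exact: h.
Qed.

Lemma gevD f h l : fsupp f -> fsupp h -> gev (fun c => f c + h c) l = gev f l + gev h l.
Proof.
move=> [m1 h1] [m2 h2]; pose ms := undup (m1 ++ m2).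
rewrite !(@gevE _ _ l ms) ?undup_uniq //.
- by rewrite -big_split; apply: eq_bigr => c _; rewrite mulrDl.
- by move=> c /h2; rewrite mem_undup mem_cat => ->; rewrite orbT.
- by move=> c /h1; rewrite mem_undup mem_cat => ->.
move=> c; rewrite mem_undup mem_cat.
case: (eqVneq (f c) 0) => [->|/h1 ->//]; rewrite add0r => /h2 ->; exact: orbT.
Qed.

Lemma gev_sum n (F : nat -> lmono R -> C) l : (forall k, fsupp (F k)) ->
  gev (fun c => \sum_(k < n) F k c) l = \sum_(k < n) gev (F k) l.
Proof.
move=> h; elim: n => [|n IH].
  by rewrite big_ord0; apply: gev0 => c; rewrite big_ord0.
rewrite [RHS]big_ord_recr /= -IH -(gevD l (fsupp_sum n h) (h n)); congr gev.
by apply/funext => c; rewrite big_ord_recr.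
Qed.

Lemma fsupp_shift r a f : fsupp f -> fsupp (gshift r a f).
Proof.
move=> [ms h]; exists [seq ((c.1 + r, (c.2 + a)%N) : lmono R) | c <- ms] => -[s k].
rewrite /gshift /=; case: ifP; rewrite ?eqxx // => ak /h hin.
by apply/mapP; exists (s - r, (k - a)%N) => //=; rewrite subrK subnK.
Qed.

Lemma gev_shift r a f l : fsupp f -> gev (gshift r a f) l = mon (r, a) l * gev f l.
Proof.
move=> [ms h]; pose sh (c : lmono R) : lmono R := (c.1 + r, (c.2 + a)%N).
have shI : injective sh by move=> [s k] [s' k'] [/addIr -> /addIn ->].
rewrite (gevE (f := f) l (undup_uniq ms)); last by move=> c /h; rewrite mem_undup.
rewrite (@gevE _ _ l (map sh (undup ms))); last 2 first.
- by rewrite map_inj_uniq ?undup_uniq.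
- move=> [s k]; rewrite /gshift /=; case: ifP; rewrite ?eqxx // => ak /h hin.
  by apply/mapP; exists (s - r, (k - a)%N); rewrite ?mem_undup // /sh /= subrK subnK.
rewrite big_map mulr_sumr; apply: eq_bigr => -[s k] _.
rewrite /gshift /sh /= leq_addl addrK addnK [RHS]mulrCA; congr (_ * _).
rewrite -(monD (r, a) (s, k) l).
have -> // : ((r, a) : lmono R) + (s, k) = (s + r, (k + a)%N).
by congr pair; [exact: addrC | exact: addnC].
Qed.

(** The logarithms of the negative numbers fill a horizontal line, on which monomials are
    independent. *)
Lemma gev_inj f : fsupp f ->
  (forall rho : R, 0 < rho -> gev f ((ln rho)%:C + pi%:C * 'i%C) = 0) -> forall c, f c = 0.
Proof.
move=> [ms h] hf c.
have h' c' : f c' != 0 -> c' \in undup ms by move=> /h; rewrite mem_undup.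
have [hc|hc] := boolP (c \in undup ms); last by apply/eqP; apply: contraNT hc => /h'.
move: c hc; apply: mon_indep; first exact: undup_uniq.
exists (pi%:C * 'i%C), 0 => x _; rewrite -(gevE _ (undup_uniq ms) h') addrC.
by have := hf _ (expR_gt0 x); rewrite expRK.
Qed.

End GevTheory.

(** * The Jacobi identity in components *)

Section Modes.
Variables (R : realType) (V : voa R) (g : V -> V).
Variables (W1 : twisted_module (@id V)) (W2 W3 : twisted_module g).
Variable Y : twisted_intertwining W1 W2 W3.
Local Notation C := R[i].
Hypotheses (g_linear : linear g) (g_omega : g (voa_omega V) = voa_omega V).
Variables (d : nat) (alpha : C) (v_ : nat -> V).
Hypothesis v_0 : forall j, (d <= j)%N -> v_ j = 0.
Hypothesis g_v : forall j, g (v_ j) = cexp (twopii R * alpha) *: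
  \sum_(k < d) (twopii R ^+ k / (k`!)%:R) *: v_ (j + k)%N.
Variables (w1 : W1) (w2 : W2).

(** This definition and the next two give the terms of the Jacobi identity at x_0^(- n - 1) x_1^(- m
    - 1) and the monomial [c] of x_2. The index k belongs to the binomial of the delta function, k'
    to that of (x_2 + x_0)^(S + N). *)
Definition prod_term (m n : int) (c : lmono R) (k : nat) : W3 :=
  (binom n%:~R k * (-1) ^+ k) *:
    tm_Y (v_ 0) (Y w1 w2 (c.1 - k%:R, c.2)) ((k%:Z - m - n - 1)%:~R - alpha, 0%N).

Definition rprod_term (m n : int) (c : lmono R) (k : nat) : W3 :=
  (binom n%:~R k * (-1) ^ (n - k%:Z)) *:
    Y w1 (tm_Y (v_ 0) w2 ((- m - 1 - k%:Z)%:~R - alpha, 0%N)) (c.1 - (n - k%:Z)%:~R, c.2).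

Definition iterate_term (m n : int) (c : lmono R) (k k' : nat) : W3 :=
  binom m%:~R k *: \sum_(a < c.2.+1) \sum_(b < d) (binomc alpha k' b / a`!%:R) *:
    Y (tm_Y (v_ (a + b)%N) w1 ((- n - 1 - k%:Z - k'%:Z)%:~R, 0%N)) w2
      (c.1 - (m - k%:Z)%:~R - alpha + k'%:R, (c.2 - a)%N).

Lemma io_lower_nat x y (c : lmono R) : exists K : nat, forall k, (K <= k)%N ->
  Y x y (c.1 - k%:R, c.2) = 0.
Proof.
have [l0 h] := io_lower Y x y (- c.1 - 1) c.2; exists (absz l0).+1 => k hk.
rewrite -(h k%:Z); last by lia.
by rewrite -pmulrn; congr (Y _ _ (_, _)); ring.
Qed.

Lemma prod_term_ev0 m n c : exists K : nat, forall k, (K <= k)%N -> prod_term m n c k = 0.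
Proof.
have [K h] := io_lower_nat w1 w2 c; exists K => k /h e.
by rewrite /prod_term e (lin0 (tm_linr (v_ 0) _)) scaler0.
Qed.

Lemma rprod_term_ev0 m n c : exists K : nat, forall k, (K <= k)%N -> rprod_term m n c k = 0.
Proof.
have [K h] := @modes_lower R V g W2 g_linear g_omega (v_ 0) w2 ((- m - 1)%:~R - alpha).
exists K => k hk; rewrite /rprod_term [(- m - 1 - k%:Z)%:~R]rmorphB /= -pmulrn addrAC h //.
by rewrite (lin0 (io_linr Y w1 _)) scaler0.
Qed.

Lemma iterate_term_ev0 m n c : exists K : nat, forall k k', (K <= k + k')%N ->
  iterate_term m n c k k' = 0.
Proof.
have [c0 [_ h]] := iterate_modes_lower v_0 w1; exists (absz (- n - 1 - c0)%R).+1 => k k' hk.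
rewrite /iterate_term big1 ?scaler0 // => a _; rewrite big1 // => b _.
by rewrite h ?(lin0 (io_linl Y w2 _)) ?scaler0 //; lia.
Qed.

(** [io_jacobi] is the value of this identity at log x_2 = l2. Powers of z_2 = - rho = e^l2 and of
    l2 are turned into shifts of monomials in x_2, and [gev_inj] removes the evaluation. *)
Lemma modes_dual w' m n : graded_dual (@tm_gr _ _ _ W3) w' ->
  exists K0 : nat, forall K c, (K0 <= K)%N ->
  \sum_(k < K) w' (prod_term m n c k) - \sum_(k < K) w' (rprod_term m n c k)
  = \sum_(k < K) \sum_(k' < K) w' (iterate_term m n c k k').
Proof.
move=> hw'.
have [a0 hA] := prod_coef_upper Y g_linear g_omega alpha v_ w1 w2 hw'.
have [b0 hB] := rprod_coef_lower Y g_linear g_omega alpha v_ w1 w2 hw'.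
have [c0 [c00 hC]] := iterate_modes_lower v_0 w1.
(* One cutoff for all the sums over k and k', independent of the monomial [c], as the comparison of
   coefficients demands. *)
pose K0 := (absz a0 + absz b0 + absz c0 + absz m + absz n + 5)%N.
exists K0 => K c hK.
pose cA := prod_coef Y alpha v_ w1 w2 w'; pose cB := rprod_coef Y alpha v_ w1 w2 w'.
pose cC := iterate_coef Y v_ w1 w2 w'.
have fA i : fsupp (cA i) by exact: prod_coef_fin.
have fB i : fsupp (cB i) by exact: io_coef_fin.
have fC j i : fsupp (cC j i) by exact: io_coef_fin.
pose GA k c := binom n%:~R k * (-1) ^+ k * gshift k%:R 0 (cA (k%:Z - m - n - 1)) c.
pose GB k c := binom n%:~R k * (-1) ^ (n - k%:Z) * gshift (n - k%:Z)%:~R 0 (cB (- m - 1 - k%:Z)) c.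
pose GC k k' j a c := binom m%:~R k * (binomc alpha k' (j - a)%N / a`!%:R) *
  gshift ((m - k%:Z)%:~R + alpha - k'%:R) a (cC j (- n - 1 - k%:Z - k'%:Z)) c.
have fGA k : fsupp (GA k) by apply/fsuppZ/fsupp_shift.
have fGB k : fsupp (GB k) by apply/fsuppZ/fsupp_shift.
have fGC k k' j a : fsupp (GC k k' j a) by apply/fsuppZ/fsupp_shift.
pose SC k k' c := \sum_(j < d) \sum_(a < j.+1) GC k k' j a c.
have fSC k k' : fsupp (SC k k').
  apply: (@fsupp_sum R d (fun j c => \sum_(a < j.+1) GC k k' j a c)) => j.
  by apply: (@fsupp_sum R j.+1 (fun a c => GC k k' j a c)).
pose Sk k c := \sum_(k' < K) SC k k' c.
have fSk k : fsupp (Sk k) by apply: (@fsupp_sum R K (fun k' c => SC k k' c)).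
pose FF c := \sum_(k < K) GA k c + -1 * (\sum_(k < K) GB k c) + -1 * \sum_(k < K) Sk k c.
have fSA := @fsupp_sum R K GA fGA; have fSB := @fsupp_sum R K GB fGB.
have fSS := @fsupp_sum R K Sk fSk.
have FF0 c' : FF c' = 0.
  move: c'; apply: gev_inj; first by apply: fsuppD; [apply: fsuppD|]; rewrite //; apply: fsuppZ.
  move=> rho rho0; set l2 := _ + _.
  rewrite /FF gevD; [|by apply: fsuppD => //; apply: fsuppZ|exact: fsuppZ].
  rewrite gevD //; last exact: fsuppZ.
  rewrite !gevZ // (gev_sum K l2 fGA) (gev_sum K l2 fGB) (gev_sum K l2 fSk).
  have el : cexp l2 = - rho%:C by rewrite /l2 cexpD cexp_bpi cexp_ln // mulrN1.
  have J := @io_jacobi R V g W1 W2 W3 Y g_linear g_omega d alpha v_ v_0 g_v w1 w2 w' hw' rho rho0 m n.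
  rewrite /= -/l2 -/cA -/cB -/cC in J.
  have e1 : phiA rho%:C (fun i => gev (cA i) l2) m n = \sum_(k < K) gev (GA k) l2.
    rewrite /phiA (@nsumE _ _ K) => [|k hk]; last first.
      by rewrite gev0 ?mulr0 // => c'; apply: hA; move: hK hk; rewrite /K0; clear; lia.
    apply: eq_bigr => k _; rewrite /GA gevZ; last exact: fsupp_shift.
    rewrite gev_shift // /mon /= expr0 mulr1 cexpMn el [(- rho%:C) ^+ k]exprNn.
    (* The sign in the delta function cancels that of z_2^k = (- rho)^k. *)
    have : (-1) ^+ k * (-1) ^+ k = 1 :> C by rewrite -exprMn mulrNN mulr1 expr1n.
    move: ((-1) ^+ k) => s hs.
    transitivity (s * s * (binom n%:~R k * rho%:C ^+ k * gev (cA (k%:Z - m - n - 1)) l2)); last by ring.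
    by rewrite hs mul1r.
  have zN (i : int) : (-1) ^ i * (- rho%:C) ^ i = rho%:C ^ i :> C.
    by rewrite -exprzMl ?mulrNN ?mul1r // unitfE ?oppr_eq0 ?oner_eq0 // (inj_eq (@complexI R)) gt_eqF.
  have e2 : psi rho%:C (fun i => gev (cB i) l2) m n = \sum_(k < K) gev (GB k) l2.
    rewrite /psi (@nsumE _ _ K) => [|k hk]; last first.
      by rewrite gev0 ?mulr0 // => c'; apply: hB; rewrite /K0 in hK; lia.
    apply: eq_bigr => k _; rewrite /GB gevZ; last exact: fsupp_shift.
    rewrite gev_shift // /mon /= expr0 mulr1 cexpMz el -(zN (n - k%:Z)).
    by rewrite !mulrA.
  have e3 : psi (- rho%:C) (twist_iterate rho d alpha (fun j i => gev (cC j i) l2)) n m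
      = \sum_(k < K) gev (Sk k) l2.
    have hCc j (i : int) : i < c0 -> gev (cC j i) l2 = 0.
      by move=> hi; apply: gev0 => c'; rewrite /cC /iterate_coef hC // (lin0 (io_linl Y w2 c')) (scal0 hw'.1).
    rewrite /psi (@nsumE _ _ K) => [|k hk]; last first.
      rewrite (@twist_iterateE R rho rho0 d alpha _ c0 c00 hCc _ 0) ?big_ord0 ?mulr0 //.
      by rewrite /K0 in hK; lia.
    apply: eq_bigr => k _.
    rewrite (@twist_iterateE R rho rho0 d alpha _ c0 c00 hCc _ K); last by rewrite /K0 in hK; lia.
    rewrite /Sk (@gev_sum R K (fun k' c => SC k k' c)) // mulr_sumr; apply: eq_bigr => k' _.
    rewrite /SC (@gev_sum R d (fun j c => \sum_(a < j.+1) GC k k' j a c)); last first.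
      by move=> j; apply: (@fsupp_sum R j.+1 (fun a c => GC k k' j a c)).
    rewrite mulr_sumr; apply: eq_bigr => j _.
    rewrite (@gev_sum R j.+1 (fun a c => GC k k' j a c)) //.
    rewrite /twist_coef mulr_suml mulr_suml mulr_sumr; apply: eq_bigr => a _.
    rewrite /GC gevZ; last exact: fsupp_shift.
    rewrite gev_shift // /mon /= !mulrDl !cexpD cexpMz mulNr cexpN cexpMn el -/l2; ring.
  move: J; rewrite e1 e2 e3 => <-; ring.
have := FF0 c; rewrite /FF => /eqP; rewrite !mulN1r subr_eq0 => /eqP h.
transitivity (\sum_(k < K) GA k c - \sum_(k < K) GB k c).
  by congr (_ - _); apply: eq_bigr => k _;
    rewrite /prod_term /rprod_term (scalZ hw'.1) /GA /GB /gshift /= subn0.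
rewrite h; apply: eq_bigr => k _; apply: eq_bigr => k' _.
rewrite /iterate_term (scalZ hw'.1) (scal_sum _ _ _ hw'.1).
pose X (a b : nat) : C := binom m%:~R k * (binomc alpha k' b / a`!%:R * cC (a + b)%N (- n - 1 - k%:Z - k'%:Z)
   (c.1 - ((m - k%:Z)%:~R + alpha - k'%:R), (c.2 - a)%N)).
have X0 a b : (d <= a + b)%N -> X a b = 0.
  move=> h'; rewrite /X /cC /iterate_coef v_0 // (lin0 (tm_linl w1 _)) (lin0 (io_linl Y w2 _)).
  by rewrite (scal0 hw'.1) !mulr0.
transitivity (\sum_(j < d) \sum_(a < j.+1) (if (a <= c.2)%N then X a (j - a)%N else 0)).
  apply: eq_bigr => j _; apply: eq_bigr => a _; rewrite /GC /gshift /X.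
  by rewrite (subnKC (leq_ord a)); case: ifP => _; rewrite ?mulr0 // [RHS]mulrA.
rewrite chain_reindex // mulr_sumr; apply: eq_bigr => a _.
rewrite (scal_sum _ _ _ hw'.1) mulr_sumr; apply: eq_bigr => b _.
rewrite (scalZ hw'.1) /X /cC /iterate_coef; congr (_ * (_ * w' (Y _ _ (_, _)))); ring.
Qed.

(** By truncation each sum is finite already in W_3, so the functionals of [modes_dual] can be
    pulled out and [tm_separates] applies. *)
Lemma io_modes m n c : nsum (prod_term m n c) - nsum (rprod_term m n c)
  = nsum (fun k => nsum (iterate_term m n c k)).
Proof.
have [K1 h1] := prod_term_ev0 m n c; have [K2 h2] := rprod_term_ev0 m n c.
have [K3 h3] := iterate_term_ev0 m n c.
apply/eqP; rewrite -subr_eq0; apply/eqP; apply: (@tm_separates _ _ _ W3) => w' hw'.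
have [K0 h] := modes_dual m n hw'; pose K := (K0 + K1 + K2 + K3)%N.
have kK : [/\ (K0 <= K)%N, (K1 <= K)%N, (K2 <= K)%N & (K3 <= K)%N] by split; rewrite /K; lia.
have [k0 k1 k2 k3] := kK.
rewrite (@nsumE _ (prod_term m n c) K); last by move=> k /(leq_trans k1)/h1.
rewrite (@nsumE _ (rprod_term m n c) K); last by move=> k /(leq_trans k2)/h2.
have e3 k : nsum (iterate_term m n c k) = \sum_(k' < K) iterate_term m n c k k'.
  by apply: nsumE => k' hk'; apply: h3; move: (leq_trans k3 hk'); lia.
rewrite (@nsumE _ _ K); last first.
  move=> k hk; rewrite e3 big1 // => k' _; apply: h3; move: (leq_trans k3 hk); lia.
rewrite !(scalB hw'.1) !(scal_sum _ _ _ hw'.1) h //.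
apply/eqP; rewrite subr_eq0; apply/eqP; apply: eq_bigr => k _.
by rewrite e3 (scal_sum _ _ _ hw'.1).
Qed.

End Modes.

(** * Coefficients of formal series *)

Section Representation.
Variable M : nmodType.

(* [f = \sum_i c_i X^(E i)] with pairwise distinct exponents. *)
Definition rep (I : Type) (W : nmodType) (f : M -> W) (E : I -> M) (c : I -> W) :=
  [/\ injective E, forall i, f (E i) = c i & forall m, f m <> 0 -> exists i, m = E i].

Lemma fsum_rep (I : choiceType) (W : nmodType) (c : I -> W) (e : I -> M) :
  injective e -> rep (fsum c e) e c.
Proof.
move=> ei; split=> // [i|m hm].
  rewrite /fsum (@fsbig_list _ _ _ [:: i]) ?big_seq1 //.
    by move=> j; rewrite inE => /eqP ->.
  by move=> j /= /ei ->; rewrite inE eqxx.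
apply: contrapT => h; apply: hm; rewrite /fsum (@fsbig_list _ _ _ [::]) ?big_nil // => i /= e1.
by exfalso; apply: h; exists i.
Qed.

Lemma rep_id (W : nmodType) (f : M -> W) : rep f id f.
Proof. by split=> // m _; exists m. Qed.

Lemma rep_scale (K : pzRingType) (W : lmodType K) (I : Type) (h : M -> W) (E : I -> M) c (a : K) :
  rep h E c -> rep (fun m => a *: h m) E (fun i => a *: c i).
Proof.
move=> [h1 h2 h3]; split=> // [i|m hm]; first by rewrite h2.
by apply: h3 => e; apply: hm; rewrite e scaler0.
Qed.

Section Apply.
Variables (I J : eqType) (U W : nmodType) (A : U -> M -> W) (f : M -> U).
Variables (E : I -> M) (c : I -> U) (E' : J -> M) (A' : U -> J -> W).
Hypotheses (rf : rep f E c) (rA : forall u, rep (A u) E' (A' u)) (A'0 : forall j, A' 0 j = 0).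

(** The sum over pairs of exponents becomes one over any list of pairs of indices that contains all
    nonzero contributions. *)
Lemma fapply_rep m (r : seq (I * J)) : uniq r -> (forall p, p \in r -> E p.1 + E' p.2 = m) ->
  (forall p, E p.1 + E' p.2 = m -> p \notin r -> A' (c p.1) p.2 = 0) ->
  fapply A f m = \sum_(p <- r) A' (c p.1) p.2.
Proof.
have [EI fE fS] := rf => ur hr hn.
pose h (p : I * J) := (E p.1, E' p.2).
have [E'I _ _] := rA 0.
have hI : injective h by move=> [i j] [i' j'] [/EI -> /E'I ->].
have AE u j : A u (E' j) = A' u j by have [_ + _] := rA u; apply.
rewrite /fapply (@fsbig_list _ _ _ (map h r)); last first.
- move=> [x y] /= xy nr; apply: contrapT => hA.
  have [_ _ /(_ _ hA)[j yj]] := rA (f x).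
  have [i xi] : exists i, x = E i.
    by apply: fS => e; apply: hA; rewrite e yj AE A'0.
  apply: hA; rewrite xi yj fE AE; apply: (hn (i, j)); first by rewrite /= -xi -yj.
  by apply: contra nr => ir; apply/mapP; exists (i, j); rewrite // /h xi yj.
- by move=> p /mapP[q /hr <- ->].
- by rewrite map_inj_uniq.
by rewrite big_map; apply: eq_bigr => p _; rewrite /h /= fE AE.
Qed.

Lemma fapply_rep_inj : injective (fun p : I * J => E p.1 + E' p.2) ->
  rep (fapply A f) (fun p : I * J => E p.1 + E' p.2) (fun p => A' (c p.1) p.2).
Proof.
move=> hI; split=> // [p|m hm].
  rewrite (@fapply_rep _ [:: p]) ?big_seq1 //.
    by move=> q; rewrite inE => /eqP ->.
  by move=> q /hI ->; rewrite inE eqxx.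
apply: contrapT => h; apply: hm; rewrite (@fapply_rep _ [::]) ?big_nil // => p e.
by exfalso; apply: h; exists p.
Qed.

End Apply.

Lemma fmul_monomial_rep (K : pzRingType) (W : lmodType K) (J : eqType) (h : M -> W)
    (E' : J -> M) (h' : J -> W) (e : M) : injective (fun m => e + m) -> rep h E' h' ->
  rep (fmul (fmonomial K e) h) (fun j => e + E' j) h'.
Proof.
move=> eI rh; have [E'I _ _] := rh.
have r1 : rep (fmonomial K e) (fun _ : unit => e) (fun=> 1).
  split=> [[] []//|_|m]; first by rewrite /fmonomial eqxx.
  by rewrite /fmonomial; case: eqP => // -> _; exists tt.
have := @fapply_rep_inj unit J K W (fun a m => a *: h m) _ _ _ E' (fun a j => a *: h' j) r1
  (fun a => rep_scale a rh) (fun j => scale0r _).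
case=> [[[] j] [[] j'] /eI/E'I /= -> //|_ h2 h3]; split=> [j j' /eI/E'I //|j|m hm].
  by have := h2 (tt, j); rewrite /= scale1r.
by have [[[] j] em] := h3 _ hm; exists j.
Qed.

End Representation.

(** * Exponents in three variables *)

Section LMonos.
Variable R : realType.
Local Notation C := R[i].
Implicit Types (a b : lmono R) (m : lmonos R 3).

Lemma lmonoP a b : a.1 = b.1 -> a.2 = b.2 -> a = b.
Proof. by case: a b => [? ?] [? ?] /= -> ->. Qed.

Lemma lmD1 a b : (a + b).1 = a.1 + b.1. Proof. by []. Qed.
Lemma lmD2 a b : (a + b).2 = (a.2 + b.2)%N. Proof. by []. Qed.
Lemma lm01 : (0 : lmono R).1 = 0. Proof. by []. Qed.
Lemma lm02 : (0 : lmono R).2 = 0%N. Proof. by []. Qed.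
Definition lmE := (lmD1, lmD2, lm01, lm02).

Lemma lm3P m m' : m x0 = m' x0 -> m x1 = m' x1 -> m x2 = m' x2 -> m = m'.
Proof.
move=> h0 h1 h2; apply/ffunP => -[[|[|[|//]]] i].
- by have -> : Ordinal i = x0 by exact: val_inj.
- by have -> : Ordinal i = x1 by exact: val_inj.
- by have -> : Ordinal i = x2 by exact: val_inj.
Qed.

Lemma addE m m' (i : 'I_3) : (m + m') i = m i + m' i. Proof. by rewrite ffunE. Qed.

Lemma at_varE (i j : 'I_3) a : at_var i a j = if j == i then a else 0.
Proof. by rewrite ffunE. Qed.

Lemma x01 : (x0 == x1) = false. Proof. by []. Qed.
Lemma x02 : (x0 == x2) = false. Proof. by []. Qed.
Lemma x10 : (x1 == x0) = false. Proof. by []. Qed.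
Lemma x12 : (x1 == x2) = false. Proof. by []. Qed.
Lemma x20 : (x2 == x0) = false. Proof. by []. Qed.
Lemma x21 : (x2 == x1) = false. Proof. by []. Qed.
Definition at3 := (addE, at_varE, eqxx, x01, x02, x10, x12, x20, x21).

Lemma lmono_addI a : injective (fun b : lmono R => a + b).
Proof.
move=> b b' h; apply: lmonoP.
  by have := congr1 fst h; rewrite !lmD1 => /addrI.
by have := congr1 snd h; rewrite !lmD2 => /addnI.
Qed.

Lemma lmonos_addI m : injective (fun m' => m + m').
Proof.
move=> m1 m2 h; have hi i : m1 i = m2 i.
  apply: (@lmono_addI (m i)).
  by have := congr1 (fun m' : lmonos R 3 => m' i) h; rewrite !addE.
exact: lm3P.
Qed.

Lemma at_var_inj (i : 'I_3) : injective (@at_var R 3 i).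
Proof. by move=> a b /(congr1 (fun m : lmonos R 3 => m i)); rewrite !at_varE eqxx. Qed.

Lemma in_var_rep (W : nmodType) (i : 'I_3) (s : lmono R -> W) :
  rep (in_var i s) (@at_var R 3 i) s.
Proof. exact/fsum_rep/at_var_inj. Qed.

Lemma at_var2_inj (i j : 'I_3) : i != j ->
  injective (fun p : lmono R * lmono R => at_var i p.1 + at_var j p.2 : lmonos R 3).
Proof.
move=> ij [a b] [a' b'] /= h.
have := congr1 (fun m : lmonos R 3 => m i) h; rewrite !addE !at_varE eqxx (negbTE ij) !addr0 => ->.
have := congr1 (fun m : lmonos R 3 => m j) h; rewrite !addE !at_varE eqxx eq_sym (negbTE ij) !add0r.
by move=> ->.
Qed.

Definition dexp (a b c : 'I_3) (p : int * nat) : lmonos R 3 :=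
  xpow a (- p.1%:~R - 1) + xpow b (p.1%:~R - p.2%:R) + xpow c p.2%:R.

Lemma natC_inj : injective (fun n : nat => n%:R : C).
Proof. by move=> n n' /eqP; rewrite eqr_nat => /eqP. Qed.

Lemma intC_inj : injective (fun n : int => n%:~R : C).
Proof. by move=> n n' /eqP; rewrite eqr_int => /eqP. Qed.

Lemma fdelta_rep (a b c : 'I_3) (s t : C) : a != b -> a != c -> b != c ->
  rep (fdelta a b c s t) (dexp a b c)
    (fun p => binom p.1%:~R p.2 * s ^ (p.1 - p.2%:Z) * t ^+ p.2).
Proof.
move=> ab ac bc; apply: fsum_rep => -[q k] [q' k'] h.
have := congr1 (fun m : lmonos R 3 => (m a).1) h; have := congr1 (fun m : lmonos R 3 => (m c).1) h.
rewrite !addE !at_varE !eqxx (negbTE ab) (negbTE ac) ![c == _]eq_sym (negbTE ac) (negbTE bc) !lmE /=.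
rewrite !addr0 !add0r => /natC_inj ->.
by move=> /addIr/oppr_inj/intC_inj ->.
Qed.

End LMonos.

(** * Coefficients of the two sides *)

Section Coefficients.
Variables (R : realType) (U1 U2 : lmodType R[i]).
Local Notation C := R[i].
Implicit Types m : lmonos R 3.
Variable alpha : C.

Section Product.
Variables (T : U1 -> lmono R -> U2) (s : lmono R -> U1).
Hypothesis T0 : forall b, T 0 b = 0.
Variables (i j : 'I_3) (sg tg : C).
Let F := fmul (fmonomial C (xpow x1 alpha)) (fapply (fun w => in_var i (T w)) (in_var j s)).
Let EF (p : lmono R * lmono R) : lmonos R 3 := xpow x1 alpha + (at_var j p.1 + at_var i p.2).
Let rF : j != i -> rep F EF (fun p => T (s p.1) p.2).
Proof.
move=> ji; apply: fmul_monomial_rep; first exact: lmonos_addI.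
exact: (fapply_rep_inj (in_var_rep j s) (fun w => in_var_rep i (T w)) T0 (at_var2_inj ji)).
Qed.

Let lhs b c := fmul (fdelta x0 b c sg tg) F.

Lemma lhs_zero b c m : j != i -> x0 != i -> x0 != j -> x0 != b -> x0 != c -> b != c ->
  (forall q : int, m x0 <> (- q%:~R - 1, 0%N)) -> lhs b c m = 0.
Proof.
move=> ji i0 j0 b0 c0 bc hm.
rewrite /lhs /fmul (fapply_rep (fdelta_rep sg tg b0 c0 bc)
  (fun a => rep_scale a (rF ji)) (fun _ => scale0r _) (r := [::])) ?big_nil //.
move=> [[q k] [x y]] h _; exfalso; apply: (hm q); rewrite -h.
rewrite /dexp /EF !addE !at_varE (negbTE i0) (negbTE j0) (negbTE b0) (negbTE c0) x01 eqxx !addr0.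
by [].
Qed.

(** The variable x_0 occurs in the delta function alone, so its exponent fixes q; only the binomial
    index k stays free, and truncation bounds it. *)
Lemma lhs1_val m (q : int) K : i = x1 -> j = x2 -> m x0 = (- q%:~R - 1, 0%N) ->
  (forall k, (K <= k)%N -> s ((m x2).1 - k%:R, (m x2).2) = 0) ->
  lhs x1 x2 m = \sum_(k < K) (binom q%:~R k * sg ^ (q - k%:Z) * tg ^+ k) *:
    T (s ((m x2).1 - k%:R, (m x2).2)) ((m x1).1 - (q%:~R - k%:R) - alpha, (m x1).2).
Proof.
move=> ei ej hm hK.
pose pr k : (int * nat) * (lmono R * lmono R) :=
  ((q, k), (((m x2).1 - k%:R, (m x2).2), ((m x1).1 - (q%:~R - k%:R) - alpha, (m x1).2))).
have ji : j != i by rewrite ei ej.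
rewrite /lhs /fmul (fapply_rep (@fdelta_rep R x0 x1 x2 sg tg isT isT isT)
  (fun a => rep_scale a (rF ji)) (fun _ => scale0r _) (r := map pr (iota 0 K))).
- by rewrite big_map -{1}[K]subn0 -/(index_iota 0 K) big_mkord.
- by rewrite map_inj_uniq ?iota_uniq // => k k' [].
- move=> _ /mapP[k _ ->]; rewrite /dexp /EF /= ei ej.
  apply: lm3P; rewrite !at3 ?hm; apply: lmonoP; rewrite !lmE /= ?addn0 ?add0n //; ring.
move=> [[q' k] [x y]]; rewrite /dexp /EF /= ei ej => h nin.
have hq : q' = q.
  have := congr1 (fun m : lmonos R 3 => (m x0).1) h; rewrite hm !at3 !lmE /= !addr0.
  by move=> /addIr/oppr_inj/intC_inj.
have hx : x = ((m x2).1 - k%:R, (m x2).2).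
  by rewrite -h !at3; apply: lmonoP; rewrite !lmE /= ?addn0 ?add0n //; ring.
have hy : y = ((m x1).1 - (q%:~R - k%:R) - alpha, (m x1).2).
  by rewrite -h !at3 hq; apply: lmonoP; rewrite !lmE /= ?addn0 ?add0n //; ring.
rewrite hx hK ?T0 ?scaler0 // leqNgt; apply: contra nin => kK.
by apply/mapP; exists k; rewrite ?mem_iota // /pr hx hy hq.
Qed.

Lemma lhs2_val m (q : int) K : i = x2 -> j = x1 -> m x0 = (- q%:~R - 1, 0%N) ->
  (forall k, (K <= k)%N -> s ((m x1).1 - k%:R - alpha, (m x1).2) = 0) ->
  lhs x2 x1 m = \sum_(k < K) (binom q%:~R k * sg ^ (q - k%:Z) * tg ^+ k) *:
    T (s ((m x1).1 - k%:R - alpha, (m x1).2)) ((m x2).1 - (q%:~R - k%:R), (m x2).2).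
Proof.
move=> ei ej hm hK.
pose pr k : (int * nat) * (lmono R * lmono R) :=
  ((q, k), (((m x1).1 - k%:R - alpha, (m x1).2), ((m x2).1 - (q%:~R - k%:R), (m x2).2))).
have ji : j != i by rewrite ei ej.
rewrite /lhs /fmul (fapply_rep (@fdelta_rep R x0 x2 x1 sg tg isT isT isT)
  (fun a => rep_scale a (rF ji)) (fun _ => scale0r _) (r := map pr (iota 0 K))).
- by rewrite big_map -{1}[K]subn0 -/(index_iota 0 K) big_mkord.
- by rewrite map_inj_uniq ?iota_uniq // => k k' [].
- move=> _ /mapP[k _ ->]; rewrite /dexp /EF /= ei ej.
  apply: lm3P; rewrite !at3 ?hm; apply: lmonoP; rewrite !lmE /= ?addn0 ?add0n //; ring.
move=> [[q' k] [x y]]; rewrite /dexp /EF /= ei ej => h nin.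
have hq : q' = q.
  have := congr1 (fun m : lmonos R 3 => (m x0).1) h; rewrite hm !at3 !lmE /= !addr0.
  by move=> /addIr/oppr_inj/intC_inj.
have hx : x = ((m x1).1 - k%:R - alpha, (m x1).2).
  by rewrite -h !at3; apply: lmonoP; rewrite !lmE /= ?addn0 ?add0n //; ring.
have hy : y = ((m x2).1 - (q%:~R - k%:R), (m x2).2).
  by rewrite -h !at3 hq; apply: lmonoP; rewrite !lmE /= ?addn0 ?add0n //; ring.
rewrite hx hK ?T0 ?scaler0 // leqNgt; apply: contra nin => kK.
by apply/mapP; exists k; rewrite ?mem_iota // /pr hx hy hq.
Qed.

End Product.

Section Iterate.
Variables (V : lmodType C) (P : V -> nat -> V) (c : nat -> V).
Variables (T1 : V -> lmono R -> U1) (T2 : U1 -> lmono R -> U2).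
Hypotheses (P0 : forall a, P 0 a = 0) (T10 : forall b, T1 0 b = 0) (T20 : forall b, T2 0 b = 0).

Definition logx (v : V) : lmono R -> V := fun b => if b.1 == alpha then P v b.2 else 0.

Let bpl : lmonos R 3 -> V := fapply (fun v => in_var x2 (logx v))
  (fsum c (fun k : nat => xpow x0 k%:R + xpow x2 (- k%:R))).
Let EB (p : nat * nat) : lmonos R 3 := xpow x0 p.1%:R + xpow x2 (- p.1%:R) + at_var x2 (alpha, p.2).

Let logx_rep v : rep (in_var x2 (logx v)) (fun a => at_var x2 (alpha, a)) (P v).
Proof.
have [h1 h2 h3] := in_var_rep x2 (logx v); split=> [a a' /h1[]//|a|m hm].
  by rewrite h2 /logx eqxx.
have [[r a] hb] := h3 _ hm; rewrite hb h2 /logx /= in hm.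
by move: hb hm; case: eqP => // -> -> _; exists a.
Qed.

Let EB_inj : injective EB.
Proof.
move=> [k a] [k' a'] h; have := congr1 (fun m : lmonos R 3 => (m x0).1) h.
rewrite /EB !at3 !lmE /= !addr0 => /natC_inj ->.
by have := congr1 (fun m : lmonos R 3 => (m x2).2) h; rewrite /EB !at3 !lmE /= !add0n => ->.
Qed.

Let bpl_rep : rep bpl EB (fun p => P (c p.1) p.2).
Proof.
have rf : rep (fsum c (fun k : nat => xpow x0 k%:R + xpow x2 (- k%:R) : lmonos R 3))
    (fun k : nat => xpow x0 k%:R + xpow x2 (- k%:R) : lmonos R 3) c.
  apply: fsum_rep => k k' h; have := congr1 (fun m : lmonos R 3 => (m x0).1) h.
  by rewrite !at3 !lmE /= !addr0 => /natC_inj.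
exact: (fapply_rep_inj rf logx_rep P0 EB_inj).
Qed.

Let EG (p : (nat * nat) * lmono R) : lmonos R 3 := EB p.1 + at_var x0 p.2.

Let EG_inj : injective EG.
Proof.
move=> [[k a] b] [[k' a'] b'] h.
have := congr1 (fun m : lmonos R 3 => (m x2).1) h; rewrite /EG /EB !at3 !lmE /= !addr0 !add0r.
move=> /addIr/oppr_inj/natC_inj /= ek.
have := congr1 (fun m : lmonos R 3 => (m x2).2) h; rewrite /EG /EB !at3 !lmE /= !addn0 !add0n => ea.
have := congr1 (fun m : lmonos R 3 => m x0) h; rewrite /EG /EB !at3 /= ek ea => /lmono_addI /= ->.
by [].
Qed.

Let G1_rep : rep (fapply (fun v => in_var x0 (T1 v)) bpl) EG (fun p => T1 (P (c p.1.1) p.1.2) p.2).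
Proof. exact: (fapply_rep_inj bpl_rep (fun v => in_var_rep x0 (T1 v)) T10 EG_inj). Qed.

Let G := fapply (fun w => in_var x2 (T2 w)) (fapply (fun v => in_var x0 (T1 v)) bpl).

(** The index a is the power of log x_2 contributed by x_2^N. *)
Definition iter_coef (b0 b2 : lmono R) (k : nat) : U2 := \sum_(a < b2.2.+1)
  T2 (T1 (P (c k) a) (b0.1 - k%:R, b0.2)) (b2.1 - alpha + k%:R, (b2.2 - a)%N).

Let G_zero m : m x1 <> 0 -> G m = 0.
Proof.
move=> hm; rewrite /G (fapply_rep G1_rep (fun w => in_var_rep x2 (T2 w)) T20 (r := [::])) ?big_nil //.
by move=> [[[k a] b] c'] h; exfalso; apply: hm; rewrite -h /EG /EB /= !at3 !addr0.
Qed.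

Let G_val m K : m x1 = 0 ->
  (forall k a, (K <= k)%N -> T1 (P (c k) a) ((m x0).1 - k%:R, (m x0).2) = 0) ->
  G m = \sum_(k < K) iter_coef (m x0) (m x2) k.
Proof.
move=> hm hK; pose pr k a : ((nat * nat) * lmono R) * lmono R :=
  (((k, a), ((m x0).1 - k%:R, (m x0).2)), ((m x2).1 - alpha + k%:R, ((m x2).2 - a)%N)).
pose r := [seq pr k a | k <- iota 0 K, a <- iota 0 (m x2).2.+1].
rewrite /G (fapply_rep G1_rep (fun w => in_var_rep x2 (T2 w)) T20 (r := r)).
- rewrite /r big_allpairs_dep -{1}[K]subn0 -/(index_iota 0 K) big_mkord; apply: eq_bigr => k _.
  rewrite /iter_coef -(big_mkord xpredT (fun a => T2 (T1 (P (c k) a) ((m x0).1 - k%:R, (m x0).2))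
    ((m x2).1 - alpha + k%:R, ((m x2).2 - a)%N))) /index_iota subn0.
  by apply: eq_bigr => a _.
- apply: allpairs_uniq; rewrite ?iota_uniq //.
  by move=> [k a] [k' a'] _ _ /= [-> ->].
- move=> _ /allpairsP[[k a] [_ ha ->]].
  have {}ha : (a <= (m x2).2)%N by move: ha; rewrite mem_iota add0n ltnS.
  rewrite /pr /EG /EB /=; apply: lm3P; rewrite !at3 ?hm; apply: lmonoP; rewrite !lmE /= ?addn0 ?add0n //; first [ring | by rewrite subnKC].
move=> [[[k a] b] c']; rewrite /EG /EB /= => h nin.
have hb : b = ((m x0).1 - k%:R, (m x0).2).
  by rewrite -h !at3; apply: lmonoP; rewrite !lmE /= ?addn0 ?add0n //; ring.
have h2 : (m x2).2 = (a + c'.2)%N by rewrite -h !at3 !lmE /= ?add0n ?addn0.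
have hc : c' = ((m x2).1 - alpha + k%:R, ((m x2).2 - a)%N).
  apply: lmonoP; last by rewrite /= h2 addKn.
  by rewrite -h !at3 !lmE /=; ring.
rewrite hb hK ?T20 // leqNgt; apply: contra nin => kK.
apply/allpairsP; exists (k, a); split; first by rewrite mem_iota.
  by rewrite mem_iota /= ?add0n ltnS h2 leq_addr.
by rewrite /pr /= -hb -hc.
Qed.

Lemma rhs_zero m : (forall q : int, m x1 <> (- q%:~R - 1, 0%N)) ->
  fmul (fdelta x1 x2 x0 1 1) G m = 0.
Proof.
move=> hm; rewrite /fmul (fapply_rep (@fdelta_rep R x1 x2 x0 1 1 isT isT isT)
  (fun a => rep_scale a (rep_id G)) (fun _ => scale0r _) (r := [::])) ?big_nil //.
move=> [[q k] m'] /= h _; rewrite G_zero ?scaler0 // => e; apply: (hm q).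
by rewrite -h /dexp !at3 e !addr0.
Qed.

(** On this side x_1 occurs in the delta function alone, so that its exponent fixes q. *)
Lemma rhs_val m (q : int) K : m x1 = (- q%:~R - 1, 0%N) ->
  (forall k k' a, (K <= k + k')%N ->
     T1 (P (c k') a) ((m x0).1 - k%:R - k'%:R, (m x0).2) = 0) ->
  fmul (fdelta x1 x2 x0 1 1) G m = \sum_(k < K) binom q%:~R k *:
    \sum_(k' < K) iter_coef ((m x0).1 - k%:R, (m x0).2) ((m x2).1 - (q%:~R - k%:R), (m x2).2) k'.
Proof.
move=> hm hK.
pose mk k : lmonos R 3 := at_var x0 ((m x0).1 - k%:R, (m x0).2)
  + at_var x2 ((m x2).1 - (q%:~R - k%:R), (m x2).2).
have mk0 k : mk k x0 = ((m x0).1 - k%:R, (m x0).2) by rewrite /mk !at3 addr0.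
have mk1 k : mk k x1 = 0 by rewrite /mk !at3 addr0.
have mk2 k : mk k x2 = ((m x2).1 - (q%:~R - k%:R), (m x2).2) by rewrite /mk !at3 add0r.
have Gmk k : G (mk k) = \sum_(k' < K) iter_coef ((m x0).1 - k%:R, (m x0).2)
     ((m x2).1 - (q%:~R - k%:R), (m x2).2) k'.
  rewrite (G_val (K := K) (mk1 k)) mk0 ?mk2 // => k' a hk'.
  by apply: hK; rewrite (leq_trans hk') // leq_addl.
pose pr k : (int * nat) * lmonos R 3 := ((q, k), mk k).
rewrite /fmul (fapply_rep (@fdelta_rep R x1 x2 x0 1 1 isT isT isT)
  (fun a => rep_scale a (rep_id G)) (fun _ => scale0r _) (r := map pr (iota 0 K))).
- rewrite big_map -{1}[K]subn0 -/(index_iota 0 K) big_mkord; apply: eq_bigr => k _ /=.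
  by rewrite exp1rz expr1n !mulr1 Gmk.
- by rewrite map_inj_uniq ?iota_uniq // => k k' [].
- move=> _ /mapP[k _ ->]; rewrite /dexp /pr /mk /=.
  apply: lm3P; rewrite !at3 ?hm; apply: lmonoP; rewrite !lmE /= ?addn0 ?add0n //; ring.
move=> [[q' k] m'] /= h nin.
have [m'1|m'1] := pselect (m' x1 = 0); last by rewrite G_zero ?scaler0.
have hq : q' = q.
  have := congr1 (fun m : lmonos R 3 => (m x1).1) h; rewrite hm /dexp !at3 m'1 !lmE /= !addr0.
  by move=> /addIr/oppr_inj/intC_inj.
have hm' : m' = mk k.
  apply: lm3P; rewrite ?mk0 ?mk1 ?mk2 // -h /dexp !at3 ?hq; apply: lmonoP; rewrite !lmE /= ?addn0 ?add0n //; ring.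
rewrite hm' Gmk big1 ?scaler0 // => k' _; rewrite /iter_coef big1 // => a _.
rewrite /= hK ?T20 // (leq_trans _ (leq_addr _ _)) // leqNgt; apply: contra nin => kK.
by apply/mapP; exists k; rewrite ?mem_iota // /pr hm' hq.
Qed.

End Iterate.
End Coefficients.

(** * Binomials of S + N, and the comparison of coefficients *)

(** S acts as alpha on every N^b u, and N raises b: this is the recursion that defines [binomc]. *)
Lemma op_binomE (R : realType) (V : voa R) (g S N : V -> V) (alpha : R[i]) (u : V) (d k : nat) :
  is_log g S N -> S u = alpha *: u -> iter d N u = 0 ->
  op_binom (fun v => S v + N v) k u = \sum_(b < d) binomc alpha k b *: iter b N u.
Proof.
move=> hL hu hd; have [[S_lin N_lin] _ _ _ _] := hL; elim: k => [|k IH].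
  case: d hd => [/= ->|d _]; first by rewrite big_ord0.
  rewrite big_ord_recl big1 ?addr0 /= ?scale1r // => b _.
  by rewrite scale0r.
have -> : op_binom (fun v => S v + N v) k.+1 u = (k.+1%:R)^-1 *: (S (op_binom (fun v => S v + N v) k u)
    + N (op_binom (fun v => S v + N v) k u) - k%:R *: op_binom (fun v => S v + N v) k u) by [].
rewrite IH; set W := \sum_(b < d) _.
have eS : S W = alpha *: W.
  rewrite /W (lin_sum _ _ _ S_lin) scaler_sumr; apply: eq_bigr => b _.
  by rewrite (linZ S_lin) (log_comm hL _ hu) !scalerA mulrC.
have eN : N W = \sum_(b < d) (if b : nat is j.+1 then binomc alpha k j else 0) *: iter b N u.
  rewrite /W (lin_sum _ _ _ N_lin); case: d hd {W eS IH} => [|d] hd; first by rewrite !big_ord0.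
  rewrite big_ord_recr big_ord_recl /= scale0r add0r (linZ N_lin) -iterS hd scaler0 addr0.
  by apply: eq_bigr => b _; rewrite (linZ N_lin).
rewrite eS eN addrAC -scalerBl /W scaler_sumr -big_split scaler_sumr; apply: eq_bigr => b _ /=.
by rewrite scalerA -scalerDl scalerA mulrC.
Qed.

Theorem proposition2p3 (R : realType) (V : voa R) (g S N : V -> V)
    (hg : voa_automorphism g) (hL : is_log g S N)
    (W1 : twisted_module (@id V)) (W2 W3 : twisted_module g)
    (Y : twisted_intertwining W1 W2 W3) (alpha : R[i])
    (halpha : 0 <= complex.Re alpha < 1)
    (u : V) (hu : gen_eigenspace g (cexp (twopii R * alpha)) u)
    (w1 : W1) (w2 : W2) :
  let x1alpha := fmonomial R[i] (xpow x1 alpha) in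
  let Y20 := fun w => in_var x1 (log_free (@tm_Y _ _ _ W2 u w)) in
  let Y30 := fun w => in_var x1 (log_free (@tm_Y _ _ _ W3 u w)) in
  let YW1 := fun v => in_var x0 (@tm_Y _ _ _ W1 v w1) in
  fmul (fdelta x0 x1 x2 1 (-1))
    (fmul x1alpha (fapply Y30 (in_var x2 (Y w1 w2))))
  \- fmul (fdelta x0 x2 x1 (-1) 1)
    (fmul x1alpha (fapply (fun w => in_var x2 (Y w1 w)) (Y20 w2)))
  =1 fmul (fdelta x1 x2 x0 1 1)
    (fapply (fun w => in_var x2 (Y w w2))
       (fapply YW1 (binom_pow_log S N alpha u))).
Proof.
move=> x1alpha Y20 Y30 YW1 M.
have [g_linear _ _ _ g_omega] := hg.
have [[_ N_lin] _ _ _ _] := hL.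
have Su := eigen_of_gen g_linear hL halpha hu.
have [d hd] := log_nil hL u.
pose v_ j := iter j N u.
have v_0 j : (d <= j)%N -> v_ j = 0.
  move=> dj; rewrite /v_ -(subnK dj) iterD hd.
  exact: (lin0 (iter_linear _ N_lin)).
have g_v j : g (v_ j) = cexp (twopii R * alpha) *:
    \sum_(k < d) (twopii R ^+ k / (k`!)%:R) *: v_ (j + k)%N.
  have hj : iter d N (v_ j) = 0 by rewrite /v_ -iterD -/(v_ (d + j)%N) v_0 ?leq_addr.
  rewrite (log_exp hL (log_comm hL j Su) hj); congr (_ *: _); apply: eq_bigr => k _.
  by rewrite /v_ -iterD addnC.
pose T3 (w : W3) := log_free (tm_Y u w).
pose T2 (w : W2) := Y w1 w.
have T30 b : T3 0 b = 0 by rewrite /T3 /log_free (lin0 (tm_linr u b)) if_same.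
have T20 b : T2 0 b = 0 by exact: (lin0 (io_linr Y w1 b)).
pose P (v : V) (a : nat) : V := (a`!%:R)^-1 *: iter a N v.
pose c (k : nat) := op_binom (fun v => S v + N v) k u.
pose T1 (v : V) := @tm_Y _ _ _ W1 v w1.
pose TY (w : W1) := Y w w2.
have P0 a : P 0 a = 0 by rewrite /P (lin0 (iter_linear a N_lin)) scaler0.
have T10 b : T1 0 b = 0 by exact: (lin0 (tm_linl w1 b)).
have TY0 b : TY 0 b = 0 by exact: (lin0 (io_linl Y w2 b)).
have Pc k a : P (c k) a = \sum_(b < d) (binomc alpha k b / a`!%:R) *: v_ (a + b)%N.
  rewrite /P /c (op_binomE k hL Su hd) (lin_sum _ _ _ (iter_linear a N_lin)) scaler_sumr.
  apply: eq_bigr => b _; rewrite (linZ (iter_linear a N_lin)) scalerA mulrC.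
  by rewrite /v_ iterD.
have lf3 (w : W3) b : log_free (tm_Y u w) b <> 0 -> b.2 = 0%N /\ exists n : int, b.1 = n%:~R - alpha.
  case: b => r k; rewrite /log_free /=; case: eqP => // -> h; split=> //.
  by have [] := @chain_mode0 R V g W3 d alpha v_ v_0 g_v w r 0 0 h.
have lf2 b : log_free (tm_Y u w2) b <> 0 -> b.2 = 0%N /\ exists n : int, b.1 = n%:~R - alpha.
  case: b => r k; rewrite /log_free /=; case: eqP => // -> h; split=> //.
  by have [] := @chain_mode0 R V g W2 d alpha v_ v_0 g_v w2 r 0 0 h.
pose L1 := fmul (fdelta x0 x1 x2 1 (-1))
  (fmul x1alpha (fapply Y30 (in_var x2 (Y w1 w2)))) M.
pose L2 := fmul (fdelta x0 x2 x1 (-1) 1)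
  (fmul x1alpha (fapply (fun w => in_var x2 (Y w1 w)) (Y20 w2))) M.
pose L3 := fmul (fdelta x1 x2 x0 1 1)
  (fapply (fun w => in_var x2 (Y w w2)) (fapply YW1 (binom_pow_log S N alpha u))) M.
change (L1 - L2 = L3).
have [K1 h1] := io_lower_nat Y w1 w2 (M x2).
(* An exponent of x_0 that is not an integer, or a power of log x_0, kills the left-hand terms
   through their delta functions and the right-hand term because W_1 is untwisted
   ([fixed_modes]). *)
have [[q hq]|n0] := pselect (exists q : int, M x0 = (- q%:~R - 1, 0%N)); last first.
  have {}n0 (q : int) : M x0 <> (- q%:~R - 1, 0%N) by move=> e; apply: n0; exists q.
  have -> : L1 = 0 by apply: (@lhs_zero R W3 W3 alpha T3 (Y w1 w2) T30 x1 x2).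
  have -> : L2 = 0 by apply: (@lhs_zero R W2 W3 alpha T2 (log_free (tm_Y u w2)) T20 x2 x1).
  rewrite subr0; apply/esym.
  have [[p hp]|n1] := pselect (exists p : int, M x1 = (- p%:~R - 1, 0%N)); last first.
    apply: (@rhs_zero R W1 W3 alpha V P c T1 TY P0 T10 TY0) => p e; apply: n1; by exists p.
  have z k k' a : (0 <= k + k')%N -> T1 (P (c k') a) ((M x0).1 - k%:R - k'%:R, (M x0).2) = 0.
    move=> _; apply: contrapT => h; have [n hn] := fixed_modes (@id_linear R V) (erefl _) h.
    apply: (n0 (- (n + k%:Z + k'%:Z) - 1)); apply: lmonoP; last exact: (congr1 snd hn).
    have := congr1 fst hn; rewrite /= => e.
    rewrite -[LHS](subrK k%:R) -[X in X + _](subrK k'%:R) e !(rmorphB, rmorphD, rmorphN) /= -!pmulrn; ring.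
  rewrite /L3.
  have := @rhs_val R W1 W3 alpha V P c T1 TY P0 T10 TY0 M p 0 hp z.
  by rewrite big_ord0.
have v1 := @lhs1_val R W3 W3 alpha T3 (Y w1 w2) T30 x1 x2 1 (-1) M q K1 erefl erefl hq h1.
(* An exponent of x_1 that is not an integer, or a power of log x_1, kills the right-hand term
   through its delta function and the left-hand ones because the log-free modes of [u] have
   exponents in Z - alpha. *)
have [[p hp]|n1] := pselect (exists p : int, M x1 = (- p%:~R - 1, 0%N)); last first.
  have {}n1 (p : int) : M x1 <> (- p%:~R - 1, 0%N) by move=> e; apply: n1; exists p.
  have bad (z n : int) : (M x1).1 - z%:~R - alpha = n%:~R - alpha -> (M x1).2 = 0%N -> False.
    move=> /addIr e e2; apply: (n1 (- (n + z) - 1)); apply: lmonoP => //=.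
    rewrite -[LHS](subrK z%:~R) e !(rmorphB, rmorphD, rmorphN) /=; ring.
  have -> : L1 = 0.
    rewrite [LHS]v1 big1 // => k _; rewrite (_ : T3 _ _ = 0) ?scaler0 //.
    apply: contrapT => /lf3[/= e2 [n e1]]; apply: (bad (q - k%:Z) n _ e2).
    by rewrite -e1 rmorphB /= -pmulrn.
  have -> : L2 = 0.
    have z k : (0 <= k)%N -> log_free (tm_Y u w2) ((M x1).1 - k%:R - alpha, (M x1).2) = 0.
      move=> _; apply: contrapT => /lf2[/= e2 [n e1]]; apply: (bad k%:Z n _ e2).
      by rewrite -e1 -pmulrn.
    have := @lhs2_val R W2 W3 alpha T2 (log_free (tm_Y u w2)) T20 x2 x1 (-1) 1 M q 0 erefl erefl hq z.
    by rewrite big_ord0.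
  rewrite subr0; apply/esym.
  exact: (@rhs_zero R W1 W3 alpha V P c T1 TY P0 T10 TY0).
have key := io_modes Y g_linear g_omega v_0 g_v w1 w2 p q (M x2).
have e1 : L1 = nsum (prod_term Y alpha v_ w1 w2 p q (M x2)).
  rewrite [LHS]v1 (@nsumE _ _ K1) => [|k hk]; last first.
    by rewrite /prod_term h1 // (lin0 (tm_linr _ _)) scaler0.
  apply: eq_bigr => k _; rewrite /prod_term /T3 /log_free hp /= exp1rz mulr1.
  congr (_ *: tm_Y _ _ (_, _)); rewrite !rmorphB /= -pmulrn; ring.
have [K2 h2] := @modes_lower R V g W2 g_linear g_omega u w2 ((M x1).1 - alpha).
have {}h2 k : (K2 <= k)%N -> log_free (tm_Y u w2) ((M x1).1 - k%:R - alpha, (M x1).2) = 0.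
  by move=> hk; rewrite /log_free addrAC h2 // if_same.
have e2 : L2 = nsum (rprod_term Y alpha v_ w1 w2 p q (M x2)).
  have v2 := @lhs2_val R W2 W3 alpha T2 (log_free (tm_Y u w2)) T20 x2 x1 (-1) 1 M q K2 erefl erefl hq h2.
  have ez k : tm_Y u w2 ((- p - 1 - k%:Z)%:~R - alpha, 0%N)
      = log_free (tm_Y u w2) ((M x1).1 - k%:R - alpha, (M x1).2).
    by rewrite hp /log_free /= !rmorphB /= rmorphN -pmulrn.
  rewrite [LHS]v2 (@nsumE _ _ K2) => [|k hk]; last first.
    by rewrite /rprod_term [tm_Y _ _ _]ez h2 // (lin0 (io_linr Y w1 _)) scaler0.
  apply: eq_bigr => k _; rewrite /rprod_term [tm_Y (v_ 0) _ _]ez /T2 expr1n mulr1.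
  by congr (_ *: Y _ _ (_, _)); rewrite rmorphB /= -pmulrn.
rewrite e1 e2 key.
have [K3 h3] := iterate_term_ev0 Y alpha v_0 w1 w2 p q (M x2).
have [c0 [_ h4]] := iterate_modes_lower v_0 w1.
pose K := (K3 + (absz (- q - 1 - c0)%R).+1)%N.
have z k k' a : (K <= k + k')%N -> T1 (P (c k') a) ((M x0).1 - k%:R - k'%:R, (M x0).2) = 0.
  move=> hk; rewrite /T1 Pc (lin_sum _ _ _ (tm_linl w1 _)) big1 // => b _.
  rewrite (linZ (tm_linl w1 _)) hq /=.
  have -> : - q%:~R - 1 - k%:R - k'%:R = (- q - 1 - k%:Z - k'%:Z)%:~R :> R[i].
    by rewrite !rmorphB /= rmorphN -!pmulrn.
  by rewrite h4 ?scaler0 //; move: hk; rewrite /K; clear; lia.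
have v3 := @rhs_val R W1 W3 alpha V P c T1 TY P0 T10 TY0 M p K hp z.
rewrite [RHS]v3 (@nsumE _ _ K) => [|k hk]; last first.
  by apply: nsum0 => k'; apply: h3; move: hk; rewrite /K; clear; lia.
apply: eq_bigr => k _; rewrite (@nsumE _ _ K) => [|k' hk']; last first.
  by apply: h3; move: hk'; rewrite /K; clear; lia.
rewrite scaler_sumr; apply: eq_bigr => k' _; congr (_ *: _).
apply: eq_bigr => a _; rewrite /TY /T1 Pc (lin_sum _ _ _ (tm_linl w1 _)) (lin_sum _ _ _ (io_linl Y w2 _)).
apply: eq_bigr => b _; rewrite (linZ (tm_linl w1 _)) (linZ (io_linl Y w2 _)) hq /=.
by congr (_ *: Y (tm_Y _ _ (_, _)) _ (_ - _ + _, _)); rewrite !rmorphB /= ?rmorphN -!pmulrn.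
Qed.
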